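(* Let $(X_k)_{k\ge 1}$ be i.i.d. real random variables, $S_n := X_1+\dots+X_n$, and let $(a_n)_{n\ge1}$ be a sequence of positive numbers such that $S_n/a_n$ converges weakly to the standard normal law $\varphi(x)\,dx$. Assume that $X_1$ is arithmetic with span $1$. Let $u(n,x)$ be the renewal mass function of the ladder variables process of $(S_n)$ and let $U$ be the distribution function of the renewal measure of the ladder heights process. Then for $x\in\mathbb{Z}$ $$u(n,x)=\frac1n\,\mathbf{P}(S_n=x)\,U(x-1)\,\big(1+o(1)\big)\qquad(n\to\infty),$$ uniformly for $x/a_n\in[\varepsilon,1/\varepsilon]$, for every fixed $\varepsilon>0$. That is, for every $\varepsilon>0$ and $\delta>0$ there is $n_0$ such that for all $n\ge n_0$ and all $x\in\mathbb{Z}$ with $x/a_n\in[\varepsilon,1/\varepsilon]$, $$\Big|u(n,x)-\tfrac1n\,\mathbf{P}(S_n=x)\,U(x-1)\Big|\le\delta\,\tfrac1n\,\mathbf{P}(S_n=x)\,U(x-1).$$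
   Context: Notation: $\varphi(x):=\frac{1}{\sqrt{2\pi}}e^{-x^2/2}$. ''Arithmetic with span $1$'' means that $X_1$ is supported by $\mathbb{Z}$ and is aperiodic (it is not supported by $d\mathbb{Z}$ for any integer $d>1$). Finite variance is not assumed. Ladder variables: with $S_0:=0$, put $(T_0,H_0):=(0,0)$ and, for $k\ge1$, $T_k:=\inf\{n>T_{k-1}: S_n>H_{k-1}\}$, $H_k:=S_{T_k}$ (strict ascending ladder epochs and ladder heights). For $n\in\mathbb{N}$, $x\in\mathbb{Z}$ the renewal mass function is $$u(n,x):=\sum_{r=0}^\infty\mathbf{P}(T_r=n,\,H_r=x)=\mathbf{P}(n\text{ is a ladder epoch},\,S_n=x),$$ and $U(x):=\sum_{r=0}^\infty\mathbf{P}(H_r\le x)$. *)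

(* Defs.v *)
From HB Require Import structures.
From mathcomp Require Import all_boot all_order all_algebra.
From mathcomp Require Import finmap.
From mathcomp Require Import all_classical all_reals all_analysis.
Set Implicit Arguments.
Unset Strict Implicit.
Unset Printing Implicit Defensive.
Import Order.TTheory GRing.Theory Num.Theory.
Import numFieldNormedType.Exports.
Local Open Scope classical_set_scope.
Local Open Scope ring_scope.

Section ladder_path.
Context {R : realType}.
Implicit Types (p : pred nat) (s : nat -> R).

(* The infimum of [p] in the extended naturals; [None] stands for the value
   +oo of the infimum of the empty set. *)
Definition first_time p : option nat :=
  if pselect (exists n, p n) is left h then Some (ex_minn h) else None.

Fixpoint ladder_epoch s (k : nat) : option nat :=
  if k is k'.+1 then
    if ladder_epoch s k' is Some t
    then first_time (fun n => (t < n)%N && (s t < s n))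
    else None
  else Some 0%N.

(* The height is +oo when the epoch is infinite, so that the events
   [H_k <= x] only involve paths with a [k]-th ladder epoch. *)
Definition ladder_height s (k : nat) : \bar R :=
  if ladder_epoch s k is Some t then (s t)%:E else +oo%E.

End ladder_path.

Section random_walk.
Context (d : measure_display) (T : measurableType d) (R : realType)
  (P : probability T R).
Implicit Type X : nat -> {RV P >-> R}.

Definition mutually_independent X : Prop :=
  forall (J : {fset nat}) (B : nat -> set R),
    (forall i, measurable (B i)) ->
    P (\bigcap_(i in [set` J]) (X i @^-1` B i)) =
    (\prod_(i <- J) P (X i @^-1` B i))%E.

Definition identically_distributed X : Prop :=
  forall (i j : nat) (B : set R), measurable B ->
    distribution P (X i) B = distribution P (X j) B.

Definition iid X : Prop := mutually_independent X /\ identically_distributed X.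

(* [X i] is the step number [i + 1] of the walk. *)
Definition walk X (n : nat) (w : T) : R := \sum_(i < n) X i w.

Definition weakly_converges (Y : nat -> T -> R) (mu : probability (measurableTypeR R) R) : Prop :=
  forall f : R -> R, continuous f -> (exists M : R, forall x, `|f x| <= M) ->
    'E_P[f \o Y n]%E @[n --> \oo] --> (\int[mu]_x (f x)%:E)%E.

Definition int_multiples (m : int) : set R :=
  [set (m * k)%:~R | k in [set: int]].

Definition arithmetic_span1 (Y : T -> R) : Prop :=
  P (Y @^-1` int_multiples 1) = 1%E /\
  forall m : int, 1 < m -> P (Y @^-1` int_multiples m) <> 1%E.

Definition ladder_mass X (n : nat) (x : int) : \bar R :=
  (\sum_(0 <= r <oo)
    P [set w | ladder_epoch (walk X ^~ w) r = Some n /\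
               ladder_height (walk X ^~ w) r = (x%:~R)%:E])%E.

Definition ladder_height_renewal X (x : R) : \bar R :=
  (\sum_(0 <= r <oo)
    P [set w | (ladder_height (walk X ^~ w) r <= x%:E)%E])%E.

End random_walk.

(* Main.v *)
(* By the cycle lemma, n u(n, x) is the expectation, on the event
   S_n = x, of the number of strict ladder heights of (S_0, ..., S_n) above
   max S - x. Put V(y) = U(y - 1). The function V is asymptotically linear on
   windows [0, B x], since the overshoot of the walk over a level is negligible at
   the scale a_n, and a second moment bound shows that in a typical block of
   about n / 3 steps the number of ladder heights below y is V(x) y / x, up to a small
   multiple of V(x), for all y up to the maximum of the block. If the three blocks
   are typical, then the counts telescope to V(x). If some block is atypical, then
   one of the other two factors can be integrated out at the cost of
   sup_y P(S_m = y) <= C / a_n, which is comparable with P(S_n = x) because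
   P(S_n = x) >= c / a_n as soon as it is positive. These two local bounds come
   from a finite Fourier expansion of the symmetrized walk and from the central
   limit theorem; the local limit theorem is not needed. *)

Require Import Defs.
From HB Require Import structures.
From mathcomp Require Import all_boot all_order all_algebra.
From mathcomp Require Import finmap.
From mathcomp Require Import all_classical all_reals all_analysis.
From mathcomp Require Import measurable_realfun.
From mathcomp Require Import zify ring lra.
Import Order.TTheory GRing.Theory Num.Theory.
Import numFieldNormedType.Exports.
Local Open Scope classical_set_scope.
Local Open Scope ring_scope.
Set Implicit Arguments.
Unset Strict Implicit.
Unset Printing Implicit Defensive.

(** * Expectation over integer paths *)

(** No variance is assumed and no regular variation of [a] is given, so all knowledge of the scale
    is extracted from the limit theorem. After symmetrization the characteristic function [rho] is
    real and non-negative, and [n (1 - rho (th / a n))] tends to [th ^ 2]. This yields a truncated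
    second moment whose monotonicity compares [a n] with [a m] for comparable [n] and [m]; it also
    excludes single steps of order [a n] and controls [rho] near 0. Away from 0 the symmetrized step
    may live on [h Z] with [h > 1] even when the step itself has span 1, for instance for steps 1
    and -1. Hence [P(S_n = x)] may vanish, and the shifts in the local estimates are multiples of
    [h]. There are three blocks because an error term can pair the count of one block with the
    atypicality of another, and a further block must stay free. The count and the atypicality of the
    same block are dependent, and are separated by a second moment. *)

Section bounded_functions.
Context {R : realType}.

Definition bd {A : Type} (f : A -> R) := exists M, forall x, `|f x| <= M.

(** Only lists of length [n] matter: [lam] and [cnt] grow with the length of the path, so they are
    bounded at each length but not [bd]. *)
Definition bn n (f : seq int -> R) :=
  exists M, forall s, size s = n -> `|f s| <= M.

Lemma bd_cst A (c : R) : bd (fun _ : A => c).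
Proof. by exists `|c|. Qed.

Lemma bd_bool A (b : A -> bool) : bd (fun x => (b x)%:R : R).
Proof. by exists 1 => x; case: (b x); rewrite ?normr1 ?normr0. Qed.

Lemma bdD A (f g : A -> R) : bd f -> bd g -> bd (fun x => f x + g x).
Proof.
move=> [M fM] [N gN]; exists (M + N) => x.
by rewrite (le_trans (ler_normD _ _))// lerD.
Qed.

Lemma bdN A (f : A -> R) : bd f -> bd (fun x => - f x).
Proof. by move=> [M fM]; exists M => x; rewrite normrN. Qed.

Lemma bdM A (f g : A -> R) : bd f -> bd g -> bd (fun x => f x * g x).
Proof.
move=> [M fM] [N gN]; exists (M * N) => x.
by rewrite normrM ler_pM.
Qed.

Lemma bdX A (f : A -> R) k : bd f -> bd (fun x => f x ^+ k).
Proof.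
move=> [M fM]; exists (M ^+ k) => x.
by rewrite normrX lerXn2r// nnegrE (le_trans _ (fM x)).
Qed.

Lemma bd_cos A (f : A -> R) : bd (fun x => cos (f x)).
Proof. by exists 1 => x; rewrite ler_norml cos_geN1 cos_le1. Qed.

Lemma bd_sin A (f : A -> R) : bd (fun x => sin (f x)).
Proof. by exists 1 => x; rewrite ler_norml sin_geN1 sin_le1. Qed.

Lemma bd_sum A I (r : seq I) (P : pred I) (F : I -> A -> R) :
  (forall i, bd (F i)) -> bd (fun x => \sum_(i <- r | P i) F i x).
Proof.
move=> bF; elim: r => [|i r IHr].
  by exists 0 => x; rewrite big_nil normr0.
have [M HM] := IHr; have [N HN] := bF i.
exists (N + M) => x; rewrite big_cons; case: ifP => _.
  by rewrite (le_trans (ler_normD _ _))// lerD.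
by rewrite (le_trans (HM x))// lerDr (le_trans _ (HN x)).
Qed.

Lemma bd_bn n (f : seq int -> R) : bd f -> bn n f.
Proof. by move=> [M fM]; exists M => s _. Qed.

Lemma bn_cst n (c : R) : bn n (fun=> c).
Proof. exact/bd_bn/bd_cst. Qed.

Lemma bn_bool n (b : seq int -> bool) : bn n (fun x => (b x)%:R).
Proof. exact/bd_bn/bd_bool. Qed.

Lemma bnD n f g : bn n f -> bn n g -> bn n (fun x => f x + g x).
Proof.
move=> [M fM] [N gN]; exists (M + N) => x xn.
by rewrite (le_trans (ler_normD _ _))// lerD ?fM ?gN.
Qed.

Lemma bnN n f : bn n f -> bn n (fun x => - f x).
Proof. by move=> [M fM]; exists M => x xn; rewrite normrN fM. Qed.

Lemma bnM n f g : bn n f -> bn n g -> bn n (fun x => f x * g x).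
Proof.
move=> [M fM] [N gN]; exists (M * N) => x xn.
by rewrite normrM ler_pM ?fM ?gN.
Qed.

Lemma bnX n f k : bn n f -> bn n (fun x => f x ^+ k).
Proof.
move=> [M fM]; exists (M ^+ k) => x xn.
by rewrite normrX lerXn2r// ?fM// nnegrE (le_trans _ (fM x xn)).
Qed.

Lemma bn_cos n f : bn n (fun x => cos (f x)).
Proof. exact/bd_bn/bd_cos. Qed.

Lemma bn_sin n f : bn n (fun x => sin (f x)).
Proof. exact/bd_bn/bd_sin. Qed.

Lemma bn_sum n I (r : seq I) (P : pred I) (F : I -> seq int -> R) :
  (forall i, bn n (F i)) -> bn n (fun x => \sum_(i <- r | P i) F i x).
Proof.
move=> bF; elim: r => [|i r IHr].
  by exists 0 => x; rewrite big_nil normr0.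
have [M HM] := IHr; have [N HN] := bF i.
exists (`|N| + M) => x xn; rewrite big_cons; case: ifP => _.
  rewrite (le_trans (ler_normD _ _))// lerD ?HM//.
  by rewrite (le_trans (HN _ xn))// ler_norm.
by rewrite (le_trans (HM x xn))// lerDr.
Qed.

Lemma bn_cons n f z : bn n.+1 f -> bn n (fun s => f (z :: s)).
Proof. by move=> [M fM]; exists M => s sn; rewrite fM//= sn. Qed.

Lemma bn_nat n (f : seq int -> nat) k :
  (forall s, size s = n -> (f s <= k)%N) -> bn n (fun s => (f s)%:R).
Proof. by move=> fk; exists k%:R => s sn; rewrite normr_nat ler_nat fk. Qed.

End bounded_functions.

(** Every use of linearity or monotonicity of [E] and [Es] leaves boundedness side conditions; these
    are closed by following the shape of the function. *)
Ltac bdd := repeat (cbn beta; first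
  [ assumption
  | match goal with
    | |- bd (fun _ => ?c) => exact (bd_cst _ c)
    | |- bn _ (fun _ => ?c) => exact (bn_cst _ c)
    | |- bd (fun x => (nat_of_bool (@?b x))%:R) => exact (bd_bool b)
    | |- bn _ (fun x => (nat_of_bool (@?b x))%:R) => exact (bn_bool _ b)
    | |- bd (fun x => @?f x + @?g x) => apply (@bdD _ _ f g)
    | |- bn _ (fun x => @?f x + @?g x) => apply (@bnD _ _ f g)
    | |- bd (fun x => - @?f x) => apply (@bdN _ _ f)
    | |- bn _ (fun x => - @?f x) => apply (@bnN _ _ f)
    | |- bd (fun x => @?f x * @?g x) => apply (@bdM _ _ f g)
    | |- bn _ (fun x => @?f x * @?g x) => apply (@bnM _ _ f g)
    | |- bd (fun x => @?f x ^+ ?k) => apply (@bdX _ _ f k)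
    | |- bn _ (fun x => @?f x ^+ ?k) => apply (@bnX _ _ f k)
    | |- bd (fun x => cos (@?f x)) => exact (bd_cos f)
    | |- bn _ (fun x => cos (@?f x)) => exact (bn_cos _ f)
    | |- bd (fun x => sin (@?f x)) => exact (bd_sin f)
    | |- bn _ (fun x => sin (@?f x)) => exact (bn_sin _ f)
    | |- bd (fun x => \sum_(i <- ?r | @?P i) @?F i x) =>
        apply (@bd_sum _ _ _ r P (fun i x => F i x)) => ?
    | |- bn _ (fun x => \sum_(i <- ?r | @?P i) @?F i x) =>
        apply (@bn_sum _ _ _ r P (fun i x => F i x)) => ?
    | H : bn ?n.+1 ?f |- bn ?n (fun s => ?f (?z :: s)) => exact (bn_cons z H)
    | H : bd ?f |- bn _ ?f => exact (bd_bn _ H)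
    end ]).

Section averaging.
Context {R : realType}.
Implicit Types (E : (int -> R) -> R).

(* The law of a single step, as a functional on bounded functions. With it the
   law of a path is obtained by plain iteration ([Es]), without product
   measures. *)
Record averaging E : Prop := {
  exD : forall f g, bd f -> bd g -> E (fun z => f z + g z) = E f + E g;
  exZ : forall c f, bd f -> E (fun z => c * f z) = c * E f;
  ex_le : forall f g, bd f -> bd g -> (forall z, f z <= g z) -> E f <= E g;
  ex1 : E (fun=> 1) = 1;
  exC : forall F : int -> int -> R, (exists M, forall x y, `|F x y| <= M) ->
    E (fun x => E (fun y => F x y)) = E (fun y => E (fun x => F x y));
  ex_tight : forall e : R, 0 < e ->
    exists L : nat, E (fun z => (L < `|z|)%N%:R) <= e }.

Fixpoint Es E n (f : seq int -> R) : R :=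
  if n is m.+1 then E (fun z => Es E m (fun s => f (z :: s))) else f [::].

Variable E : (int -> R) -> R.
Hypothesis hE : averaging E.

Lemma ex_cst c : E (fun=> c) = c.
Proof.
have -> : (fun _ : int => c) = (fun _ => c * 1) by apply/funext => z; rewrite mulr1.
by rewrite (exZ hE) ?(ex1 hE) ?mulr1//; bdd.
Qed.

Lemma ex_bound M f : (forall z, `|f z| <= M) -> `|E f| <= M.
Proof.
move=> fM; have bf : bd f by exists M.
rewrite ler_norml -{1}(ex_cst (- M)) -{2}(ex_cst M).
apply/andP; split; apply: (ex_le hE) => //; try bdd.
  by move=> z; have := fM z; rewrite ler_norml => /andP[].
by move=> z; have := fM z; rewrite ler_norml => /andP[].
Qed.

Lemma Es_ext n f g : (forall s, size s = n -> f s = g s) -> Es E n f = Es E n g.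
Proof.
elim: n f g => [|n IHn] f g fg /=; first exact: fg.
by congr E; apply/funext => z; apply: IHn => s sn; rewrite fg//= sn.
Qed.

Lemma Es_bound n M f : (forall s, size s = n -> `|f s| <= M) -> `|Es E n f| <= M.
Proof.
elim: n f => [|n IHn] f fM /=; first exact: fM.
by apply: ex_bound => z; apply: IHn => s sn; rewrite fM//= sn.
Qed.

Lemma bd_Es n (f : int -> seq int -> R) :
  (exists M, forall z s, size s = n -> `|f z s| <= M) -> bd (fun z => Es E n (f z)).
Proof. by move=> [M fM]; exists M => z; apply: Es_bound => s sn; rewrite fM. Qed.

Lemma bd_Es_cons n f : bn n.+1 f -> bd (fun z => Es E n (fun s => f (z :: s))).
Proof.
by move=> [M fM]; apply: bd_Es; exists M => z s sn; rewrite fM//= sn.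
Qed.

Lemma bn_Es m n (f : seq int -> seq int -> R) :
  (exists M, forall s t, size s = m -> size t = n -> `|f s t| <= M) ->
  bn m (fun s => Es E n (f s)).
Proof. by move=> [M fM]; exists M => s sm; apply: Es_bound => t tn; rewrite fM. Qed.

Lemma EsD n f g : bn n f -> bn n g -> Es E n (fun s => f s + g s) = Es E n f + Es E n g.
Proof.
elim: n f g => [|n IHn] f g bf bg //=.
rewrite -(exD hE); [|exact: bd_Es_cons..].
by congr E; apply/funext => z; rewrite IHn//; bdd.
Qed.

Lemma EsZ n c f : bn n f -> Es E n (fun s => c * f s) = c * Es E n f.
Proof.
elim: n f => [|n IHn] f bf //=.
rewrite -(exZ hE); last exact: bd_Es_cons.
by congr E; apply/funext => z; rewrite IHn//; bdd.
Qed.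

Lemma Es_cst n c : Es E n (fun=> c) = c.
Proof.
elim: n => //= n IHn; rewrite -[RHS]ex_cst; congr E.
by apply/funext => z; exact: IHn.
Qed.

Lemma EsN n f : bn n f -> Es E n (fun s => - f s) = - Es E n f.
Proof.
by move=> bf; rewrite -mulN1r -EsZ//; apply: Es_ext => s _; rewrite mulN1r.
Qed.

Lemma EsB n f g : bn n f -> bn n g -> Es E n (fun s => f s - g s) = Es E n f - Es E n g.
Proof. by move=> bf bg; rewrite EsD ?EsN//; bdd. Qed.

Lemma Es_sum n I (r : seq I) (P : pred I) (F : I -> seq int -> R) :
  (forall i, bn n (F i)) ->
  Es E n (fun s => \sum_(i <- r | P i) F i s) = \sum_(i <- r | P i) Es E n (F i).
Proof.
move=> bF; elim: r => [|i r IHr].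
  by rewrite big_nil -[RHS](Es_cst n); apply: Es_ext => s _; rewrite big_nil.
rewrite big_cons -IHr; case: ifP => Pi.
  by rewrite -EsD//; [apply: Es_ext => s _; rewrite big_cons Pi|bdd].
by apply: Es_ext => s _; rewrite big_cons Pi.
Qed.

Lemma Es_le n f g : bn n f -> bn n g -> (forall s, size s = n -> f s <= g s) ->
  Es E n f <= Es E n g.
Proof.
elim: n f g => [|n IHn] f g bf bg fg /=; first exact: fg.
apply: (ex_le hE); [exact: bd_Es_cons..|].
by move=> z; apply: IHn; [bdd..|] => s sn; rewrite fg//= sn.
Qed.

Lemma Es_ge0 n f : bn n f -> (forall s, size s = n -> 0 <= f s) -> 0 <= Es E n f.
Proof. by move=> bf f0; rewrite -(Es_cst n 0); apply: Es_le => //; bdd. Qed.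

Lemma Es_cat m n f :
  Es E (m + n) f = Es E m (fun s => Es E n (fun t => f (s ++ t))).
Proof.
elim: m f => [|m IHm] f //=.
by congr E; apply/funext => z; rewrite IHm.
Qed.

Lemma Es_indep m n f g : bn m f -> bn n g ->
  Es E m (fun s => Es E n (fun t => f s * g t)) = Es E m f * Es E n g.
Proof.
move=> bf bg; rewrite mulrC -EsZ//.
by apply: Es_ext => s _; rewrite EsZ// mulrC.
Qed.

Lemma exEsC n (F : int -> seq int -> R) :
  (exists M, forall z s, size s = n -> `|F z s| <= M) ->
  E (fun z => Es E n (fun s => F z s)) = Es E n (fun s => E (fun z => F z s)).
Proof.
elim: n F => [|n IHn] F [M FM] //=.
rewrite (exC hE); last first.
  by exists M => x y; apply: Es_bound => s sn; rewrite FM//= sn.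
congr E; apply/funext => z; rewrite IHn//.
by exists M => x s sn; rewrite FM//= sn.
Qed.

Lemma EsC m n (F : seq int -> seq int -> R) :
  (exists M, forall s t, size s = m -> size t = n -> `|F s t| <= M) ->
  Es E m (fun s => Es E n (fun t => F s t)) = Es E n (fun t => Es E m (fun s => F s t)).
Proof.
elim: m F => [|m IHm] F [M FM] //=.
rewrite -exEsC; last first.
  by exists M => z s sn; apply: Es_bound => t tm; rewrite FM//= tm.
congr E; apply/funext => z; rewrite IHm//.
by exists M => s t sm tn; rewrite FM//= sm.
Qed.

(** The path consists of two independent pieces, and [EsC] exchanges them. The cycle lemma rests on
    this invariance. *)
Lemma Es_rot n k f : bn n f -> (k <= n)%N -> Es E n (fun s => f (rot k s)) = Es E n f.
Proof.
move=> bf kn; have nE : n = (k + (n - k))%N by rewrite subnKC.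
rewrite nE in bf *; rewrite Es_cat.
rewrite (@Es_ext _ _ (fun s => Es E (k + (n - k) - k) (fun t => f (t ++ s)))); last first.
  move=> s sk; rewrite addKn; apply: Es_ext => t tn.
  by rewrite -sk rot_size_cat.
move: bf => [M fM]; rewrite addKn EsC; last first.
  by exists M => s t sm tn; rewrite fM// size_cat sm tn addnC.
by rewrite -Es_cat addnC.
Qed.

Lemma Es_take k n f : (k <= n)%N -> Es E n (fun s => f (take k s)) = Es E k f.
Proof.
move=> kn; rewrite -(subnKC kn) Es_cat; apply: Es_ext => s sk.
rewrite -[RHS](Es_cst (n - k)); apply: Es_ext => t _.
by rewrite -sk take_size_cat.
Qed.

End averaging.

(** * Ladder heights of a path *)

Section ladder_combinatorics.
Implicit Types (s u v : seq int) (g y z : int).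

Definition sumz s : int := \sum_(z <- s) z.

(* The maximum of all partial sums, the empty one included. *)
Fixpoint mx s : int := if s is z :: s' then Num.max 0 (z + mx s') else 0.

(* All nonempty final segments have a positive sum: the time [size s] is a
   strict ascending ladder epoch. *)
Fixpoint lad s : bool :=
  if s is z :: s' then (0 < z + sumz s') && lad s' else true.

(* The number of strict ascending ladder heights above [g], the initial height
   0 included; see [lam_take]. *)
Fixpoint lam s g : nat :=
  ((g < 0)%R + if s is z :: s' then lam s' (Num.max g 0 - z) else 0)%N.

(* The number of ladder heights in [0, y). *)
Definition cnt s y : nat := (lam s (-1) - lam s (y - 1))%N.

(* Some partial sum exceeds [g], and the first one to do so is at most
   [g + r]. *)
Fixpoint passes s g r : bool :=
  if g < 0 then - g <= r else if s is z :: s' then passes s' (g - z) r else false.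

Lemma sumz_nil : sumz [::] = 0. Proof. exact: big_nil. Qed.

Lemma sumz_cons z s : sumz (z :: s) = z + sumz s. Proof. exact: big_cons. Qed.

Lemma sumz_cat u v : sumz (u ++ v) = sumz u + sumz v. Proof. exact: big_cat. Qed.

Lemma mx_ge0 s : 0 <= mx s.
Proof. by case: s => //= z s; rewrite le_max lexx. Qed.

Lemma mx_ge_sumz s : sumz s <= mx s.
Proof. by elim: s => [|z s IHs] /=; rewrite ?sumz_nil ?sumz_cons//; lia. Qed.

Lemma mx_cat u v : mx (u ++ v) = Num.max (mx u) (sumz u + mx v).
Proof.
elim: u => [|z u IHu] /=; first by rewrite sumz_nil; have := mx_ge0 v; lia.
by rewrite sumz_cons IHu; lia.
Qed.

Lemma mx_leP s y : reflect (forall k, (k <= size s)%N -> sumz (take k s) <= y) (mx s <= y).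
Proof.
apply: (iffP idP).
  elim: s y => [|z s IHs] y /=.
    by move=> y0 k _; rewrite sumz_nil.
  rewrite ge_max => /andP[y0 zy] [|k] ks; first by rewrite take0 sumz_nil.
  rewrite [take _ _]/= sumz_cons; have := IHs (y - z) _ k ks; lia.
elim: s y => [|z s IHs] y H /=.
  by have := H 0%N isT; rewrite sumz_nil.
rewrite ge_max; have := H 0%N isT; rewrite take0 sumz_nil => -> /=.
have /IHs: forall k, (k <= size s)%N -> sumz (take k s) <= y - z.
  by move=> k ks; have := H k.+1 ks; rewrite [take _ _]/= sumz_cons; lia.
lia.
Qed.

Lemma lam_max0 s g : lam s g = ((g < 0)%R + lam s (Num.max g 0))%N.
Proof.
have -> : Num.max g 0 = Num.max (Num.max g 0) 0 by lia.
case: s => [|z s] /=; first by lia.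
have -> : (Num.max (Num.max g 0) 0 < 0) = false by lia.
by rewrite add0n; congr (_ + lam _ (_ - _))%N; lia.
Qed.

Lemma lam_neg s g : g < 0 -> lam s g = (lam s 0).+1.
Proof. by move=> g0; rewrite lam_max0 g0 add1n; congr (lam _ _).+1; lia. Qed.

Lemma lam_neg2 s g g' : g < 0 -> g' < 0 -> lam s g = lam s g'.
Proof. by move=> g0 g0'; rewrite (lam_neg s g0) (lam_neg s g0'). Qed.

(** A ladder height reached in [v] has to exceed both [g] and the maximum of [u], a level read here
    from the endpoint of [u]. That level is never negative, so the start of [v] is not counted
    again. *)
Lemma lam_cat u v g :
  lam (u ++ v) g = (lam u g + lam v (Num.max g (mx u) - sumz u))%N.
Proof.
elim: u g => [|z u IHu] g /=.
  by rewrite sumz_nil subr0 addn0; exact: lam_max0.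
by rewrite IHu addnA sumz_cons; congr (_ + _ + lam _ _)%N; lia.
Qed.

Lemma lam_mono s g g' : g <= g' -> (lam s g' <= lam s g)%N.
Proof.
elim: s g g' => [|z s IHs] g g' gg' /=; first by lia.
by apply: leq_add; [lia|apply: IHs; lia].
Qed.

Lemma lam_size s g : (lam s g <= (size s).+1)%N.
Proof.
have lam0 : (lam s 0 <= size s)%N.
  elim: s {g} => //= z s IHs; rewrite add0n.
  have [z0|z0] := ltP 0 z.
    by rewrite lam_neg// ; lia.
  by apply: leqW; apply: leq_trans IHs; apply: lam_mono; lia.
have [g0|g0] := ltP g 0; first by rewrite lam_neg.
by apply: leqW; apply: leq_trans lam0; exact: lam_mono.
Qed.

Lemma lam_mx0 s g : 0 <= g -> mx s <= g -> lam s g = 0%N.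
Proof.
elim: s g => [|z s IHs] g g0 /=; first by lia.
rewrite ge_max => /andP[_ zg].
have -> : (g < 0) = false by lia.
by rewrite add0n IHs//; have := mx_ge0 s; lia.
Qed.

Lemma lam_take s g :
  lam s g = (\sum_(k < (size s).+1) (lad (take k s) && (g < sumz (take k s))%R))%N.
Proof.
elim: s g => [|z s IHs] g /=.
  by rewrite big_ord_recl big_ord0 /= sumz_nil addn0.
rewrite big_ord_recl take0 /= sumz_nil; congr (_ + _)%N.
rewrite IHs; apply: eq_bigr => k _; rewrite /= add0n sumz_cons.
by case: (lad _); rewrite ?andbT ?andbF//=; congr (nat_of_bool _); lia.
Qed.

Lemma lad_cat u v : lad (u ++ v) =
  lad v && [forall k : 'I_(size u), 0 < sumz (drop k u) + sumz v].
Proof.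
elim: u => [|z u IHu] /=.
  by rewrite andb_idr// => _; apply/forallP => -[].
rewrite IHu andbCA; congr (_ && _); rewrite sumz_cat.
apply/andP/forallP => /=.
  move=> [zuv /forallP H] [[|k] /= ku]; first by rewrite sumz_cons; lia.
  exact: H (Ordinal (ku : (k < size u)%N)).
move=> H; split; first by have := H ord0; rewrite drop0 sumz_cons; lia.
apply/forallP => k; have := H (lift ord0 k); by rewrite /= add0n.
Qed.

(** The final segments of the rotated path are those of [take k.+1 s] and, beyond them, those of [s]
    continued cyclically by this prefix. The latter are positive when no partial sum of [s] reaches
    [sumz s + sumz (take k.+1 s)]; for the partial sums before time [k.+1] this is automatic. *)
Lemma lad_rot s k : 0 < sumz s -> (k < size s)%N ->
  lad (rot k.+1 s) = lad (take k.+1 s) && (mx s - sumz s < sumz (take k.+1 s)).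
Proof.
move=> s0 ks; rewrite /rot lad_cat; apply: andb_id2l => lt.
have tk0 : 0 < sumz (take k.+1 s).
  by case: s ks lt s0 => //= z s ks /andP[+ _] _; rewrite sumz_cons.
have sE j : sumz s = sumz (take j s) + sumz (drop j s).
  by rewrite -sumz_cat cat_take_drop.
have -> : (mx s - sumz s < sumz (take k.+1 s)) =
    (mx s <= sumz s + sumz (take k.+1 s) - 1) by lia.
apply/forallP/mx_leP => [H j js|H j].
  have [jk|kj] := ltnP j k.+1.
    have jk' : (j <= size s)%N by [].
    have : lad (take j (take k.+1 s) ++ drop j (take k.+1 s)).
      by rewrite cat_take_drop.
    rewrite take_takel; last exact: ltnW.
    have tE : sumz (take k.+1 s) = sumz (take j s) + sumz (drop j (take k.+1 s)).
      by rewrite -[in LHS](cat_take_drop j (take k.+1 s)) take_takel 1?ltnW// sumz_cat.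
    rewrite lad_cat => /andP[+ _].
    case E : (drop j (take k.+1 s)) => [|z w].
      move/(congr1 size): E; rewrite size_drop size_takel//=; lia.
    by rewrite /= => /andP[+ _]; rewrite tE E sumz_cons; lia.
  have [jn|nj] := ltnP j (size s); last first.
    by rewrite take_oversize//; lia.
  have jlt : (j - k.+1 < size (drop k.+1 s))%N by rewrite size_drop; lia.
  have := H (Ordinal jlt); rewrite /= drop_drop subnK//.
  by have := sE j; lia.
have jn : (j < size s - k.+1)%N by rewrite -size_drop ltn_ord.
have := H (j + k.+1)%N ltac:(lia); rewrite drop_drop.
by have := sE (j + k.+1)%N; lia.
Qed.

Lemma lam_rot s : 0 < sumz s ->
  lam s (mx s - sumz s) = (\sum_(i < size s) lad (rot i s))%N.
Proof.
move=> s0; rewrite lam_take big_ord_recl take0 /= sumz_nil.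
have -> : (mx s - sumz s < 0) = false by have := mx_ge_sumz s; lia.
rewrite add0n; transitivity (\sum_(i < size s) lad (rot i.+1 s))%N.
  by apply: eq_bigr => k _; rewrite lad_rot.
case: s s0 => [|z s] s0; first by rewrite !big_ord0.
(* The shift by [size s] equals the shift by 0, so the sums over [1 .. size s] and [0 .. size s - 1]
   agree. *)
rewrite [size _]/= big_ord_recr [RHS]big_ord_recl rot0 addnC.
by rewrite -[X in rot X _]/(size (z :: s)) rot_size.
Qed.

Lemma cnt_le u v y : (cnt u y <= cnt (u ++ v) y)%N.
Proof.
rewrite /cnt !lam_cat.
have [y0|y0] := ltP y 0%R.
  have -> : lam u (-1) = lam u (y - 1) by apply: lam_neg2; lia.
  by rewrite subnn.
have u1 : (lam u (y - 1)%R <= lam u (-1)%R)%N by apply: lam_mono; lia.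
have v1 : (lam v (Num.max (y - 1) (mx u) - sumz u)%R <=
           lam v (Num.max (-1) (mx u) - sumz u)%R)%N by apply: lam_mono; lia.
by move: u1 v1; move: (lam _ _) (lam _ _) (lam _ _) (lam _ _) => p q r t; lia.
Qed.

(** Later ladder heights exceed [mx u], hence are at least [y]. *)
Lemma cnt_cat_stable u v y : 0 <= y -> y <= mx u + 1 -> cnt (u ++ v) y = cnt u y.
Proof.
move=> y0 yu; rewrite /cnt !lam_cat.
have -> : Num.max (-1) (mx u) = Num.max (y - 1) (mx u) by have := mx_ge0 u; lia.
by rewrite subnDr.
Qed.

Lemma cnt_mono s y y' : y <= y' -> (cnt s y <= cnt s y')%N.
Proof. by move=> yy'; apply: leq_sub2l; apply: lam_mono; lia. Qed.

Lemma lam_cnt s y : 0 <= y -> lam s (-1) = (cnt s y + lam s (y - 1))%N.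
Proof. by move=> y0; rewrite /cnt subnK//; apply: lam_mono; lia. Qed.

Lemma cnt_mx s : cnt s (mx s + 1) = lam s (-1).
Proof. by rewrite /cnt addrK (@lam_mx0 s (mx s)) ?mx_ge0// subn0. Qed.

(** An overshoot is at most the step that causes it; [- g <= r] covers a level that is already
    exceeded at the start. *)
Lemma passesP s g r : - g <= r -> g < mx s -> all (fun z => z <= r) s -> passes s g r.
Proof.
elim: s g => [|z s IHs] g gr /=; first by move=> g0 _; rewrite g0.
case: ifP => // g0 gm /andP[zr sr].
by apply: IHs => //; lia.
Qed.

End ladder_combinatorics.

(** * Renewal function of the ladder heights *)

Section probabilities.
Context {R : realType}.
Variable E : (int -> R) -> R.
Hypothesis hE : averaging E.

Definition Ps E n (b : seq int -> bool) : R := Es E n (fun s => (b s)%:R).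

Local Notation Pr := (Ps E).

Lemma Ps_le n (b c : seq int -> bool) :
  (forall s, size s = n -> b s -> c s) -> Pr n b <= Pr n c.
Proof.
move=> bc; apply: (Es_le hE); [bdd..|] => s sn.
by have := bc s sn; case: (b s) => [->//|_]; case: (c s); rewrite ?ler01.
Qed.

Lemma Ps_ge0 n b : 0 <= Pr n b.
Proof. by apply: (Es_ge0 hE); [bdd|] => s _; case: (b s); rewrite ?ler01. Qed.

Lemma Ps_le1 n b : Pr n b <= 1.
Proof.
rewrite -[leRHS](Es_cst hE n); apply: (Es_le hE); [bdd..|].
by move=> s _; case: (b s).
Qed.

Lemma Ps_or n (b c : seq int -> bool) : Pr n (fun s => b s || c s) <= Pr n b + Pr n c.
Proof.
rewrite -(EsD hE); [|bdd..]; apply: (Es_le hE); [bdd..|] => s _.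
by case: (b s); case: (c s) => /=; lra.
Qed.

Lemma Ps_neg n b : Pr n (fun s => ~~ b s) = 1 - Pr n b.
Proof.
rewrite -[X in X - _](Es_cst hE n) -(EsB hE); [|bdd..].
by apply: Es_ext => s _; case: (b s) => /=; lra.
Qed.

Lemma Ps_has n N (b : nat -> seq int -> bool) :
  Pr n (fun s => [exists k : 'I_N, b k s]) <= \sum_(k < N) Pr n (b k).
Proof.
rewrite -(Es_sum hE); last by move=> i; bdd.
apply: (Es_le hE); [bdd..|] => s _.
case: existsP => [[k bk]|_].
  by rewrite (bigD1 k)//= bk lerDl sumr_ge0// => i _; case: (b i s); rewrite ?ler01.
by rewrite sumr_ge0// => i _; case: (b i s); rewrite ?ler01.
Qed.

Lemma Markov n (f : seq int -> R) (b : seq int -> bool) c : 0 < c -> bn n f ->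
  (forall s, size s = n -> 0 <= f s) ->
  (forall s, size s = n -> b s -> c <= f s) -> Pr n b <= c^-1 * Es E n f.
Proof.
move=> c0 bf f0 bfc; rewrite -(EsZ hE)//; apply: (Es_le hE); [bdd..|] => s sn.
case bs : (b s); last by rewrite mulr_ge0 ?f0// invr_ge0 ltW.
by rewrite ler_pdivlMl// mulr1 bfc.
Qed.

Lemma Es_consE n f g : (forall z s, size s = n -> f (z :: s) = g z s) ->
  Es E n.+1 f = E (fun z => Es E n (g z)).
Proof.
by move=> fg; congr E; apply/funext => z; apply: Es_ext => s sn; exact: fg.
Qed.

Lemma Es_cons_le n f c : bn n.+1 f -> (forall z, Es E n (fun s => f (z :: s)) <= c) ->
  Es E n.+1 f <= c.
Proof.
move=> bf fc; rewrite -(ex_cst hE c) /=; apply: (ex_le hE) => //; last exact: bd_cst.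
exact: bd_Es_cons.
Qed.

Lemma Es_cons_le2 m n f g : bn m.+1 f -> bn n.+1 g ->
  (forall z, Es E m (fun s => f (z :: s)) <= Es E n (fun s => g (z :: s))) ->
  Es E m.+1 f <= Es E n.+1 g.
Proof. by move=> bf bg fg; apply: (ex_le hE) => //; exact: bd_Es_cons. Qed.

End probabilities.

Section ladder_bounds.
Context {R : realType}.

Lemma bn_lam n (g : seq int -> int) : bn n (fun s => (lam s (g s))%:R : R).
Proof. by apply: (@bn_nat _ _ _ n.+1) => s <-; exact: lam_size. Qed.

Lemma bn_cnt n (g : seq int -> int) : bn n (fun s => (cnt s (g s))%:R : R).
Proof.
apply: (@bn_nat _ _ _ n.+1) => s <-; apply: leq_trans (leq_subr _ _) _.
exact: lam_size.
Qed.

End ladder_bounds.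

Ltac bddl := repeat (cbn beta; first
  [ match goal with
    | |- bn ?n (fun s => (lam s (@?g s))%:R) => exact (bn_lam n g)
    | |- bn ?n (fun s => (cnt s (@?g s))%:R) => exact (bn_cnt n g)
    end
  | progress bdd ]).

Section renewal.
Context {R : realType}.
Variable E : (int -> R) -> R.
Hypothesis hE : averaging E.
Local Notation Pr := (Ps E).

Lemma natr_cnt (s : seq int) (y : int) : 0 <= y ->
  (cnt s y)%:R = (lam s (-1))%:R - (lam s (y - 1))%:R :> R.
Proof. by move=> y0; rewrite /cnt natrB//; apply: lam_mono; lia. Qed.

Lemma lam_cons z s g : 0 <= g -> lam (z :: s) g = lam s (g - z).
Proof.
move=> g0 /=; have -> : (g < 0) = false by lia.
by rewrite add0n; congr lam; lia.
Qed.

(* [Vn n y] is the mean number of ladder heights below [y] up to time [n]; it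
   increases with [n] to U(y - 1), which is [Vlim y]. *)
Definition Vn n (y : nat) : R := Es E n (fun s => (cnt s y%:Z)%:R).

Definition Lam n : R := Es E n (fun s => (lam s (-1))%:R).

Lemma Vn_ge0 n y : 0 <= Vn n y.
Proof. by apply: (Es_ge0 hE) => //; bddl. Qed.

Lemma Vn_mono m n y : (m <= n)%N -> Vn m y <= Vn n y.
Proof.
move=> mn; rewrite /Vn -(Es_take hE _ mn).
apply: (Es_le hE); [by apply: bn_nat (m.+1) _ => s sn; apply: leq_trans (leq_subr _ _) _; apply: leq_trans (lam_size _ _) _; rewrite ltnS size_take_min geq_minl|bddl|].
by move=> s _; rewrite ler_nat -{2}(cat_take_drop m s) cnt_le.
Qed.

Lemma Vn_monoy n y y' : (y <= y')%N -> Vn n y <= Vn n y'.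
Proof.
move=> yy'; apply: (Es_le hE); [bddl..|] => s _.
by rewrite ler_nat; apply: cnt_mono; lia.
Qed.

Lemma Vn0 n : Vn n 0 = 0.
Proof.
rewrite -[RHS](Es_cst hE n); apply: Es_ext => s _.
by rewrite /cnt subnn.
Qed.

Lemma Vn1 n : Vn n 1 = 1.
Proof.
rewrite -[RHS](Es_cst hE n); apply: Es_ext => s _.
by rewrite /cnt (@lam_neg s (-1))// subSn ?subnn.
Qed.

(* The walk started at the first ladder height above [g] is independent of the
   past, so a window of length [y] contains on average at most as many ladder
   heights as the window starting at 0. *)
Lemma window_le n g (y : nat) :
  Es E n (fun s => (lam s g)%:R - (lam s (g + y%:Z))%:R) <= Vn n y.
Proof.
elim: n g => [|n IHn] g.
  have [g0|g0] := ltP g 0; last first.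
    apply: le_trans (Vn_ge0 0 y); rewrite -[leRHS](Es_cst hE 0).
    apply: (Es_le hE) => [| |[]// _]; [bddl..|].
    by rewrite !lam_mx0 ?subrr//=; lia.
  apply: (Es_le hE) => [| |s _]; [bddl..|].
  rewrite natr_cnt// (@lam_neg2 s g (-1))//.
  by rewrite lerD2l lerN2 ler_nat; apply: lam_mono; lia.
have [g0|g0] := ltP g 0.
  apply: (Es_le hE); [bddl..|] => s _.
  rewrite natr_cnt// (@lam_neg2 s g (-1))//.
  by rewrite lerD2l lerN2 ler_nat; apply: lam_mono; lia.
apply: le_trans (Vn_mono _ (leqnSn n)); apply: (Es_cons_le hE) => [|z]; first bddl.
rewrite (@Es_ext _ _ _ _ (fun s => (lam s (g - z))%:R - (lam s (g - z + y%:Z))%:R))//.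
move=> s _; rewrite !lam_cons//; last by lia.
by congr (_ - (lam s _)%:R); lia.
Qed.

Lemma Vn_sub n x y : Vn n (x + y) <= Vn n x + Vn n y.
Proof.
apply: le_trans (lerD (lexx _) (window_le n (x%:Z - 1) y)).
rewrite -(EsD hE); [|bddl..]; apply: (Es_le hE); [bddl..|] => s _.
rewrite !natr_cnt//; have -> : x%:Z - 1 + y%:Z = (x + y)%:Z - 1 by lia.
lra.
Qed.

Lemma Vn_le_id n y : Vn n y <= y%:R.
Proof.
elim: y => [|y IHy]; first by rewrite Vn0.
by rewrite -addn1 natrD (le_trans (Vn_sub _ _ _))// lerD// Vn1.
Qed.

(* If level [x - 1] is passed with an overshoot of at most [r], then the
   remaining walk contributes on average [Vn H (y - r)] ladder heights below
   [x + y]. *)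
Lemma Vn_sup n H x y r : (r <= y)%N ->
  Vn (n + H) x + Pr n (fun s => passes s (x%:Z - 1) r%:Z) * Vn H (y - r) <= Vn (n + H) (x + y).
Proof.
move=> ry.
(* The window sits above an arbitrary level [g], so that the induction on [n] can move it by the
   first step. *)
suff key g : Pr n (fun s => passes s g r%:Z) * Vn H (y - r) <=
    Es E (n + H) (fun s => (lam s g)%:R - (lam s (g + y%:Z))%:R).
  apply: le_trans (lerD (lexx _) (key (x%:Z - 1))) _.
  rewrite -(EsD hE); [|bddl..]; apply: (Es_le hE); [bddl..|] => s _.
  rewrite !natr_cnt//; have -> : x%:Z - 1 + y%:Z = (x + y)%:Z - 1 by lia.
  lra.
have win0 m g' : 0 <= Es E m (fun s => (lam s g')%:R - (lam s (g' + y%:Z))%:R).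
  apply: (Es_ge0 hE); first by bddl.
  by move=> s _; rewrite subr_ge0 ler_nat lam_mono//; lia.
elim: n g => [|n IHn] g.
  rewrite /Ps /=; case: ifP => g0; last by rewrite /= mulr0n mul0r; exact: win0.
  case: (leP (- g) r%:Z) => gr; last by rewrite /= mulr0n mul0r; exact: win0.
  rewrite mul1r; apply: (Es_le hE); [bddl..|] => s _.
  rewrite natr_cnt; last by lia.
  rewrite (@lam_neg2 s g (-1))//.
  by rewrite lerD2l lerN2 ler_nat; apply: lam_mono; lia.
have [g0|g0] := ltP g 0.
  have [gr|gr] := leP (- g) r%:Z; last first.
    rewrite (_ : Ps _ _ _ = 0) ?mul0r; first exact: win0.
    rewrite -[RHS](Es_cst hE n.+1); apply: Es_ext => -[|z s]//= _.
    by rewrite g0 leNgt gr.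
  apply: (@le_trans _ _ (Vn H (y - r))).
    by rewrite ler_piMl ?Vn_ge0// (Ps_le1 hE).
  apply: le_trans (Vn_mono _ (leq_addl n.+1 H)) _.
  apply: (Es_le hE); [bddl..|] => s _.
  rewrite natr_cnt; last by lia.
  rewrite (@lam_neg2 s g (-1))//.
  by rewrite lerD2l lerN2 ler_nat; apply: lam_mono; lia.
rewrite addSn mulrC /Ps -(EsZ hE); last by bddl.
apply: (Es_cons_le2 hE); [bddl..|] => z.
rewrite [leRHS](@Es_ext _ _ _ _ (fun s => (lam s (g - z))%:R - (lam s (g - z + y%:Z))%:R)).
  apply: le_trans (IHn (g - z)); rewrite mulrC /Ps -(EsZ hE); last by bddl.
  by rewrite (@Es_ext _ _ _ _ (fun s => Vn H (y - r) * (passes s (g - z) r%:Z)%:R))// => s _ /=; have -> : (g < 0) = false by lia.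
move=> s _; rewrite !lam_cons//; last by lia.
by congr (_ - (lam s _)%:R); lia.
Qed.

Lemma Lam_mono m n : (m <= n)%N -> Lam m <= Lam n.
Proof.
move=> mn; rewrite /Lam -(Es_take hE _ mn).
apply: (Es_le hE); [by apply: bn_nat (m.+1) _ => s sn; apply: leq_trans (lam_size _ _) _; rewrite ltnS size_take_min geq_minl|bddl|].
by move=> s _; rewrite ler_nat -{2}(cat_take_drop m s) lam_cat leq_addr.
Qed.

Lemma Lam_ge1 n : 1 <= Lam n.
Proof.
rewrite -[leLHS](Es_cst hE n); apply: (Es_le hE); [bddl..|] => s _.
by rewrite lam_neg// ler1n.
Qed.

(** Once [g] is exceeded, the walk restarts at the first ladder height above it, and at most [Lam n]
    ladder heights follow on average, that one included. *)
Lemma lam_tail n g : Es E n (fun s => (lam s g)%:R) <= Pr n (fun s => g < mx s) * Lam n.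
Proof.
elim: n g => [|n IHn] g.
  have [g0|g0] := ltP g 0; rewrite /Ps /Lam/=.
    by rewrite g0 /= mul1r.
  by rewrite ltNge g0 /= mul0r.
have [g0|g0] := ltP g 0.
  rewrite (_ : Ps _ _ _ = 1) ?mul1r.
    by apply: (Es_le hE); [bddl..|] => s _; rewrite (@lam_neg2 s g (-1)).
  rewrite -[RHS](Es_cst hE n.+1); apply: Es_ext => s _.
  by have := mx_ge0 s; case: ltP => //; lia.
rewrite mulrC /Ps -(EsZ hE); last by bddl.
apply: (Es_cons_le2 hE); [bddl..|] => z.
rewrite (@Es_ext _ _ _ _ (fun s => (lam s (g - z))%:R)); last first.
  by move=> s _; rewrite lam_cons.
apply: le_trans (IHn _) _; rewrite mulrC (EsZ hE); last by bddl.
apply: ler_pM; rewrite ?Ps_ge0 ?Lam_mono//.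
  by rewrite (le_trans _ (Lam_ge1 n)).
by apply: (Ps_le hE) => s _ /=; lia.
Qed.

(** By [lam_tail] the heights above [y - 1] make up at most half of [Lam n], so those below [y] make
    up at least the other half. *)
Lemma Lam_le n (y : nat) : Pr n (fun s => y%:Z - 1 < mx s) <= 2^-1 -> Lam n <= 2 * Vn n y.
Proof.
move=> Py.
have : Lam n = Vn n y + Es E n (fun s => (lam s (y%:Z - 1))%:R).
  rewrite -(EsD hE); [|bddl..]; apply: Es_ext => s _.
  by rewrite natr_cnt// addrNK.
have := lam_tail n (y%:Z - 1).
have := Lam_ge1 n.
have : Pr n (fun s => y%:Z - 1 < mx s) * Lam n <= 2^-1 * Lam n.
  by rewrite ler_wpM2r// (le_trans _ (Lam_ge1 n)).
lra.
Qed.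

(* The number of ladder heights after one of them is independent of the past
   and has mean at most [Lam n]. *)
Lemma lam_second n g :
  Es E n (fun s => (lam s g)%:R * ((lam s g)%:R + 1)) <=
  2 * Lam n * Es E n (fun s => (lam s g)%:R).
Proof.
(* Below 0 the initial height adds one to the count [l = lam s 0], and
   [(l + 1) (l + 2) = l (l + 1) + 2 (l + 1)], where [l + 1] has mean [Lam m]. *)
have neg m g' : g' < 0 ->
  Es E m (fun s => (lam s 0)%:R * ((lam s 0)%:R + 1)) <=
    2 * Lam m * Es E m (fun s => (lam s 0)%:R) ->
  Es E m (fun s => (lam s g')%:R * ((lam s g')%:R + 1)) <=
  2 * Lam m * Es E m (fun s => (lam s g')%:R).
  move=> g0 H0.
  have L1 : Lam m = Es E m (fun s => (lam s 0)%:R) + 1.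
    rewrite -[X in _ + X](Es_cst hE m) -(EsD hE); [|bddl..].
    by apply: Es_ext => s _; rewrite lam_neg// mulrSr.
  rewrite (@Es_ext _ _ _ _ (fun s => (lam s 0)%:R * ((lam s 0)%:R + 1) +
    2 * ((lam s 0)%:R + 1))); last first.
    by move=> s _; rewrite lam_neg// mulrSr; ring.
  rewrite [X in _ <= _ * X](@Es_ext _ _ _ _ (fun s => (lam s 0)%:R + 1)); last first.
    by move=> s _; rewrite lam_neg// mulrSr.
  rewrite !(EsD hE, EsZ hE, Es_cst hE) -?L1; [|bddl..].
  have := Lam_ge1 m; nra.
elim: n g => [|n IHn] g.
  have zero : Es E 0 (fun s => (lam s 0)%:R * ((lam s 0)%:R + 1)) <=
      2 * Lam 0 * Es E 0 (fun s => (lam s 0)%:R) by rewrite /= mul0r mulr0.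
  have [g0|g0] := ltP g 0; first exact: neg.
  by rewrite /= ltNge g0 /= mul0r mulr0.
have pos g' : 0 <= g' ->
  Es E n.+1 (fun s => (lam s g')%:R * ((lam s g')%:R + 1)) <=
  2 * Lam n.+1 * Es E n.+1 (fun s => (lam s g')%:R).
  move=> g0; rewrite -(EsZ hE); last by bddl.
  apply: (Es_cons_le2 hE); [bddl..|] => z.
  rewrite (@Es_ext _ _ _ _ (fun s => (lam s (g' - z))%:R * ((lam s (g' - z))%:R + 1))); last first.
    by move=> s _; rewrite lam_cons.
  rewrite [leRHS](@Es_ext _ _ _ _ (fun s => 2 * Lam n.+1 * (lam s (g' - z))%:R)); last first.
    by move=> s _; rewrite lam_cons.
  apply: le_trans (IHn _) _; rewrite (EsZ hE); last by bddl.
  rewrite ler_wpM2r ?ler_pM2l ?Lam_mono//.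
  by apply: (Es_ge0 hE) => //; bddl.
have [g0|g0] := ltP g 0; last exact: pos.
by apply: neg => //; apply: pos.
Qed.

Lemma Lam_second n : Es E n (fun s => (lam s (-1))%:R ^+ 2) <= 2 * Lam n ^+ 2.
Proof.
apply: le_trans (_ : _ <= 2 * Lam n * Es E n (fun s => (lam s (-1))%:R)) _; last first.
  by rewrite -/(Lam n); lra.
apply: le_trans (lam_second n (-1)); apply: (Es_le hE); [bddl..|] => s _.
by rewrite expr2 mulrDr mulr1 lerDl.
Qed.

End renewal.

(** * Linearity of the renewal function *)

Section nearly_additive.
Context {R : realType}.
Variable f : nat -> R.
Hypothesis f_mono : forall x y, (x <= y)%N -> f x <= f y.
Hypothesis f_ge0 : forall x, 0 <= f x.
Hypothesis f_subadd : forall x y, f (x + y)%N <= f x + f y.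
Hypothesis f_superadd : forall e : R, 0 < e -> exists x0, forall x y r,
  (x0 <= x)%N -> (r <= y)%N -> e * x%:R <= r%:R ->
  f x + (1 - e) * f (y - r)%N <= f (x + y)%N.

Lemma subadditiveM k x : f (k * x) <= k%:R * f x + f 0.
Proof.
elim: k => [|k IHk]; first by rewrite mul0n mul0r add0r.
rewrite mulSn (le_trans (f_subadd _ _))// -[in leRHS]natr1; lra.
Qed.

Lemma nat_upper_bound (x : R) : exists k : nat, x <= k%:R.
Proof.
by exists (Num.bound `|x|); rewrite (le_trans (ler_norm x))// ltW// archi_boundP.
Qed.

(** A crude bound that starts the bootstrap. With gaps of half a block, each block still contributes
    half of [f (r - r./2)], which is at least [f r / 2] by subadditivity; hence the 4. *)
Lemma nearly_additive_lower_weak j : exists r0, forall r, (r0 <= r)%N -> j%:R / 4 * f r <= f (j * r).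
Proof.
(* So small that the gap demanded at any point up to [j r] is at most [r./2]. *)
have e0 : 0 < (3 * j.+1%:R)^-1 :> R by rewrite invr_gt0 mulr_gt0.
have [x0 Hx0] := f_superadd e0; exists (x0 + 3)%N => r r0.
have [->|j0] := eqVneq j 0%N; first by rewrite !mul0r f_ge0.
have half : f r <= 2 * f (r - r./2).
  rewrite (le_trans (@f_mono _ (r - r./2 + (r - r./2)) _))//; first by lia.
  by rewrite (le_trans (f_subadd _ _))// mulr2n mulrDl mul1r.
have step i : (i < j)%N -> f r + i%:R / 4 * f r <= f (i.+1 * r).
  elim: i => [|i IHi] ij; first by rewrite mul0r mul0r addr0 mul1n.
  have := Hx0 (i.+1 * r)%N r r./2 ltac:(rewrite mulSn; lia) ltac:(lia).
  have H1 : (3 * j.+1%:R)^-1 * (i.+1 * r)%:R <= (r./2)%:R :> R.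
    rewrite ler_pdivrMl ?mulr_gt0// -!natrM ler_nat.
    rewrite mulnAC; apply: (@leq_trans (j.+1 * (3 * r./2))); last by lia.
    by apply: leq_mul; lia.
  move=> /(_ H1).
  have -> : (i.+1 * r + r = i.+2 * r)%N by lia.
  have H2 : (3 * j.+1%:R)^-1 <= 2^-1 :> R.
    by rewrite lef_pV2 ?posrE ?mulr_gt0// -natrM ler_nat; lia.
  move: (_^-1) H2 => q H2.
  have := IHi ltac:(lia); have := half; have := f_ge0 (r - r./2).
  rewrite -(natr1 i) => F0 hf.
  have : (1 - q) * f (r - r./2) >= 2^-1 * f (r - r./2).
    by apply: ler_wpM2r => //; lra.
  lra.
have := step j.-1 ltac:(lia); rewrite prednK ?lt0n//.
have -> : j.-1%:R = j%:R - 1 :> R by rewrite -subn1 natrB// lt0n.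
have := f_ge0 r; lra.
Qed.

(** The gaps now have length [r = w / j]. By the crude bound [f r] is at most [(e / 2) f w], so a
    window shortened by a gap keeps the factor [1 - e / 2], and [(1 - e / 2) ^ 2 >= 1 - e]. *)
Lemma nearly_additive_lower K (e : R) : 0 < e -> exists w0, forall w k, (w0 <= w)%N -> (k <= K)%N ->
  k%:R * (1 - e) * f w <= f (k * w).
Proof.
move=> e0; have [j jE] := nat_upper_bound (8 / e + 1).
have j1 : 8 / e + 1 > 1 by rewrite ltrDr divr_gt0.
have j0 : (0 < j)%N by rewrite -(ltr_nat R); lra.
have ej : 4 / j%:R <= e / 2.
  rewrite ler_pdivrMr ?ltr0n//.
  have : 8 / e <= j%:R by lra.
  rewrite ler_pdivrMr//; lra.
have [r0 Hr0] := nearly_additive_lower_weak j.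
(* Since [w <= 2 j r], the gap demanded at any point up to [K.+1 * w] is at most [r]. *)
pose e' : R := Num.min (e / 2) (2 * j%:R * K.+1%:R)^-1.
have e'0 : 0 < e' by rewrite lt_min divr_gt0//= invr_gt0 !mulr_gt0 ?ltr0n.
have [x0 Hx0] := f_superadd e'0.
exists (x0 + 2 * j + j * r0.+1)%N => w k wb kK.
pose r := (w %/ j)%N.
have jr : (j * r <= w)%N by rewrite mulnC leq_trunc_div.
have jr2 : (w < j * r + j)%N by rewrite /r; have := ltn_ceil w j0; lia.
have rw : (r <= w)%N by exact: leq_div.
have fr : f r <= 4 / j%:R * f w.
  have : j%:R / 4 * f r <= f w.
    apply: le_trans (f_mono jr); apply: Hr0; rewrite /r leq_divRL//.
    by lia.
  by move=> H; rewrite mulrAC ler_pdivlMr ?ltr0n//; lra.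
have fw : (1 - e / 2) * f w <= f (w - r).
  have := f_subadd r (w - r); rewrite subnKC; last by lia.
  have := f_ge0 w; have := ej; nra.
have [->|k0] := eqVneq k 0%N; first by rewrite !mul0r f_ge0.
have e'e : e' <= e / 2 by rewrite /e' ge_min lexx.
have [e1|e1] := leP 1 e.
  rewrite (le_trans _ (f_ge0 _))// mulr_le0_ge0//.
  by rewrite mulr_ge0_le0//; lra.
have F0 := f_ge0 w.
have e'K : e' <= (2 * j%:R * K.+1%:R)^-1 by rewrite /e' ge_min lexx orbT.
have x0w : (x0 <= w)%N.
  by apply: leq_trans wb; rewrite -addnA leq_addr.
have jw : (j <= w)%N.
  by apply: leq_trans wb; rewrite -addnA addnCA mul2n -addnn -addnA leq_addr.
have w2r : (w <= 2 * j * r)%N.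
  have : (j <= j * r)%N by rewrite leq_pmulr// divn_gt0.
  by rewrite -mulnA; move: jr2; move: (j * r)%N => p; clear; lia.
clear fr wb jr jr2 jw; clearbody e' r.
have step i : (i < k)%N -> f w + i%:R * (1 - e) * f w <= f (i.+1 * w).
  elim: i => [|i IHi] ik; first by rewrite mul0r mul0r addr0 mul1n.
  have := Hx0 (i.+1 * w)%N w r (leq_trans x0w (leq_addr _ _)) rw.
  have H1 : e' * (i.+1 * w)%:R <= r%:R.
    apply: (@le_trans _ _ ((2 * j%:R * K.+1%:R)^-1 * (i.+1 * w)%:R)).
      by rewrite ler_wpM2r.
    rewrite ler_pdivrMl ?mulr_gt0 ?ltr0n// -!natrM ler_nat.
    rewrite [leqRHS]mulnAC [leqRHS]mulnC; apply: leq_mul => //.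
    exact: leq_trans (ltnW ik) (leq_trans kK (leqnSn K)).
  move=> /(_ H1).
  have -> : (i.+1 * w + w = i.+2 * w)%N by rewrite addnC -mulSn.
  have := IHi (ltnW ik); rewrite -(natr1 i).
  have : (1 - e') * f (w - r) >= (1 - e) * f w.
    apply: (@le_trans _ _ ((1 - e / 2) * ((1 - e / 2) * f w))).
      rewrite mulrA ler_wpM2r//; nra.
    apply: ler_pM => //; [lra|rewrite mulr_ge0//; lra|lra].
  lra.
have := step k.-1; rewrite prednK ?lt0n// => /(_ (leqnn _)).
have -> : k.-1%:R = k%:R - 1 :> R by rewrite -subn1 natrB// lt0n.
nra.
Qed.

(** Both arguments are measured in units of [w = x / J]. At multiples of [w], subadditivity bounds
    [f] from above and [nearly_additive_lower] from below, so [f x] and [f z] are close to [J f w]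
    and [i f w], where [i / J] is close to [z / x]. *)
Lemma nearly_additive_linear B (e : R) : 0 < e -> exists x0, forall x z, (x0 <= x)%N -> (z <= B * x)%N ->
  `|f z - z%:R / x%:R * f x| <= e * f x.
Proof.
wlog e1 : e / e <= 1.
  move=> H e0; have [e1|e1] := leP e 1; first exact: H.
  have [x0 Hx0] := H 1 (lexx 1) ltr01; exists x0 => x z x0x zx.
  rewrite (le_trans (Hx0 x z x0x zx))// ler_wpM2r//; lra.
move=> e0.
(* [J] makes the rounding to multiples of [w] cheap, and [d] below makes the factor [1 - d] cheap
   over the whole range [i <= B J.+1]. *)
have [J JE] := nat_upper_bound (16 * (B%:R + 2) / e).
have B0 : 0 <= B%:R :> R by [].
have J1 : 1 < J%:R :> R.
  rewrite (lt_le_trans _ JE)// ltr_pdivlMr//; lra.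
have JE' : 16 * (B%:R + 2) <= e * J%:R by move: JE; rewrite ler_pdivrMr// [leRHS]mulrC.
pose d : R := e / (16 * (B%:R + 1)).
have d0 : 0 < d by rewrite divr_gt0// mulr_gt0//; lra.
have dE : d * (16 * (B%:R + 1)) = e by rewrite /d divfK//; lra.
have d1 : d <= 2^-1 by nra.
have [w0 Hw0] := nearly_additive_lower (B.+1 * J.+1) d0.
exists (J * (w0 + J).+1)%N => x z xb zx.
have J0 : (0 < J)%N by rewrite -(ltr_nat R); lra.
pose w := (x %/ J)%N; pose i := (z %/ w)%N.
have wb : (w0 + J < w)%N by rewrite /w leq_divRL// mulnC.
have w_gt0 : (0 < w)%N by exact: leq_ltn_trans wb.
have w0w : (w0 <= w)%N by apply: leq_trans (ltnW wb); exact: leq_addr.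
have xl : (J * w <= x)%N by rewrite mulnC leq_trunc_div.
have xu : (x <= J.+1 * w)%N.
  rewrite mulSnr (leq_trans (ltnW (ltn_ceil x J0)))// -/w mulSnr mulnC leq_add2l.
  by apply: leq_trans (ltnW wb); exact: leq_addl.
have zl : (i * w <= z)%N by rewrite leq_trunc_div.
have zu : (z <= i.+1 * w)%N by rewrite ltnW// ltn_ceil.
have iB : (i <= B * J.+1)%N.
  by rewrite -(leq_pmul2r w_gt0) (leq_trans zl)// (leq_trans zx)// -mulnA leq_mul.
have iK : (i <= B.+1 * J.+1)%N by rewrite (leq_trans iB)// leq_mul.
have JK : (J <= B.+1 * J.+1)%N by rewrite (leq_trans (leqnSn J))// leq_pmull.
have x0 : (0 < x)%N by rewrite (leq_trans _ xl)// muln_gt0 J0.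
have ixz : (i * x <= z * J.+1)%N.
  rewrite (leq_trans (leq_mul (leqnn i) xu))// mulnCA [leqRHS]mulnC leq_mul//.
have zJx : (z * J <= i.+1 * x)%N.
  by rewrite (leq_trans (leq_mul zu (leqnn J)))// -mulnA leq_mul// mulnC.
clear xb wb; clearbody i w.
have F0 := f_ge0 w.
have f_up k : f (k.+1 * w) <= k.+1%:R * f w.
  elim: k => [|k IHk]; first by rewrite !mul1n mul1r.
  rewrite mulSn (le_trans (f_subadd _ _))// -[in leRHS]natr1; lra.
have fz1 : f z <= (i%:R + 1) * f w.
  by rewrite natr1 (le_trans _ (f_up i))// f_mono.
have fz2 : i%:R * (1 - d) * f w <= f z.
  by rewrite (le_trans _ (f_mono zl))// Hw0.
have fx1 : f x <= (J%:R + 1) * f w.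
  by rewrite natr1 (le_trans _ (f_up J))// f_mono.
have fx2 : J%:R * (1 - d) * f w <= f x.
  by rewrite (le_trans _ (f_mono xl))// Hw0.
pose t : R := z%:R / x%:R.
have tx : t * x%:R = z%:R by rewrite /t divfK// pnatr_eq0 -lt0n.
have xR : 0 < x%:R :> R by rewrite ltr0n.
have t1 : i%:R <= t * (J%:R + 1).
  by rewrite /t mulrAC ler_pdivlMr// natr1 -!natrM ler_nat.
have t2 : t * J%:R <= i%:R + 1.
  by rewrite /t mulrAC ler_pdivrMr// natr1 -!natrM ler_nat.
have t0 : 0 <= t by rewrite divr_ge0.
have iR : i%:R <= B%:R * (J%:R + 1) :> R by rewrite natr1 -natrM ler_nat.
have tB : t <= B%:R by rewrite /t ler_pdivrMr// -natrM ler_nat.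
have iR0 : 0 <= i%:R :> R by [].
rewrite -/t.
have Bd : B%:R * d <= e / 16 by nra.
have key : 1 + B%:R + (i%:R + 1) * d <= e * (J%:R * (1 - d)).
  have : i%:R * d <= (J%:R + 1) * (e / 16).
    apply: (@le_trans _ _ (B%:R * (J%:R + 1) * d)); first by rewrite ler_wpM2r// ltW.
    by rewrite mulrAC mulrC ler_wpM2l//; lra.
  have : e * (J%:R * (1 - d)) >= e * J%:R / 2 by nra.
  nra.
have eF : (1 + B%:R + (i%:R + 1) * d) * f w <= e * f x.
  apply: (@le_trans _ _ (e * (J%:R * (1 - d)) * f w)); first by rewrite ler_wpM2r.
  by rewrite -mulrA ler_wpM2l// ltW.
rewrite ler_norml; apply/andP; split.
  have : t * f x <= (i%:R + 1 + B%:R) * f w.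
    apply: (@le_trans _ _ (t * ((J%:R + 1) * f w))); first by rewrite ler_wpM2l.
    by rewrite mulrA ler_wpM2r//; nra.
  nra.
have : (i%:R - B%:R - (i%:R + 1) * d) * f w <= t * f x.
  apply: (@le_trans _ _ (t * (J%:R * (1 - d) * f w))); last exact: ler_wpM2l.
  rewrite (mulrA t); apply: ler_wpM2r => //; nra.
nra.
Qed.

End nearly_additive.

Section renewal_limit.
Context {R : realType}.
Variable E : (int -> R) -> R.
Hypothesis hE : averaging E.
Local Notation Pr := (Ps E).
Local Notation Vn := (Vn E).

Definition Vlim y : R := sup [set Vn n y | n in [set: nat]].

Let Vset y : has_sup [set Vn n y | n in [set: nat]].
Proof.
split; first by exists (Vn 0 y); exists 0%N.
by exists y%:R => _ [n _ <-]; exact: Vn_le_id.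
Qed.

Lemma Vn_le_V n y : Vn n y <= Vlim y.
Proof. by apply: sup_upper_bound => //; exists n. Qed.

Lemma V_le y c : (forall n, Vn n y <= c) -> Vlim y <= c.
Proof. by move=> H; apply: ge_sup => [|_ [n _ <-]//]; have [] := Vset y. Qed.

Lemma V_adh y e : 0 < e -> exists n0, forall n, (n0 <= n)%N -> Vlim y - e <= Vn n y.
Proof.
move=> e0; have [_ [n0 _ <-] H] := sup_adherent e0 (Vset y).
exists n0 => n n0n; rewrite (le_trans (ltW H))//.
exact: Vn_mono.
Qed.

Lemma V_cvg y : Vn n y @[n --> \oo] --> Vlim y.
Proof.
apply/cvgrPdist_le => e e0; have [n0 H] := V_adh y e0.
exists n0 => // n /= n0n; rewrite ger0_norm; first by have := H n n0n; lra.
by rewrite subr_ge0 Vn_le_V.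
Qed.

Lemma V_mono y y' : (y <= y')%N -> Vlim y <= Vlim y'.
Proof.
by move=> yy'; apply: V_le => n; rewrite (le_trans _ (Vn_le_V n y'))// Vn_monoy.
Qed.

Lemma V_ge0 y : 0 <= Vlim y.
Proof. by rewrite (le_trans _ (Vn_le_V 0 y))// Vn_ge0. Qed.

Lemma V_ge1 y : (0 < y)%N -> 1 <= Vlim y.
Proof.
by move=> y0; rewrite -(Vn1 hE 0) (le_trans _ (Vn_le_V 0 y))// Vn_monoy.
Qed.

Lemma V_sub x y : Vlim (x + y) <= Vlim x + Vlim y.
Proof.
apply: V_le => n; rewrite (le_trans (Vn_sub hE n x y))//.
by rewrite lerD ?Vn_le_V.
Qed.

Lemma V_sup n x y r : (r <= y)%N ->
  Vlim x + Pr n (fun s => passes s (x%:Z - 1) r%:Z) * Vlim (y - r) <= Vlim (x + y).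
Proof.
move=> ry; apply/ler_addgt0Pr => e e0.
have e2 : 0 < e / 2 by rewrite divr_gt0.
have [n1 H1] := V_adh x e2; have [n2 H2] := V_adh (y - r) e2.
have := Vn_sup hE n (n1 + n2) x ry.
have := H1 (n + (n1 + n2))%N ltac:(lia); have := H2 (n1 + n2)%N ltac:(lia).
have := Vn_le_V (n + (n1 + n2)) (x + y).
have := Ps_ge0 hE n (fun s => passes s (x%:Z - 1) r%:Z).
have := Ps_le1 hE n (fun s => passes s (x%:Z - 1) r%:Z).
set p := Ps _ _ _; nra.
Qed.

Lemma passes_ge n (x r : nat) : (0 < x)%N ->
  Pr n (fun s => passes s (x%:Z - 1) r%:Z) >=
  1 - Pr n (fun s => mx s < x%:Z) - Pr n (fun s => ~~ all (fun z => z <= r%:Z) s).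
Proof.
move=> x0.
have := Ps_or hE n (fun s => mx s < x%:Z) (fun s => ~~ all (fun z => z <= r%:Z) s).
have : Pr n (fun s => ~~ passes s (x%:Z - 1) r%:Z) <=
   Pr n (fun s => (mx s < x%:Z) || ~~ all (fun z => z <= r%:Z) s).
  apply: (Ps_le hE) => s _; apply: contraR; rewrite negb_or negbK => /andP[xs rs].
  by apply: passesP => //; move: xs; rewrite -?leNgt; lia.
rewrite (Ps_neg hE); lra.
Qed.

Lemma Ps_not_all n (b : int -> bool) :
  Pr n (fun s => ~~ all b s) <= n%:R * E (fun z => (~~ b z)%:R).
Proof.
elim: n => [|n IHn]; first by rewrite mul0r.
rewrite /Ps /=.
apply: (@le_trans _ _ (E (fun z => (~~ b z)%:R + Pr n (fun s => ~~ all b s)))).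
  apply: (ex_le hE); [apply: bd_Es|bdd|] => //.
    by exists 1 => z s _; case: (~~ _); rewrite ?normr1 ?normr0.
  move=> z; rewrite -(Es_cst hE n (~~ b z)%:R) -(EsD hE); [|bdd..].
  apply: (Es_le hE); [bdd..|] => s _.
  by case: (b z); case: (all b s) => /=; lra.
rewrite (exD hE); [|bdd..]; rewrite (ex_cst hE) -natr1 mulrDl mul1r addrC.
by rewrite lerD2r.
Qed.

End renewal_limit.

(** * Second moments of ladder counts and typical blocks *)

Section second_moment.
Context {R : realType}.
Variable E : (int -> R) -> R.
Hypothesis hE : averaging E.
Local Notation Pr := (Ps E).
Local Notation Vn := (Vn E).
Local Notation Vlim := (Vlim E).

Let win s g (i : nat) : R := (lam s g)%:R - (lam s (g + i%:Z))%:R.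
Let W m g i := Es E m (fun s => win s g i).

Let win_ge0 s g i : 0 <= win s g i.
Proof. by rewrite subr_ge0 ler_nat lam_mono//; lia. Qed.

Let bn_win n g i : bn n (fun s => win s g i).
Proof. by rewrite /win; bddl. Qed.

Let W_ge0 m g i : 0 <= W m g i.
Proof. by apply: (Es_ge0 hE) => //; exact: bn_win. Qed.

Let win0 s g : win s g 0 = 0.
Proof. by rewrite /win addr0 subrr. Qed.

(* Twice the sum of the window counts seen from each ladder height of the window
   is the left-hand side; each of these counts has mean at most [A i + B], where
   [i] is the length that remains. *)
Lemma window_second n (A B : R) Y : 0 <= A -> 0 <= B ->
  (forall y, (y <= Y)%N -> Vn n y <= A * y%:R + B) ->
  forall m g L, (m <= n)%N -> (L <= Y)%N ->
  Es E m (fun s => win s g L * (win s g L + 1)) <=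
  2 * A * \sum_(i < L) W m g i.+1 + 2 * B * W m g L.
Proof.
move=> A0 B0 HV.
have neg m g L : (m <= n)%N -> (L <= Y)%N -> g < 0 ->
  (forall L', (L' <= Y)%N -> Es E m (fun s => win s 0 L' * (win s 0 L' + 1)) <=
    2 * A * \sum_(i < L') W m 0 i.+1 + 2 * B * W m 0 L') ->
  Es E m (fun s => win s g L * (win s g L + 1)) <=
  2 * A * \sum_(i < L) W m g i.+1 + 2 * B * W m g L.
  move=> mn LY g0 H0.
  have [gL|gL] := ltP (g + L%:Z) 0.
    rewrite (@Es_ext _ _ _ _ (fun=> 0)); last first.
      by move=> s _; rewrite /win (lam_neg2 s g0 gL) subrr mul0r.
    rewrite (Es_cst hE) addr_ge0// mulr_ge0// ?mulr_ge0//.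
    by apply: sumr_ge0 => i _; exact: W_ge0.
  (* With [k = - g], a window shorter than [k] is empty, and one of length [k + i] contains the
     initial height and what a window of length [i] above level 0 contains. *)
  pose e := `|(g + L%:Z)%R|%N; pose k := `|g|%N.
  have eE : g + L%:Z = e by lia.
  have kE : g = - k%:Z by lia.
  have LE : L = (k.-1 + e.+1)%N by lia.
  have winE s i : win s g (k + i) = 1 + win s 0 i.
    rewrite /win (lam_neg s g0) (_ : g + (k + i)%:Z = 0 + i%:Z) -?natr1; first by lra.
    lia.
  have WE i : W m g (k + i) = 1 + W m 0 i.
    rewrite -[X in X + _](Es_cst hE m) -(EsD hE); [|bdd|exact: bn_win].
    by apply: Es_ext => s _; exact: winE.
  have LE' : L = (k + e)%N by lia.
  rewrite [X in _ <= _ + 2 * B * W _ _ X]LE' WE.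
  have -> : \sum_(i < L) W m g i.+1 = e.+1%:R + \sum_(i < e) W m 0 i.+1.
    rewrite LE big_split_ord/= big1 ?add0r; last first.
      move=> i _; rewrite /W (@Es_ext _ _ _ _ (fun=> 0)) ?(Es_cst hE)//.
      move=> s _; rewrite /win (@lam_neg2 s _ (g + i.+1%:Z)) ?subrr//.
      by have := ltn_ord i; lia.
    rewrite (eq_bigr (fun i : 'I_e.+1 => 1 + W m 0 i)); last first.
      by move=> i _; rewrite -WE; congr W; lia.
    rewrite big_split/= sumr_const card_ord; congr (_ + _).
    rewrite big_ord_recl /W (@Es_ext _ _ _ _ (fun=> 0)).
      by rewrite (Es_cst hE) add0r.
    by move=> s _; rewrite win0.
  have VE : Vn m e.+1 = 1 + W m 0 e.
    rewrite -[X in X + _](Es_cst hE m) -(EsD hE); [|bdd|exact: bn_win].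
    apply: Es_ext => s _; rewrite natr_cnt// /win (@lam_neg s (-1))//.
    by rewrite (_ : e.+1%:Z - 1 = 0 + e%:Z) -?natr1; [lra|lia].
  have := HV e.+1 ltac:(lia); have := Vn_mono hE e.+1 mn; rewrite VE => h1 h2.
  rewrite (@Es_ext _ _ _ _ (fun s => win s 0 e * (win s 0 e + 1) +
     2 * (1 + win s 0 e))); last first.
    by move=> s _; rewrite LE' winE; ring.
  have bw := bn_win m 0 e.
  rewrite (EsD hE); [|bdd..]; rewrite (EsZ hE); last by bdd.
  rewrite (EsD hE); [|bdd..]; rewrite (Es_cst hE) -/(W m 0 e).
  have := H0 e ltac:(lia).
  have := W_ge0 m 0 e; set S := \sum_(i < e) _; nra.
elim=> [|m IHm] g L mn LY.
  have zero L' : (L' <= Y)%N -> Es E 0 (fun s => win s 0 L' * (win s 0 L' + 1)) <=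
    2 * A * \sum_(i < L') W 0 0 i.+1 + 2 * B * W 0 0 L'.
    move=> L'Y; rewrite [leLHS]/= {1}/win /= !subr0 mul0r addr_ge0// mulr_ge0// ?mulr_ge0//.
    by apply: sumr_ge0 => i _; exact: W_ge0.
  have [g0|g0] := ltP g 0; first exact: neg.
  rewrite [leLHS](_ : _ = 0).
    rewrite addr_ge0// mulr_ge0// ?mulr_ge0//.
    by apply: sumr_ge0 => i _; exact: W_ge0.
  by rewrite /= /win !lam_mx0/= ?subrr ?mul0r//; lia.
have pos g' L' : 0 <= g' -> (L' <= Y)%N ->
  Es E m.+1 (fun s => win s g' L' * (win s g' L' + 1)) <=
  2 * A * \sum_(i < L') W m.+1 g' i.+1 + 2 * B * W m.+1 g' L'.
  move=> g0 L'Y.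
  have bw p h i := bn_win p h i.
  have winS z s i : win (z :: s) g' i = win s (g' - z) i.
    rewrite /win !lam_cons//; last by lia.
    by congr (_ - (lam s _)%:R); lia.
  have -> : 2 * A * \sum_(i < L') W m.+1 g' i.+1 + 2 * B * W m.+1 g' L' =
     Es E m.+1 (fun s => 2 * A * \sum_(i < L') win s g' i.+1 + 2 * B * win s g' L').
    have bs : bn m.+1 (fun s => \sum_(i < L') win s g' i.+1) by apply: bn_sum.
    have bL := bw m.+1 g' L'.
    rewrite (EsD hE); [|bdd..]; rewrite !(EsZ hE)//; [|bdd..].
    by rewrite (Es_sum hE)//.
  have bs p h : bn p (fun s => \sum_(i < L') win s h i.+1) by apply: bn_sum.
  have bS := bs m.+1 g'; have bL := bw m.+1 g' L'.
  apply: (Es_cons_le2 hE); [bdd..|] => z.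
  rewrite (@Es_ext _ _ _ _ (fun s => win s (g' - z) L' * (win s (g' - z) L' + 1))); last first.
    by move=> s _; rewrite winS.
  rewrite [leRHS](@Es_ext _ _ _ _ (fun s => 2 * A * \sum_(i < L') win s (g' - z) i.+1 +
      2 * B * win s (g' - z) L')); last first.
    by move=> s _; rewrite winS; under eq_bigr => i _ do rewrite winS.
  apply: le_trans (IHm (g' - z) L' ltac:(lia) L'Y) _.
  have bS' := bs m (g' - z); have bL' := bw m (g' - z) L'.
  rewrite (EsD hE); [|bdd..]; rewrite !(EsZ hE)//; [|bdd..].
  by rewrite (Es_sum hE).
have [g0|g0] := ltP g 0; last exact: pos.
by apply: neg => // L' L'Y; apply: pos.
Qed.

(** Summing the linear bound over window lengths gives the leading term [A ^ 2 y ^ 2] with constant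
    1, as a variance estimate requires; the constant 2 of [Lam_second] would not suffice for
    that. *)
Lemma cnt_second n (A B : R) Y y : 0 <= A -> 0 <= B ->
  (forall y, (y <= Y)%N -> Vn n y <= A * y%:R + B) -> (y <= Y)%N ->
  Es E n (fun s => (cnt s y%:Z)%:R ^+ 2) <=
  A ^+ 2 * (y%:R * (y%:R + 1)) + 4 * A * B * y%:R + 2 * B ^+ 2.
Proof.
move=> A0 B0 HV yY.
have winE s i : (cnt s i%:Z)%:R = win s (-1) i.
  by rewrite natr_cnt// /win addrC.
have WE i : W n (-1) i = Vn n i by apply: Es_ext => s _; rewrite winE.
apply: (@le_trans _ _ (Es E n (fun s => win s (-1) y * (win s (-1) y + 1)))).
  have bw := bn_win n (-1) y.
  apply: (Es_le hE); [bddl|bdd|] => s _.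
  by rewrite winE expr2; have := win_ge0 s (-1) y; nra.
apply: le_trans (window_second A0 B0 HV (-1) (leqnn n) yY) _.
rewrite WE; under eq_bigr => i _ do rewrite WE.
have : \sum_(i < y) Vn n i.+1 <= A * (y%:R * (y%:R + 1) / 2) + B * y%:R.
  elim: y yY => [|y IHy] yY; first by rewrite big_ord0 !mul0r !mulr0 addr0.
  rewrite big_ord_recr/=.
  have := HV y.+1 yY; have := IHy (ltnW yY); rewrite -(natr1 y); nra.
have := HV y yY; nra.
Qed.

(** Chebyshev's inequality is applied to a longer path, whose mean count is close to [Vlim y]. The
    count of its first [n] steps is never larger, and it is the same once the maximum has reached
    [y - 1]; a low count is therefore excluded only in that case. *)
Lemma cnt_chebyshev n (k d t : R) Y y : 0 <= k -> 0 < d -> 0 < t ->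
  (forall y, (y <= Y)%N -> `|Vlim y - k * y%:R| <= d) -> (y <= Y)%N ->
  Pr n (fun s => (t <= (cnt s y%:Z)%:R - k * y%:R) ||
    ((y%:Z <= mx s + 1) && (t <= k * y%:R - (cnt s y%:Z)%:R))) <=
  t ^- 2 * (k ^+ 2 * y%:R + 8 * k * d * y%:R + 2 * d ^+ 2).
Proof.
move=> k0 d0 t0 HV yY.
have [n0 Hn0] := V_adh hE y d0.
pose N := (n + n0)%N.
have HVN : Vlim y - d <= Vn N y by apply: Hn0; lia.
rewrite /Ps -(Es_take hE _ (leq_addr n0 n : (n <= N)%N)).
have HV1 z : (z <= Y)%N -> Vn N z <= k * z%:R + d.
  move=> zY; have := Vn_le_V hE N z; have := HV z zY.
  by rewrite ler_norml => /andP[_]; lra.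
have H2 := cnt_second k0 (ltW d0) HV1 yY.
have bc : bn N (fun s => ((cnt s y%:Z)%:R - k * y%:R) ^+ 2 : R) by bddl.
have t20 : 0 < t ^+ 2 by exact: exprn_gt0.
apply: le_trans (Markov hE t20 bc _ _) _.
- by move=> s _; exact: sqr_ge0.
- move=> s sN /orP[H|/andP[H1 H]].
    have : (cnt (take n s) y%:Z)%:R <= (cnt s y%:Z)%:R :> R.
      by rewrite ler_nat -{2}(cat_take_drop n s) cnt_le.
    move=> H3; nra.
  have <- : cnt (take n s) y = cnt s y.
    by rewrite -[in RHS](cat_take_drop n s) cnt_cat_stable.
  nra.
rewrite ler_pM2l ?invr_gt0 ?exprn_gt0//.
rewrite (@Es_ext _ _ _ _ (fun s => (cnt s y%:Z)%:R ^+ 2 + (- 2 * k * y%:R) * (cnt s y%:Z)%:R +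
    (k * y%:R) ^+ 2)); last by move=> s _; ring.
rewrite (EsD hE); [|bddl..]; rewrite (EsD hE); [|bddl..]; rewrite (Es_cst hE).
rewrite (EsZ hE); last by bddl.
(* The mean [Vn N y] is at least [k y - 2 d], so the terms [(k y) ^ 2] cancel. *)
rewrite -/(Vn N y); have := HV y yY; rewrite ler_norml => /andP[H3 _].
have y0 : 0 <= y%:R :> R by [].
have : 0 <= k * y%:R by rewrite mulr_ge0.
nra.
Qed.

(* Up to its own maximum the block has the expected number of ladder heights. *)
Definition good (k t : R) (b : seq int) : bool :=
  `[< forall y : nat, y%:Z <= mx b + 1 -> `|(cnt b y%:Z)%:R - k * y%:R| <= t >].

(** Counts are monotone in [y], so it is enough to control them at the multiples of [w], between
    which [k y] changes by at most [t / 2]. The bound on the maximum limits these multiples to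
    [N + 2]. *)
Lemma bad_bound n (k d t : R) N w : 0 <= k -> 0 < d -> 0 < t -> (0 < w)%N ->
  k * w%:R <= t / 2 ->
  (forall y, (y <= N.+1 * w)%N -> `|Vlim y - k * y%:R| <= d) ->
  Pr n (fun b => ~~ good k t b) <= Pr n (fun b => (N * w)%:Z <= mx b) +
    N.+2%:R * ((t / 2) ^- 2 * (k ^+ 2 * (N.+1 * w)%:R + 8 * k * d * (N.+1 * w)%:R + 2 * d ^+ 2)).
Proof.
move=> k0 d0 t0 w0 kw HV.
have t2 : 0 < t / 2 by rewrite divr_gt0.
pose dev (j : nat) (s : seq int) : bool := (t / 2 <= (cnt s (j * w)%:Z)%:R - k * (j * w)%:R) ||
    (((j * w)%:Z <= mx s + 1) && (t / 2 <= k * (j * w)%:R - (cnt s (j * w)%:Z)%:R)).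
have devP (j : 'I_N.+2) : Pr n (dev j) <= (t / 2) ^- 2 *
    (k ^+ 2 * (N.+1 * w)%:R + 8 * k * d * (N.+1 * w)%:R + 2 * d ^+ 2).
  have jw : (j * w <= N.+1 * w)%N by rewrite leq_mul// -ltnS.
  apply: le_trans (cnt_chebyshev n k0 d0 t2 HV jw) _.
  rewrite ler_pM2l ?invr_gt0 ?exprn_gt0//.
  have jR : (j * w)%:R <= (N.+1 * w)%:R :> R by rewrite ler_nat.
  by rewrite lerD2r lerD// ler_wpM2l ?mulr_ge0 ?sqr_ge0// ltW.
apply: le_trans (_ : _ <= Pr n (fun b => ((N * w)%:Z <= mx b) || [exists j : 'I_N.+2, dev j b])) _.
  apply: (Ps_le hE) => s _; apply: contraR; rewrite negb_or => /andP[Nw /existsPn Hd].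
  apply/asboolP => y ym.
  pose j := (y %/ w)%N.
  have jl : (j * w <= y)%N by exact: leq_trunc_div.
  have ju : (y < j.+1 * w)%N by exact: ltn_ceil.
  have jN : (j < N.+1)%N.
    by rewrite /j ltn_divLR// mulSn; lia.
  (* The multiple above [y] serves for the upper bound, the one below for the lower bound, where the
     maximum is high enough. *)
  have := Hd (Ordinal (leqW jN)); have := Hd (Ordinal (jN : (j.+1 < N.+2)%N)).
  rewrite /dev /= !negb_or => /andP[+ _] /andP[_].
  have -> /= : ((j * w)%:Z <= mx s + 1) by lia.
  rewrite -!ltNge => h1 h2.
  have h3 : (cnt s y)%:R <= (cnt s (j.+1 * w)%N)%:R :> R.
    by rewrite ler_nat cnt_mono// lez_nat ltnW.
  have h4 : (cnt s (j * w)%N)%:R <= (cnt s y)%:R :> R.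
    by rewrite ler_nat cnt_mono.
  have h5 : k * (j * w)%:R <= k * y%:R by rewrite ler_wpM2l// ler_nat.
  have h6 : k * y%:R <= k * (j * w)%:R + k * w%:R.
    by rewrite -mulrDr -natrD ler_wpM2l// ler_nat -mulSnr ltnW.
  have h7 : k * (j.+1 * w)%:R = k * (j * w)%:R + k * w%:R.
    by rewrite -mulrDr -natrD -mulSnr.
  rewrite ler_norml; apply/andP; split; lra.
apply: le_trans (Ps_or hE _ _ _) _; rewrite lerD2l.
apply: le_trans (Ps_has hE _ _ _) _.
apply: (@le_trans _ _ (\sum_(j < N.+2) ((t / 2) ^- 2 *
    (k ^+ 2 * (N.+1 * w)%:R + 8 * k * d * (N.+1 * w)%:R + 2 * d ^+ 2)))).
  by apply: ler_sum => j _; exact: devP.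
by rewrite sumr_const card_ord -[leLHS]mulr_natl.
Qed.

End second_moment.

(** * Three blocks and the cycle lemma *)

Section blocks.
Context {R : realType}.

(** Above [g] lies the difference of the counts below [mx b + 1] and below [g + 1], each known up to
    [t]. *)
Lemma lam_good (k t : R) b g : 0 <= k -> good k t b -> 0 <= g ->
  `|(lam b g)%:R - k * (Num.max (mx b) g - g)%:~R| <= 2 * t.
Proof.
move=> k0 /asboolP gb g0; have mb := mx_ge0 b.
have t0 : 0 <= t by rewrite (le_trans _ (gb 0%N _))//; lia.
have [mg|gm] := leP (mx b) g.
  by rewrite lam_mx0// subrr mulr0 subrr normr0 mulr_ge0.
have H1 := gb (absz (mx b + 1)) ltac:(lia).
have H2 := gb (absz (g + 1)) ltac:(lia).
have e1 : (absz (mx b + 1))%:Z = mx b + 1 by lia.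
have e2 : (absz (g + 1))%:Z = g + 1 by lia.
have r1 : (absz (mx b + 1))%:R = (mx b)%:~R + 1 :> R.
  by rewrite pmulrn e1 intrD.
have r2 : (absz (g + 1))%:R = g%:~R + 1 :> R.
  by rewrite pmulrn e2 intrD.
rewrite e1 cnt_mx r1 in H1; rewrite e2 r2 in H2.
have e3 : (lam b (-1))%:R = (cnt b (g + 1))%:R + (lam b g)%:R :> R.
  by rewrite -natrD; congr _%:R; rewrite (@lam_cnt b (g + 1)) ?addrK//; lia.
rewrite intrB; move: H1 H2; rewrite e3 !ler_norml => /andP[a1 a2] /andP[a3 a4].
by apply/andP; split; lra.
Qed.

(* Above its running maximum each block contributes [k] times the increase of the
   running maximum, and these increases telescope. *)
Lemma lam_blocks (k t : R) s1 s2 s3 (x : int) : 0 <= k ->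
  good k t s1 -> good k t s2 -> good k t s3 ->
  sumz (s1 ++ s2 ++ s3) = x -> 0 < x ->
  `|(lam (s1 ++ s2 ++ s3) (mx (s1 ++ s2 ++ s3) - x))%:R - k * x%:~R| <= 6 * t.
Proof.
move=> k0 g1 g2 g3 sx x0; set s := s1 ++ s2 ++ s3.
pose g := mx s - x; have gs : sumz s <= mx s := mx_ge_sumz s.
have g0 : 0 <= g by rewrite /g -sx subr_ge0.
have sE : sumz s = sumz s1 + (sumz s2 + sumz s3) by rewrite !sumz_cat.
have mE : mx s = Num.max (mx s1) (sumz s1 + Num.max (mx s2) (sumz s2 + mx s3)).
  by rewrite !mx_cat.
rewrite -/g /s !lam_cat.
set h1 := Num.max g (mx s1) - sumz s1; set h2 := Num.max h1 (mx s2) - sumz s2.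
have h10 : 0 <= h1 by rewrite /h1; have := mx_ge_sumz s1; lia.
have h20 : 0 <= h2 by rewrite /h2; have := mx_ge_sumz s2; lia.
have := lam_good k0 g1 g0; have := lam_good k0 g2 h10; have := lam_good k0 g3 h20.
have -> : x%:~R = (Num.max (mx s1) g - g)%:~R + ((Num.max (mx s2) h1 - h1)%:~R +
   (Num.max (mx s3) h2 - h2)%:~R) :> R.
  rewrite -!intrD; congr _%:~R.
  move: mE sE; rewrite sx /h2 /h1 /g; lia.
rewrite !natrD !ler_norml => /andP[? ?] /andP[? ?] /andP[? ?].
by apply/andP; split; lra.
Qed.

Lemma lam_blocks_ub s1 s2 s3 g :
  (lam (s1 ++ s2 ++ s3) g <= lam s1 (-1) + (lam s2 (-1) + lam s3 (-1)))%N.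
Proof.
have le1 s h : (lam s h <= lam s (-1))%N.
  have [h0|h0] := ltP h 0; first by rewrite (lam_neg2 s h0 (_ : -1 < 0)).
  by apply: lam_mono; lia.
by rewrite !lam_cat !leq_add.
Qed.

End blocks.

(* If a block is bad, then the count is bounded by the sum of the counts of all blocks;
   each product on the right involves at most two blocks, so that the third one
   remains free. *)
Lemma nine_terms (R : realFieldType) (z l1 l2 l3 v t : R) (c1 c2 c3 : bool) :
  0 <= l1 -> 0 <= l2 -> 0 <= l3 -> 0 <= v -> 0 <= t ->
  z <= l1 + l2 + l3 + v -> (c1 -> c2 -> c3 -> z <= t) ->
  let b1 := (~~ c1)%:R in let b2 := (~~ c2)%:R in let b3 := (~~ c3)%:R in
  z <= t + ((l1 * b1 + l2 * b2 + l3 * b3) +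
    (l1 * b2 + l1 * b3 + l2 * b3 + b1 * l2 + b1 * l3 + b2 * l3) + v * (b1 + b2 + b3)).
Proof.
case: c1; case: c2; case: c3 => /= l10 l20 l30 v0 t0 zu zt;
  rewrite !(mulr0, mul0r, mulr1, mul1r, addr0, add0r);
  [exact: zt|clear zt; lra..].
Qed.

Lemma dist_le (R : realDomainType) (a v b : R) : 0 <= a -> 0 <= v -> a <= b ->
  `|a - v| <= b + v.
Proof. by move=> *; rewrite ler_norml; apply/andP; split; lra. Qed.

Section three_blocks.
Context {R : realType}.
Variable E : (int -> R) -> R.
Hypothesis hE : averaging E.
Local Notation Pr := (Ps E).
Variables (m1 m2 m3 : nat) (C0 : R).
Hypothesis C00 : 0 <= C0.
Hypothesis HC : forall m y, m \in [:: m1; m2; m3] -> Pr m (fun s => sumz s == y) <= C0.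

Let n := (m1 + (m2 + m3))%N.
Let p1 (s : seq int) := take m1 s.
Let p2 (s : seq int) := take m2 (drop m1 s).
Let p3 (s : seq int) := drop m2 (drop m1 s).

Let E3E (F : seq int -> seq int -> seq int -> R) :
  Es E n (fun s => F (p1 s) (p2 s) (p3 s)) =
  Es E m1 (fun a => Es E m2 (fun b => Es E m3 (fun c => F a b c))).
Proof.
rewrite /n Es_cat; apply: Es_ext => a sa; rewrite Es_cat; apply: Es_ext => b sb.
apply: Es_ext => c sc; rewrite /p1 /p2 /p3.
by rewrite -sa take_size_cat// drop_size_cat// -sb take_size_cat// drop_size_cat.
Qed.

Let psz s : size s = n -> [/\ size (p1 s) = m1, size (p2 s) = m2 & size (p3 s) = m3].
Proof.
by move=> sn; rewrite /p1 /p2 /p3 !size_take_min !size_drop sn /n; split; lia.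
Qed.

Let pE s : s = p1 s ++ p2 s ++ p3 s.
Proof. by rewrite !cat_take_drop. Qed.

Let bn_p1 (f : seq int -> R) : bn m1 f -> bn n (fun s => f (p1 s)).
Proof. by move=> [M fM]; exists M => s /psz[? ? ?]; exact: fM. Qed.
Let bn_p2 (f : seq int -> R) : bn m2 f -> bn n (fun s => f (p2 s)).
Proof. by move=> [M fM]; exists M => s /psz[? ? ?]; exact: fM. Qed.
Let bn_p3 (f : seq int -> R) : bn m3 f -> bn n (fun s => f (p3 s)).
Proof. by move=> [M fM]; exists M => s /psz[? ? ?]; exact: fM. Qed.

(* The free block has to compensate the others, which costs a local probability. *)
Let local2 ma mb mc f g (y : seq int -> seq int -> int) :
  mc \in [:: m1; m2; m3] -> bn ma f -> bn mb g ->
  (forall s, 0 <= f s) -> (forall s, 0 <= g s) ->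
  Es E ma (fun a => Es E mb (fun b => Es E mc (fun c => f a * g b * (sumz c == y a b)%:R))) <=
  C0 * (Es E ma f * Es E mb g).
Proof.
move=> mcm bf bg f0 g0; rewrite -(Es_indep hE)// -(EsZ hE); last first.
  have [[M fM] [N gN]] := (bf, bg); apply: (bn_Es hE); exists (M * N) => a b sa sb.
  by rewrite normrM ler_pM ?fM ?gN.
have [[M fM] [N gN]] := (bf, bg).
apply: (Es_le hE).
- apply: (bn_Es hE); exists (M * N) => a b sa sb; apply: (Es_bound hE) => c _.
  rewrite !normrM; case: (_ == _); rewrite ?normr1 ?normr0 ?mulr1 ?mulr0.
    by rewrite ler_pM ?fM ?gN.
  by rewrite mulr_ge0 ?(le_trans _ (fM _ sa))// (le_trans _ (gN _ sb)).
- apply: bnM; first exact: bn_cst.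
  apply: (bn_Es hE); exists (M * N) => a b sa sb.
  by rewrite normrM ler_pM ?fM ?gN.
move=> a sa; rewrite -(EsZ hE); last by bdd.
apply: (Es_le hE).
- apply: (bn_Es hE); exists (M * N) => b c sb sc.
  rewrite !normrM; case: (_ == _); rewrite ?normr1 ?normr0 ?mulr1 ?mulr0.
    by rewrite ler_pM ?fM ?gN.
  by rewrite mulr_ge0 ?(le_trans _ (fM _ sa))// (le_trans _ (gN _ sb)).
- by bdd.
move=> b sb; rewrite (EsZ hE); last by bdd.
by rewrite mulrC ler_wpM2r ?mulr_ge0// HC.
Qed.

Let eq_le (a b : R) : a = b -> a <= b.
Proof. by move=> ->. Qed.

Variable x : int.
Let free3 f g : bn m1 f -> bn m2 g -> (forall s, 0 <= f s) -> (forall s, 0 <= g s) ->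
  Es E n (fun s => f (p1 s) * g (p2 s) * (sumz s == x)%:R) <= C0 * (Es E m1 f * Es E m2 g).
Proof.
move=> bf bg f0 g0.
have -> : (fun s => f (p1 s) * g (p2 s) * (sumz s == x)%:R) =
   (fun s => (fun a b c => f a * g b * (sumz c == x - sumz a - sumz b)%:R) (p1 s) (p2 s) (p3 s)).
  apply/funext => s; rewrite {3}(pE s) !sumz_cat; congr (_ * _%:R); congr nat_of_bool.
  by apply/eqP/eqP; lia.
by rewrite (E3E (fun a b c => f a * g b * (sumz c == x - sumz a - sumz b)%:R)) local2// !inE eqxx !orbT.
Qed.

Let free2 f g : bn m1 f -> bn m3 g -> (forall s, 0 <= f s) -> (forall s, 0 <= g s) ->
  Es E n (fun s => f (p1 s) * g (p3 s) * (sumz s == x)%:R) <= C0 * (Es E m1 f * Es E m3 g).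
Proof.
move=> bf bg f0 g0.
have -> : (fun s => f (p1 s) * g (p3 s) * (sumz s == x)%:R) =
   (fun s => (fun a b c => f a * g c * (sumz b == x - sumz a - sumz c)%:R) (p1 s) (p2 s) (p3 s)).
  apply/funext => s; rewrite {3}(pE s) !sumz_cat; congr (_ * _%:R); congr nat_of_bool.
  by apply/eqP/eqP; lia.
rewrite (E3E (fun a b c => f a * g c * (sumz b == x - sumz a - sumz c)%:R)); apply: le_trans (@local2 m1 m3 m2 f g (fun a b => x - sumz a - sumz b) _ bf bg f0 g0); last first.
  by rewrite !inE eqxx orbT.
apply/eq_le/Es_ext => a sa; rewrite (EsC hE)//.
have [[M fM] [N gN]] := (bf, bg); exists (M * N) => b c sb sc.
rewrite !normrM; case: (_ == _); rewrite ?normr1 ?normr0 ?mulr1 ?mulr0.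
  by rewrite ler_pM ?fM ?gN.
by rewrite mulr_ge0 ?(le_trans _ (fM _ sa))// (le_trans _ (gN _ sc)).
Qed.

Let free1 f g : bn m2 f -> bn m3 g -> (forall s, 0 <= f s) -> (forall s, 0 <= g s) ->
  Es E n (fun s => f (p2 s) * g (p3 s) * (sumz s == x)%:R) <= C0 * (Es E m2 f * Es E m3 g).
Proof.
move=> bf bg f0 g0.
have -> : (fun s => f (p2 s) * g (p3 s) * (sumz s == x)%:R) =
   (fun s => (fun a b c => f b * g c * (sumz a == x - sumz b - sumz c)%:R) (p1 s) (p2 s) (p3 s)).
  apply/funext => s; rewrite {3}(pE s) !sumz_cat; congr (_ * _%:R); congr nat_of_bool.
  by apply/eqP/eqP; lia.
rewrite (E3E (fun a b c => f b * g c * (sumz a == x - sumz b - sumz c)%:R)); apply: le_trans (@local2 m2 m3 m1 f g (fun a b => x - sumz a - sumz b) _ bf bg f0 g0); last first.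
  by rewrite !inE eqxx.
have [[M fM] [N gN]] := (bf, bg).
have bnd (a b c : seq int) (y : int) : size b = m2 -> size c = m3 ->
   `|f b * g c * (sumz a == y)%:R| <= M * N.
  move=> sb sc; rewrite !normrM; case: (_ == _); rewrite ?normr1 ?normr0 ?mulr1 ?mulr0.
    by rewrite ler_pM ?fM ?gN.
  by rewrite mulr_ge0 ?(le_trans _ (fM _ sb))// (le_trans _ (gN _ sc)).
rewrite (EsC hE); last first.
  by exists (M * N) => a b sa sb; apply: (Es_bound hE) => c sc; exact: bnd.
apply/eq_le/Es_ext => b sb; rewrite (EsC hE)//.
by exists (M * N) => a c sa sc; exact: bnd.
Qed.

Variables (k t L q r : R).
Hypothesis k0 : 0 <= k.
Hypothesis t0 : 0 <= t.
Hypothesis L0 : 0 <= L.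
Hypothesis q0 : 0 <= q.
Hypothesis x0 : 0 < x.
Let lm s : R := (lam s (-1))%:R.
Let bad s : R := (~~ good k t s)%:R.
Hypothesis HL : forall m, m \in [:: m1; m2; m3] -> Es E m lm <= L.
Hypothesis Hq : forall m, m \in [:: m1; m2; m3] -> Es E m bad <= q.
Hypothesis Hr : forall m, m \in [:: m1; m2; m3] -> Es E m (fun s => lm s * bad s) <= r.

(** Of the twelve error terms of [nine_terms], three pair a count with the badness of its own block
    and cost [r], six pair it with another block and cost [L q], and three carry [k x] and cost
    [k x q]. Each leaves a block free, whence the factor [C0]. *)
Lemma three_blocks :
  `|Es E n (fun s => (lam s (mx s - x))%:R * (sumz s == x)%:R) -
    k * x%:~R * Pr n (fun s => sumz s == x)| <=
  6 * t * Pr n (fun s => sumz s == x) + C0 * (3 * r + 6 * (L * q) + 3 * (k * x%:~R * q)).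
Proof.
pose v := k * x%:~R; have v0 : 0 <= v by rewrite mulr_ge0// ler0z ltW.
have lm0 s : 0 <= lm s by [].
have bad0 s : 0 <= bad s by [].
have blm m : bn m lm by rewrite /lm; bddl.
have bbad m : bn m bad by rewrite /bad; bdd.
have blb m : bn m (fun s => lm s * bad s) by apply: bnM.
have lb0 s : 0 <= lm s * bad s by rewrite mulr_ge0.
have one0 (s : seq int) : 0 <= (1 : R) by [].
have b1 m : bn m (fun=> 1 : R) by bdd.
pose j s : R := (sumz s == x)%:R.
(* The factors 1 bring every term into the form expected by [free1], [free2] and [free3]. *)
pose rhs s := 6 * t * j s + (
  ((fun s => lm s * bad s) (p1 s) * 1 * j s + 1 * (fun s => lm s * bad s) (p2 s) * j s +
   1 * (fun s => lm s * bad s) (p3 s) * j s) +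
  (lm (p1 s) * bad (p2 s) * j s + lm (p1 s) * bad (p3 s) * j s + lm (p2 s) * bad (p3 s) * j s +
   bad (p1 s) * lm (p2 s) * j s + bad (p1 s) * lm (p3 s) * j s + bad (p2 s) * lm (p3 s) * j s) +
  v * (bad (p1 s) * 1 * j s + 1 * bad (p2 s) * j s + 1 * bad (p3 s) * j s)).
have pw s : size s = n -> `|(lam s (mx s - x))%:R * j s - v * j s| <= rhs s.
  move=> sn; rewrite -mulrBl /rhs /j.
  have [sx|sx] := eqVneq (sumz s) x; last by rewrite !mulr0 normr0 !addr0 mulr0.
  rewrite !mulr1 !mul1r.
  have ub : `|(lam s (mx s - x))%:R - v| <= lm (p1 s) + lm (p2 s) + lm (p3 s) + v.
    have : (lam s (mx s - x))%:R <= lm (p1 s) + lm (p2 s) + lm (p3 s).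
      by rewrite /lm -addrA -!natrD ler_nat [in leqLHS](pE s) lam_blocks_ub.
    have : 0 <= (lam s (mx s - x))%:R :> R by [].
    by move=> h1 h2; exact: dist_le.
  have gd : good k t (p1 s) -> good k t (p2 s) -> good k t (p3 s) ->
     `|(lam s (mx s - x))%:R - v| <= 6 * t.
    move=> g1 g2 g3; have sx' := sx; rewrite (pE s) in sx' *.
    exact: (lam_blocks k0 g1 g2 g3 sx' x0).
  have t6 : 0 <= 6 * t by rewrite mulr_ge0.
  exact: (nine_terms (lm0 (p1 s)) (lm0 (p2 s)) (lm0 (p3 s)) v0 t6 ub gd).
have bj m : bn m j by rewrite /j; bdd.
have B1 f := @bn_p1 f; have B2 f := @bn_p2 f; have B3 f := @bn_p3 f.
have x1 := B1 _ (blm m1); have x2 := B2 _ (blm m2); have x3 := B3 _ (blm m3).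
have y1 := B1 _ (bbad m1); have y2 := B2 _ (bbad m2); have y3 := B3 _ (bbad m3).
have z1 := B1 _ (blb m1); have z2 := B2 _ (blb m2); have z3 := B3 _ (blb m3).
have jn := bj n.
have brhs : bn n rhs by rewrite /rhs; bdd.
have bl : bn n (fun s => (lam s (mx s - x))%:R * j s) by bddl.
have ineq : `|Es E n (fun s => (lam s (mx s - x))%:R * j s) - v * Pr n (fun s => sumz s == x)|
    <= Es E n rhs.
  have bv : bn n (fun s => v * j s) by bdd.
  rewrite -(EsZ hE) -?(EsB hE)//.
  rewrite ler_norml; apply/andP; split.
    rewrite -(EsN hE)//; apply: (Es_le hE); [bdd..|] => s sn.
    by have := pw s sn; rewrite ler_norml => /andP[].
  apply: (Es_le hE); [bdd..|] => s sn.
  by have := pw s sn; rewrite ler_norml => /andP[].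
apply: le_trans ineq _.
have in1 : m1 \in [:: m1; m2; m3] by rewrite !inE eqxx.
have in2 : m2 \in [:: m1; m2; m3] by rewrite !inE eqxx orbT.
have in3 : m3 \in [:: m1; m2; m3] by rewrite !inE eqxx !orbT.
have step_mean m : Es E m (fun=> 1) = 1 by exact: Es_cst.
have M1 a b A B : 0 <= a -> 0 <= b -> a <= A -> b <= B -> C0 * (a * b) <= C0 * (A * B).
  by move=> *; rewrite ler_wpM2l// ler_pM.
have pos m f : bn m f -> (forall s, 0 <= f s) -> 0 <= Es E m f.
  by move=> bf f0; apply: (Es_ge0 hE).
rewrite /rhs.
have T1 := le_trans (free3 (blb m1) (b1 m2) lb0 one0) (M1 _ _ _ _ (pos _ _ (blb m1) lb0) (pos _ _ (b1 m2) one0) (Hr in1) (lexx _)).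
have T2 := le_trans (free3 (b1 m1) (blb m2) one0 lb0) (M1 _ _ _ _ (pos _ _ (b1 m1) one0) (pos _ _ (blb m2) lb0) (lexx _) (Hr in2)).
have T3 := le_trans (free2 (b1 m1) (blb m3) one0 lb0) (M1 _ _ _ _ (pos _ _ (b1 m1) one0) (pos _ _ (blb m3) lb0) (lexx _) (Hr in3)).
have U1 := le_trans (free3 (blm m1) (bbad m2) lm0 bad0) (M1 _ _ _ _ (pos _ _ (blm m1) lm0) (pos _ _ (bbad m2) bad0) (HL in1) (Hq in2)).
have U2 := le_trans (free2 (blm m1) (bbad m3) lm0 bad0) (M1 _ _ _ _ (pos _ _ (blm m1) lm0) (pos _ _ (bbad m3) bad0) (HL in1) (Hq in3)).
have U3 := le_trans (free1 (blm m2) (bbad m3) lm0 bad0) (M1 _ _ _ _ (pos _ _ (blm m2) lm0) (pos _ _ (bbad m3) bad0) (HL in2) (Hq in3)).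
have U4 := le_trans (free3 (bbad m1) (blm m2) bad0 lm0) (M1 _ _ _ _ (pos _ _ (bbad m1) bad0) (pos _ _ (blm m2) lm0) (Hq in1) (HL in2)).
have U5 := le_trans (free2 (bbad m1) (blm m3) bad0 lm0) (M1 _ _ _ _ (pos _ _ (bbad m1) bad0) (pos _ _ (blm m3) lm0) (Hq in1) (HL in3)).
have U6 := le_trans (free1 (bbad m2) (blm m3) bad0 lm0) (M1 _ _ _ _ (pos _ _ (bbad m2) bad0) (pos _ _ (blm m3) lm0) (Hq in2) (HL in3)).
have W1 := le_trans (free3 (bbad m1) (b1 m2) bad0 one0) (M1 _ _ _ _ (pos _ _ (bbad m1) bad0) (pos _ _ (b1 m2) one0) (Hq in1) (lexx _)).
have W2 := le_trans (free3 (b1 m1) (bbad m2) one0 bad0) (M1 _ _ _ _ (pos _ _ (b1 m1) one0) (pos _ _ (bbad m2) bad0) (lexx _) (Hq in2)).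
have W3 := le_trans (free2 (b1 m1) (bbad m3) one0 bad0) (M1 _ _ _ _ (pos _ _ (b1 m1) one0) (pos _ _ (bbad m3) bad0) (lexx _) (Hq in3)).
rewrite !step_mean -/j in T1 T2 T3 W1 W2 W3.
rewrite (EsD hE); [|bdd..]; rewrite (EsZ hE); [|by bdd].
rewrite (EsD hE); [|bdd..]; rewrite (EsD hE); [|bdd..].
rewrite (EsZ hE); [|by bdd].
do 9 (rewrite (EsD hE); [|bdd..]).
have vW := ler_wpM2l v0 (lerD (lerD W1 W2) W3).
rewrite lerD2l; apply: le_trans (lerD (lerD (lerD (lerD T1 T2) T3)
  (lerD (lerD (lerD (lerD (lerD U1 U2) U3) U4) U5) U6)) vW) _.
by rewrite le_eqVlt; apply/orP; left; apply/eqP; rewrite /v; ring.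
Qed.

End three_blocks.

Section cycle.
Context {R : realType}.
Variable E : (int -> R) -> R.
Hypothesis hE : averaging E.

Lemma sumz_rot k s : sumz (rot k s) = sumz s.
Proof. by rewrite /rot sumz_cat addrC -sumz_cat cat_take_drop. Qed.

(* A path with sum [x > 0] has exactly [lam s (mx s - x)] cyclic shifts whose
   endpoint is a strict record. *)
Lemma cycle_identity n (x : int) : 0 < x ->
  n%:R * Ps E n (fun s => lad s && (sumz s == x)) =
  Es E n (fun s => (lam s (mx s - x))%:R * (sumz s == x)%:R).
Proof.
move=> x0.
rewrite (@Es_ext _ _ _ _ (fun s => \sum_(i < n) (lad (rot i s) && (sumz (rot i s) == x))%:R)).
  rewrite (Es_sum hE); last by move=> i; bdd.
  rewrite (eq_bigr (fun=> Ps E n (fun s => lad s && (sumz s == x)))).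
    by rewrite sumr_const card_ord mulr_natl.
  move=> i _; rewrite -[RHS](Es_rot hE (k := i)) //; last exact: ltnW.
  by bdd.
move=> s sn; have [sx|sx] := eqVneq (sumz s) x; last first.
  by rewrite mulr0 big1// => i _; rewrite sumz_rot (negbTE sx) andbF.
rewrite mulr1 -sx lam_rot ?sx// natr_sum sn; apply: eq_bigr => i _.
by rewrite sumz_rot sx eqxx andbT.
Qed.

End cycle.

(** * Symmetrization and the norming sequence *)

Section symmetrization.
Context {R : realType}.
Variable E : (int -> R) -> R.
Hypothesis hE : averaging E.

Definition sym (f : int -> R) : R := E (fun x => E (fun y => f (x - y))).

Let bd_ex (F : int -> int -> R) : (exists M, forall x y, `|F x y| <= M) ->
  bd (fun x => E (fun y => F x y)).
Proof. by move=> [M FM]; exists M => x; apply: (ex_bound hE). Qed.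

Let bd_sub (f : int -> R) x : bd f -> bd (fun y => f (x - y)).
Proof. by move=> [M fM]; exists M. Qed.

Let bd_sub2 (f : int -> R) : bd f -> bd (fun x => E (fun y => f (x - y))).
Proof. by move=> [M fM]; apply: bd_ex; exists M. Qed.

Lemma averaging_sym : averaging sym.
Proof.
split.
- move=> f g bf bg; rewrite /sym -(exD hE); [|exact: bd_sub2..].
  by congr E; apply/funext => x; rewrite (exD hE)//; exact: bd_sub.
- move=> c f bf; rewrite /sym -(exZ hE); last exact: bd_sub2.
  by congr E; apply/funext => x; rewrite (exZ hE)//; exact: bd_sub.
- move=> f g bf bg fg; apply: (ex_le hE); [exact: bd_sub2..|] => x.
  by apply: (ex_le hE) => //; exact: bd_sub.
- by rewrite /sym !(ex_cst hE).
- move=> F [M FM]; rewrite /sym.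
  have bE (G : int -> R) : (forall z, `|G z| <= M) -> `|E G| <= M by exact: ex_bound.
  transitivity (E (fun x1 => E (fun y1 => E (fun x2 => E (fun y2 => F (x1 - x2) (y1 - y2)))))).
    congr E; apply/funext => x1; apply: (exC hE).
    by exists M => x y; apply: bE.
  transitivity (E (fun y1 => E (fun x1 => E (fun x2 => E (fun y2 => F (x1 - x2) (y1 - y2)))))).
    by apply: (exC hE); exists M => x y; apply/bE => z; apply/bE => t.
  congr E; apply/funext => y1.
  transitivity (E (fun x1 => E (fun y2 => E (fun x2 => F (x1 - x2) (y1 - y2))))).
    by congr E; apply/funext => x1; apply: (exC hE); exists M.
  by apply: (exC hE); exists M => x y; apply: bE.
- move=> e e0; have [L HL] := ex_tight hE (divr_gt0 e0 (ltr0n R 2)).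
  exists (L + L)%N; rewrite /sym.
  apply: (@le_trans _ _ (E (fun x => (L < `|x|)%N%:R + E (fun y => (L < `|y|)%N%:R)))).
    apply: (ex_le hE); [apply: bd_ex; exists 1 => x y; case: (_ < _)%N; rewrite ?normr1 ?normr0//|bdd|].
    move=> x; rewrite -(ex_cst hE ((L < `|x|)%N%:R)) -(exD hE); [|bdd..].
    apply: (ex_le hE); [bdd..|] => y.
    have : (L + L < `|x - y|)%N -> (L < `|x|)%N || (L < `|y|)%N by lia.
    rewrite -natrD ler_nat; case: (L + L < _)%N => [/(_ isT)|//].
    by case: (L < `|x|)%N; case: (L < `|y|)%N.
  rewrite (exD hE); [|bdd..]; rewrite (ex_cst hE); lra.
Qed.

Lemma sym_opp f : bd f -> sym (fun d => f (- d)) = sym f.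
Proof.
move=> [M fM]; rewrite /sym (exC hE); last by exists M.
by congr E; apply/funext => x; congr E; apply/funext => y; rewrite opprB.
Qed.

Lemma Es_sym n (f : int -> R) : bd f ->
  Es sym n (fun s => f (sumz s)) = Es E n (fun s => Es E n (fun t => f (sumz s - sumz t))).
Proof.
elim: n f => [|n IHn] f [M fM] /=; first by rewrite sumz_nil subrr.
rewrite /sym; congr E; apply/funext => x.
rewrite -(exEsC hE); last first.
  by exists M => z s sn; apply: (Es_bound hE) => t tn.
congr E; apply/funext => y.
rewrite (@Es_ext _ _ _ _ (fun s => f (x - y + sumz s))); last first.
  by move=> s _; rewrite sumz_cons.
rewrite (IHn (fun z => f (x - y + z))); last by exists M.
apply: Es_ext => s _; apply: Es_ext => t _; rewrite !sumz_cons; congr f; lia.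
Qed.

Definition rho (th : R) : R := sym (fun d => cos (th * d%:~R)).

Lemma sym_sin th : sym (fun d => sin (th * d%:~R)) = 0.
Proof.
have : sym (fun d => sin (th * (- d)%:~R)) = sym (fun d => sin (th * d%:~R)).
  by rewrite (sym_opp (f := fun d => sin (th * d%:~R)))//; bdd.
rewrite (_ : (fun d => sin (th * (- d)%:~R)) = (fun d => -1 * sin (th * d%:~R))).
  by rewrite (exZ averaging_sym); [lra|bdd].
by apply/funext => d; rewrite mulN1r intrN mulrN sinN.
Qed.

Lemma Es_sym_cos_sin n th :
  Es sym n (fun s => cos (th * (sumz s)%:~R)) = rho th ^+ n /\
  Es sym n (fun s => sin (th * (sumz s)%:~R)) = 0.
Proof.
have hS := averaging_sym.
elim: n => [|n [IHc IHs]]; first by rewrite /= sumz_nil mulr0 cos0 sin0.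
split.
  rewrite (@Es_consE _ _ _ _ (fun z s => cos (th * z%:~R) * cos (th * (sumz s)%:~R) -
      sin (th * z%:~R) * sin (th * (sumz s)%:~R))); last first.
    by move=> z s _; rewrite sumz_cons intrD mulrDr cosD.
  transitivity (sym (fun z => rho th ^+ n * cos (th * z%:~R))); last first.
    by rewrite (exZ hS); [rewrite exprSr|bdd].
  congr sym; apply/funext => z.
  rewrite (EsB hS); [|bdd..]; rewrite !(EsZ hS); [|bdd..].
  by rewrite IHc IHs mulr0 subr0 mulrC.
rewrite (@Es_consE _ _ _ _ (fun z s => sin (th * z%:~R) * cos (th * (sumz s)%:~R) +
      cos (th * z%:~R) * sin (th * (sumz s)%:~R))); last first.
  by move=> z s _; rewrite sumz_cons intrD mulrDr sinD.
rewrite (_ : (fun _ => _) = (fun z => rho th ^+ n * sin (th * z%:~R))).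
  by rewrite (exZ hS); [rewrite sym_sin mulr0|bdd].
apply/funext => z; rewrite (EsD hS); [|bdd..]; rewrite !(EsZ hS); [|bdd..].
by rewrite IHc IHs mulr0 addr0 mulrC.
Qed.

(** The left-hand side is the squared modulus of the characteristic function of the walk, which is
    the characteristic function of the difference of two independent copies. *)
Lemma rho_exp n th :
  (Es E n (fun s => cos (th * (sumz s)%:~R))) ^+ 2 +
  (Es E n (fun s => sin (th * (sumz s)%:~R))) ^+ 2 = rho th ^+ n.
Proof.
rewrite -(Es_sym_cos_sin n th).1 (Es_sym n (f := fun d => cos (th * d%:~R))); last by bdd.
rewrite !expr2 -!(Es_indep hE); [|bdd..]; rewrite -(EsD hE).
- apply: Es_ext => s _; rewrite -(EsD hE); [|bdd..].
  by apply: Es_ext => t _; rewrite intrB mulrBr cosB.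
- apply: (bn_Es hE); exists 1 => s t _ _; rewrite normrM.
  by rewrite mulr_ile1// ler_norml cos_geN1 cos_le1.
- apply: (bn_Es hE); exists 1 => s t _ _; rewrite normrM.
  by rewrite mulr_ile1// ler_norml sin_geN1 sin_le1.
Qed.

Lemma rho_ge0 th : 0 <= rho th.
Proof.
have := rho_exp 1 th; rewrite expr1 => <-.
by rewrite addr_ge0// sqr_ge0.
Qed.

Lemma rho_le1 th : rho th <= 1.
Proof.
rewrite -(ex1 averaging_sym); apply: (ex_le averaging_sym); [bdd..|] => z.
exact: cos_le1.
Qed.

Lemma one_sub_rho th : 1 - rho th = sym (fun d => 1 - cos (th * d%:~R)).
Proof.
rewrite (exD averaging_sym); [|bdd..]; rewrite (ex1 averaging_sym); congr (_ + _).
rewrite (_ : (fun _ => _) = (fun d => -1 * cos (th * d%:~R))).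
  by rewrite (exZ averaging_sym) ?mulN1r//; bdd.
by apply/funext => d; rewrite mulN1r.
Qed.

End symmetrization.

(** * Trigonometric inequalities *)

Section trigonometry.
Context {R : realType}.
Implicit Types x u a b : R.

Lemma sin_mvt x : 0 <= x -> exists2 c, 0 <= c <= x & sin x = cos c * x.
Proof.
move=> x0.
have [c cx H] : exists2 c, c \in `[0, x] & sin x - sin 0 = cos c * (x - 0).
  apply: (@MVT_segment R sin cos 0 x x0).
  by apply: continuous_subspaceT => y; exact: continuous_sin.
exists c; first by move: cx; rewrite in_itv.
by move: H; rewrite sin0 !subr0.
Qed.

Lemma cos_half u : 1 - cos u = 2 * sin (u / 2) ^+ 2.
Proof.
rewrite (_ : cos u = cos ((u / 2) *+ 2)); last by congr cos; rewrite mulr2n; lra.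
by rewrite cos_mulr2n cos2sin2 mulr2n; ring.
Qed.

Lemma sin_sqr_le x : sin x ^+ 2 <= x ^+ 2.
Proof.
wlog x0 : x / 0 <= x.
  by move=> H; have [/H//|/ltW x0] := leP 0 x; rewrite -sqrrN -sinN -(sqrrN x) H ?oppr_ge0.
have [c _ ->] := sin_mvt x0.
by rewrite exprMn ler_piMl ?sqr_ge0.
Qed.

Lemma one_sub_cos_le u : 1 - cos u <= u ^+ 2 / 2.
Proof. by rewrite cos_half; have := sin_sqr_le (u / 2); rewrite expr_div_n; lra. Qed.

Lemma one_sub_cos_ge u : `|u| <= 1 -> 3 / 8 * u ^+ 2 <= 1 - cos u.
Proof.
wlog u0 : u / 0 <= u.
  by move=> H; have [/H//|/ltW u0] := leP 0 u; rewrite -normrN -sqrrN -cosN; apply: H; rewrite oppr_ge0.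
rewrite ger0_norm// => u1; rewrite cos_half.
have h0 : 0 <= u / 2 by rewrite divr_ge0.
have [c /andP[c0 cu] ->] := sin_mvt h0.
have := one_sub_cos_le c => cc.
have c2 : c ^+ 2 <= 4^-1 by nra.
(* This suffices because [2 (7 / 8) ^ 2 / 4 = 49 / 128] exceeds [3 / 8]. *)
have cb : 7 / 8 <= cos c by lra.
rewrite exprMn expr_div_n.
have : (7 / 8) ^+ 2 <= cos c ^+ 2 by nra.
nra.
Qed.

Lemma one_sub_cos_sqr u : 2 * (1 - cos u) ^+ 2 = 4 * (1 - cos u) - (1 - cos (2 * u)).
Proof.
rewrite (_ : 2 * u = u *+ 2); last by rewrite mulr2n; lra.
rewrite cos_mulr2n mulr2n; ring.
Qed.

Lemma one_sub_cosD a b : 1 - cos (a + b) <= 2 * (1 - cos a) + 2 * (1 - cos b).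
Proof.
rewrite !cos_half (mulrDl a b) sinD.
have := cos2Dsin2 (a / 2); have := cos2Dsin2 (b / 2).
move: (cos (a / 2)) (cos (b / 2)) (sin (a / 2)) (sin (b / 2)) => c d s t h1 h2.
have H1 : (s * d) ^+ 2 <= s ^+ 2 by rewrite exprMn ler_piMr ?sqr_ge0//; nra.
have H2 : (c * t) ^+ 2 <= t ^+ 2 by rewrite exprMn ler_piMl ?sqr_ge0//; nra.
have H3 : (s * d + c * t) ^+ 2 <= 2 * (s * d) ^+ 2 + 2 * (c * t) ^+ 2.
  by have := sqr_ge0 (s * d - c * t); lra.
lra.
Qed.

End trigonometry.

(** The induction step is [(1 - q) (1 + (n + 1) q) <= 1 + n q]. *)
Lemma bernoulli_inv (R : realFieldType) (q : R) n : 0 <= q -> q <= 1 ->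
  (1 - q) ^+ n * (1 + n%:R * q) <= 1.
Proof.
move=> q0 q1; elim: n => [|n IHn]; first by rewrite mul0r addr0 mulr1.
rewrite exprS -natr1.
have n0 : 0 <= n%:R :> R by [].
have p0 : 0 <= (1 - q) ^+ n by rewrite exprn_ge0//; lra.
have nq : 0 <= n%:R * q by rewrite mulr_ge0.
by apply: le_trans IHn; rewrite mulrAC (mulrC _ (_ ^+ n)) ler_wpM2l//; nra.
Qed.

(** * A Levy inequality for the largest symmetrized step *)

Section levy.
Context {R : realType}.
Variable E : (int -> R) -> R.
Hypothesis hE : averaging E.
Let hS := averaging_sym hE.
Local Notation sym := (sym E).

Let big (t : R) (z : int) : bool := t < `|z%:~R|.

(* Changing the sign of everything but a step beyond [t] moves one of the two
   symmetric sums outside [-t, t]. *)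
Lemma levy n (t d : R) :
  Ps sym n (has (big t)) <= Ps sym n (fun s => t < `|d + (sumz s)%:~R|) +
                            Ps sym n (fun s => t < `|- d + (sumz s)%:~R|).
Proof.
elim: n d => [|n IHn] d; first by rewrite addr_ge0 ?Ps_ge0.
pose A z := Ps sym n (fun s => t < `|d + (z%:~R + (sumz s)%:~R)|).
pose B z := Ps sym n (fun s => t < `|- d + (z%:~R + (sumz s)%:~R)|).
have bP (f : int -> seq int -> bool) : bd (fun z => Ps sym n (f z)).
  by exists 1 => z; rewrite ger0_norm ?Ps_ge0 ?Ps_le1.
have bA : bd A by exact: bP. have bB : bd B by exact: bP.
have AE : Ps sym n.+1 (fun s => t < `|d + (sumz s)%:~R|) = sym A.
  by apply: Es_consE => z s _; rewrite sumz_cons intrD.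
have BE : Ps sym n.+1 (fun s => t < `|- d + (sumz s)%:~R|) = sym B.
  by apply: Es_consE => z s _; rewrite sumz_cons intrD.
have bBo : bd (fun z => B (- z)) by exact: bP.
(* For a small step the second event is reflected in that step, which turns the pair [d, - d] into
   [d + z, - (d + z)] for the induction. *)
have Bflip : sym (fun z => (~~ big t z)%:R * B z) = sym (fun z => (~~ big t z)%:R * B (- z)).
  rewrite -(sym_opp hE); last by bdd.
  by congr sym; apply/funext => z; rewrite /big intrN normrN.
rewrite AE BE -(exD hS)//.
rewrite (_ : (fun z => A z + B z) = (fun z => (A z + (big t z)%:R * B z) + (~~ big t z)%:R * B z)); last first.
  by apply/funext => z; case: (big t z) => /=; lra.
rewrite (exD hS); [|bdd..]; rewrite Bflip -(exD hS); [|bdd..].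
apply: (ex_le hS); [exact: bP|bdd|] => z /=.
have A0 : 0 <= A z by exact: Ps_ge0. have B0 : 0 <= B (- z) by exact: Ps_ge0.
case bz : (big t z) => /=; last first.
  rewrite mul0r addr0 mul1r; apply: le_trans (IHn (d + z%:~R)) _.
  rewrite le_eqVlt; apply/orP; left; apply/eqP; congr (_ + _); apply: Es_ext => s _.
    by rewrite addrA.
  by rewrite intrN opprD addrA.
rewrite mul0r addr0 mul1r.
(* For a large step the rest of the walk is reflected instead. The two endpoints then add up to
   [2 z], so they cannot both lie in [[-t, t]]. *)
have -> : B z = Ps sym n (fun s => t < `|z%:~R - (d + (sumz s)%:~R)|).
  rewrite /B /Ps (Es_sym hE n (f := fun y => (t < `|- d + (z%:~R + y%:~R)|)%R%:R)); last by bdd.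
  rewrite (Es_sym hE n (f := fun y => (t < `|z%:~R - (d + y%:~R)|)%R%:R)); last by bdd.
  rewrite (EsC hE); last by exists 1 => u v _ _; case: (_ < _); rewrite ?normr1 ?normr0.
  apply: Es_ext => u _; apply: Es_ext => v _.
  by congr (_ %:R); congr (nat_of_bool (_ < `|_|)); rewrite !intrB; lra.
rewrite -(EsD hS); [|bdd..]; apply: (Es_le hS); [bdd..|] => s _.
have : (t < `|d + (z%:~R + (sumz s)%:~R)|) || (t < `|z%:~R - (d + (sumz s)%:~R)|).
  rewrite !ltNge -negb_and; apply/negP => /andP[h1 h2].
  have : `|2 * z%:~R : R| <= t + t.
    rewrite (_ : 2 * z%:~R = (d + (z%:~R + (sumz s)%:~R)) + (z%:~R - (d + (sumz s)%:~R))); last by lra.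
    by rewrite (le_trans (ler_normD _ _))// lerD.
  have bz' : t < `|z%:~R : R| by exact: bz.
  rewrite normrM ger0_norm//; lra.
by case: (t < _); case: (t < _) => //= _; lra.
Qed.

Lemma Ps_all n (b : int -> bool) : Ps sym n (all b) = sym (fun z => (b z)%:R) ^+ n.
Proof.
elim: n => [//|n IHn].
rewrite /Ps (@Es_consE _ _ _ _ (fun z s => (b z)%:R * (all b s)%:R)); last first.
  by move=> z s _ /=; case: (b z); rewrite ?mul1r ?mul0r.
rewrite exprSr -(exZ hS); last by bdd.
by congr sym; apply/funext => z; rewrite (EsZ hS) -?IHn 1?mulrC//; bdd.
Qed.

(** By independence the probability is [1 - (1 - q) ^ n], and [bernoulli_inv] applies. Where it is
    bounded away from 1, it thus bounds [n q]. *)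
Lemma max_step n (b : int -> bool) q : q = sym (fun z => (b z)%:R) ->
  n%:R * q <= Ps sym n (has b) * (1 + n%:R * q).
Proof.
move=> qE; have q0 : 0 <= q.
  by rewrite qE -[leLHS](ex_cst hS); apply: (ex_le hS) => [||z]; [bdd..|]; case: (b z).
have q1 : q <= 1.
  by rewrite qE -[leRHS](ex_cst hS); apply: (ex_le hS) => [||z]; [bdd..|]; case: (b z).
have -> : Ps sym n (has b) = 1 - (1 - q) ^+ n.
  have -> : 1 - q = sym (fun z => (~~ b z)%:R).
    rewrite -[X in X - q](ex1 hS) qE.
    have -> : (fun z => (~~ b z)%:R) = (fun z => 1 + (-1) * (b z)%:R) :> (int -> R).
      by apply/funext => z; case: (b z) => /=; lra.
    by rewrite (exD hS) ?(exZ hS) ?mulN1r//; bdd.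
  rewrite -Ps_all -(Ps_neg hS); apply: Es_ext => s _.
  by rewrite -has_predC; congr (_ %:R); congr nat_of_bool; apply: eq_has => z /=; rewrite negbK.
have key := bernoulli_inv n q0 q1.
lra.
Qed.

End levy.

(** * Scaling of the norming sequence *)

Section scaling.
Context {R : realType}.
Variable E : (int -> R) -> R.
Hypothesis hE : averaging E.
Let hS := averaging_sym hE.
Local Notation sym := (sym E).
Local Notation rho := (rho E).
Variable a : nat -> R.
Hypothesis a_gt0 : forall n, (0 < n)%N -> 0 < a n.
Hypothesis cos_cvg : forall th : R,
  Es E n (fun s => cos (th / a n * (sumz s)%:~R)) @[n --> \oo] --> expR (- (th ^+ 2 / 2)).
Hypothesis sin_cvg : forall th : R,
  Es E n (fun s => sin (th / a n * (sumz s)%:~R)) @[n --> \oo] --> (0 : R).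
Hypothesis tail : forall e : R, 0 < e -> exists2 L : R, 0 < L &
  \forall n \near \oo, Ps E n (fun s => L * a n < `|(sumz s)%:~R|) <= e.

Let big (t : R) (z : int) : bool := t < `|z%:~R|.
Let G (th : R) n : R := n%:R * (1 - rho (th / a n)).

Lemma rho_cvg th : rho (th / a n) ^+ n @[n --> \oo] --> expR (- th ^+ 2).
Proof.
have -> : expR (- th ^+ 2) = expR (- (th ^+ 2 / 2)) ^+ 2 + 0 ^+ 2.
  by rewrite (expr2 (expR _)) -expRD expr0n addr0; congr expR; lra.
under eq_fun => n do rewrite -(rho_exp hE).
apply: cvgD.
  by rewrite (expr2 (expR _)); under eq_fun => n do rewrite expr2; apply: cvgM.
by rewrite expr2; under eq_fun => n do rewrite expr2; apply: cvgM.
Qed.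

(** With [r = rho (th / a n)] and [u = - n ln r], which tends to [th ^ 2], the two elementary bounds
    on the logarithm give [r u <= n (1 - r) <= u]. Since [n (1 - r)] stays bounded, [(1 - r) u]
    tends to 0. *)
Lemma rho_gap_cvg th : G th n @[n --> \oo] --> th ^+ 2.
Proof.
have r0 : 0 < expR (- th ^+ 2) by exact: expR_gt0.
have u_cvg : - ln (rho (th / a n) ^+ n) @[n --> \oo] --> th ^+ 2.
  rewrite -[X in _ --> X]opprK -[in X in _ --> X](expRK (- th ^+ 2)).
  by apply: cvgN; apply: continuous_cvg; [exact: continuous_ln|exact: rho_cvg].
pose B := th ^+ 2 + 1.
have B1 : 1 <= B by rewrite lerDr sqr_ge0.
apply/cvgrPdist_le => e e0.
have e2 : 0 < e / 2 by rewrite divr_gt0.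
have n1 : \forall n \near \oo, 2 * B ^+ 2 / e < n%:R :> R by exact: nbhs_infty_gtr.
have n2 : \forall n \near \oo, 0 < rho (th / a n) ^+ n by exact: (cvgr_gt _ (rho_cvg (th := th)) _ r0).
have n3 : \forall n \near \oo, - ln (rho (th / a n) ^+ n) < B.
  by apply: (cvgr_lt _ u_cvg); rewrite ltrDl.
move/cvgrPdist_le : u_cvg => /(_ _ e2) n4.
near=> n.
have N0 : (0 < n)%N by near: n; exact: nbhs_infty_gt.
have nR : 0 < n%:R :> R by rewrite ltr0n.
have h1 : 2 * B ^+ 2 / e < n%:R :> R by near: n.
have h2 : 0 < rho (th / a n) ^+ n by near: n.
have h3 : - ln (rho (th / a n) ^+ n) < B by near: n.
have h4 : `|th ^+ 2 - - ln (rho (th / a n) ^+ n)| <= e / 2 by near: n.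
rewrite /G; move: h2 h3 h4; set r := rho _ => h2 h3 h4.
have rp : 0 < r.
  rewrite lt_neqAle rho_ge0// andbT eq_sym; apply: contraTneq h2 => ->.
  by rewrite expr0n eqn0Ngt N0 ltxx.
have r1 : r <= 1 by exact: rho_le1.
pose u := - (n%:R * ln r).
have uE : - ln (r ^+ n) = u by rewrite lnXn// /u mulr_natl.
rewrite uE in h3 h4.
have ln1 : ln r <= r - 1.
  by have := @le_ln1Dx R (r - 1) ltac:(lra); rewrite addrC subrK.
have ln2 : - ln r <= (1 - r) / r.
  rewrite -lnV ?posrE//.
  have := @le_ln1Dx R (r^-1 - 1) ltac:(rewrite ltrBDr addrC subrr invr_gt0//).
  by rewrite addrC subrK mulrBl divff ?mul1r// gt_eqF.
have u1 : n%:R * (1 - r) <= u by rewrite /u -mulrN ler_pM2l//; lra.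
have u0 : 0 <= u by rewrite (le_trans _ u1)// mulr_ge0//; lra.
have u2 : r * u <= n%:R * (1 - r).
  rewrite /u -mulrN mulrCA ler_pM2l//; move: ln2; rewrite ler_pdivlMr//; lra.
have u3 : (1 - r) * u <= e / 2.
  have : n%:R * (1 - r) * u <= B ^+ 2.
    have p3 : u <= B by exact: ltW.
    have p2 : n%:R * (1 - r) <= B by exact: le_trans u1 p3.
    have p1 : 0 <= n%:R * (1 - r) by rewrite mulr_ge0// subr_ge0.
    by rewrite expr2; exact: ler_pM.
  move: h1; rewrite ltr_pdivrMr// => h1 h5.
  have : n%:R * ((1 - r) * u) <= n%:R * (e / 2). by clear -h1 h5; lra.
  by rewrite ler_pM2l.
move: h4; rewrite !ler_norml => /andP[h5 h6]; apply/andP; split; lra.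
Unshelve. all: by end_near. Qed.

(* By [one_sub_cos_sqr] and [rho_gap_cvg] at [th] and [2 * th], whose limits
   [4 th ^ 2] and [(2 th) ^ 2] cancel. *)
Lemma cos_sqr_cvg th :
  n%:R * sym (fun d => (1 - cos (th / a n * d%:~R)) ^+ 2) @[n --> \oo] --> (0 : R).
Proof.
have H : 2 * G th n - G (2 * th) n / 2 @[n --> \oo] --> (0 : R).
  rewrite [X in _ --> X](_ : 0 = 2 * th ^+ 2 - (2 * th) ^+ 2 / 2); last by lra.
  apply: cvgB; first by apply: cvgMr; exact: rho_gap_cvg.
  by apply: cvgMl; exact: rho_gap_cvg.
rewrite (_ : (fun n => _) = (fun n => 2 * G th n - G (2 * th) n / 2))//.
apply/funext => n; rewrite /G !(one_sub_rho hE).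
rewrite (_ : 2 * (n%:R * sym (fun d => 1 - cos (th / a n * d%:~R))) -
  n%:R * sym (fun d => 1 - cos (2 * th / a n * d%:~R)) / 2 =
  n%:R * (2 * sym (fun d => 1 - cos (th / a n * d%:~R)) +
  (- 2^-1) * sym (fun d => 1 - cos (2 * th / a n * d%:~R)))); last by ring.
rewrite -(exZ hS 2); [|bdd]; rewrite -(exZ hS (- 2^-1)); [|bdd].
rewrite -(exD hS); [|bdd..].
congr (_ * _); congr sym; apply/funext => d.
have := one_sub_cos_sqr (th / a n * d%:~R); rewrite !mulrA; lra.
Qed.

(** [levy] bounds the probability of a step beyond [2 L a n] by the tail of the walk, and [max_step]
    turns this into a bound on [n] times the tail of one step. *)
Lemma sym_tail e : 0 < e -> exists2 L : R, 0 < L &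
  \forall n \near \oo, n%:R * sym (fun d => (L * a n < `|d%:~R|)%R%:R) <= e.
Proof.
(* The probability [p] of a large step will be at most [4 e' <= 1 / 2], and then
   [n q <= p (1 + n q)] gives [n q <= 8 e' <= e]. *)
move=> e0; pose e' := Num.min e 1 / 8.
have e'0 : 0 < e' by rewrite divr_gt0// lt_min e0 ltr01.
have [L L0 HL] := tail e'0.
exists (2 * L); first by rewrite mulr_gt0.
move: HL; apply: filterS => n HL.
set q := sym _.
have qE : q = sym (fun z => (big (2 * L * a n) z)%:R) by [].
have q0 : 0 <= q.
  by rewrite qE -[leLHS](ex_cst hS); apply: (ex_le hS) => [||z]; [bdd..|]; case: big.
have := max_step hE n qE; have := levy hE n (2 * L * a n) 0.
rewrite -/(big (2 * L * a n)); set p := Ps _ _ (has _).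
have half : Ps sym n (fun s => 2 * L * a n < `|(sumz s)%:~R|) <= 2 * e'.
  rewrite /Ps (Es_sym hE n (f := fun y => (2 * L * a n < `|y%:~R|)%R%:R)); last by bdd.
  apply: (@le_trans _ _ (Es E n (fun s => Es E n (fun t =>
     (L * a n < `|(sumz s)%:~R|)%R%:R + (L * a n < `|(sumz t)%:~R|)%R%:R)))).
    apply: (Es_le hE).
    - by apply: (bn_Es hE); exists 1 => s t _ _; case: (_ < _); rewrite ?normr1 ?normr0.
    - apply: (bn_Es hE); exists 2 => s t _ _.
      by case: (_ < _); case: (_ < _) => /=; rewrite ger0_norm; lra.
    move=> s _; apply: (Es_le hE); [bdd..|] => t _.
    have : (2 * L * a n < `|(sumz s - sumz t)%:~R|) -> (L * a n < `|(sumz s)%:~R|) ||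
        (L * a n < `|(sumz t)%:~R|).
      rewrite intrB => H; rewrite !ltNge -negb_and; apply/negP => /andP[h1 h2].
      have := le_trans (ler_normB (sumz s)%:~R (sumz t)%:~R) (lerD h1 h2); lra.
    by do 3 case: (_ < _) => //=; rewrite ?addr0 ?add0r //; try lra; move=> /(_ isT).
  rewrite (@Es_ext _ _ _ _ (fun s => (L * a n < `|(sumz s)%:~R|)%R%:R +
      Ps E n (fun t => L * a n < `|(sumz t)%:~R|))); last first.
    by move=> s _; rewrite (EsD hE); [rewrite (Es_cst hE)|bdd..].
  rewrite (EsD hE); [|bdd..]; rewrite (Es_cst hE).
  by have := HL; rewrite /Ps; lra.
have -> : (fun s : seq int => 2 * L * a n < `|0 + (sumz s)%:~R|) =
  (fun s => 2 * L * a n < `|(sumz s)%:~R|) by apply/funext => s; rewrite add0r.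
have -> : (fun s : seq int => 2 * L * a n < `|- 0 + (sumz s)%:~R|) =
  (fun s => 2 * L * a n < `|(sumz s)%:~R|) by apply/funext => s; rewrite oppr0 add0r.
move=> h1 h2.
have h3 : e' <= 8^-1 by rewrite /e' ler_pdivrMr// mulVf// ge_min lexx orbT.
have h4 : 8 * e' <= e by rewrite /e' mulrCA divff// mulr1 ge_min lexx.
have nq : 0 <= n%:R * q by rewrite mulr_ge0.
have hp : p <= 4 * e' by lra.
have : p * (1 + n%:R * q) <= 4 * e' * (1 + n%:R * q) by apply: ler_wpM2r => //; lra.
have : 4 * e' * (n%:R * q) <= 2^-1 * (n%:R * q) by apply: ler_wpM2r => //; lra.
lra.
Qed.

(** Between [eta a n] and [L a n] the integrand of [cos_sqr_cvg] at frequency [1 / L] is at least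
    [c ^ 2], so these steps are negligible; [sym_tail] covers the steps beyond [L a n]. *)
Lemma sym_tail0 eta e : 0 < eta -> 0 < e ->
  \forall n \near \oo, n%:R * sym (fun d => (eta * a n < `|d%:~R|)%R%:R) <= e.
Proof.
move=> eta0 e0; have e2 : 0 < e / 2 by rewrite divr_gt0.
have [L L0 HL] := sym_tail e2.
pose c := 3 / 8 * (eta / L) ^+ 2.
have c0 : 0 < c by rewrite mulr_gt0// exprn_gt0// divr_gt0.
have e3 : 0 < e / 2 * c ^+ 2 by rewrite mulr_gt0// exprn_gt0.
have H2 : \forall n \near \oo,
    n%:R * sym (fun d => (1 - cos (L^-1 / a n * d%:~R)) ^+ 2) <= e / 2 * c ^+ 2.
  exact: (cvgr_le _ (cos_sqr_cvg L^-1) _ e3).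
near=> n.
have N0 : (0 < n)%N by near: n; exact: nbhs_infty_gt.
have an := a_gt0 N0.
have h1 : n%:R * sym (fun d => (L * a n < `|d%:~R|)%R%:R) <= e / 2 by near: n.
have h2 : n%:R * sym (fun d => (1 - cos (L^-1 / a n * d%:~R)) ^+ 2) <= e / 2 * c ^+ 2 by near: n.
have : sym (fun d => (eta * a n < `|d%:~R|)%R%:R) <=
   sym (fun d => (L * a n < `|d%:~R|)%R%:R + c ^- 2 * (1 - cos (L^-1 / a n * d%:~R)) ^+ 2).
  apply: (ex_le hS); [bdd..|] => d.
  have p0 : 0 <= c ^- 2 * (1 - cos (L^-1 / a n * d%:~R)) ^+ 2.
    by rewrite mulr_ge0 ?invr_ge0 ?sqr_ge0.
  have [h3|h3] := ltP (L * a n) `|d%:~R|.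
    by move: p0; case: (eta * a n < _) => /=; lra.
  have [h4|h4] := ltP (eta * a n) `|d%:~R|; rewrite /= add0r//.
  rewrite ler_pdivlMl ?exprn_gt0// mulr1 lerXn2r ?nnegrE ?(ltW c0) ?subr_ge0 ?cos_le1//.
  set u := L^-1 / a n * d%:~R.
  have uE : `|u| = `|d%:~R| / (L * a n).
    by rewrite /u !normrM !normfV (gtr0_norm L0) (gtr0_norm an) invfM mulrC.
  apply: le_trans (one_sub_cos_ge _); last by rewrite uE ler_pdivrMr ?mulr_gt0// mul1r.
  have h6 : eta / L <= `|u|.
    by rewrite uE ler_pdivlMr ?mulr_gt0// mulrA divfK ?gt_eqF// ltW.
  have eL : 0 <= eta / L by rewrite divr_ge0// ltW.
  by rewrite /c ler_pM2l// -(real_normK (num_real u)) lerXn2r ?nnegrE.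
rewrite (exD hS); [|bdd..]; rewrite (exZ hS); last by bdd.
move=> h3; have nR : 0 <= n%:R :> R by [].
apply: le_trans (ler_wpM2l nR h3) _; rewrite mulrDr.
have : n%:R * (c ^- 2 * sym (fun d => (1 - cos (L^-1 / a n * d%:~R)) ^+ 2)) <= e / 2.
  by rewrite mulrCA ler_pdivrMl ?exprn_gt0// [leRHS]mulrC.
lra.
Unshelve. all: by end_near. Qed.

(* Its monotonicity compares the values of [a] at different times. *)
Definition trunc_moment (t : R) : R := sym (fun d => Num.min 1 ((d%:~R / t) ^+ 2)).

Let bd_trunc_moment (t : R) : bd (fun d : int => Num.min 1 ((d%:~R / t) ^+ 2) : R).
Proof.
exists 1 => d; rewrite ger0_norm ?ge_min ?lexx//.
by rewrite le_min ler01 sqr_ge0.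
Qed.

Lemma trunc_moment_ge0 t : 0 <= trunc_moment t.
Proof.
rewrite -[leLHS](ex_cst hS); apply: (ex_le hS) => // [|d]; first by bdd.
by rewrite le_min ler01 sqr_ge0.
Qed.

Lemma trunc_moment_mono t t' : 0 < t -> t <= t' -> trunc_moment t' <= trunc_moment t.
Proof.
move=> t0 tt'; apply: (ex_le hS) => // d.
rewrite le_min ge_min lexx/= ge_min; apply/orP; right.
rewrite !exprMn ler_wpM2l ?sqr_ge0// lerXn2r ?nnegrE ?invr_ge0 ?(ltW t0)//.
  by rewrite (le_trans (ltW t0)).
by rewrite lef_pV2 ?posrE// (lt_le_trans t0).
Qed.

(** For [|u| <= 1] the functions [min 1 (u ^ 2)] and [1 - cos u] agree up to constants, and larger
    steps are negligible by [sym_tail0]. The slack [1 / 20] leaves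
    [8 / 3 * 11 / 10 + 1 / 20 < 3]. *)
Lemma trunc_moment_bounds t : 0 < t -> \forall n \near \oo,
  t ^- 2 <= n%:R * trunc_moment (t * a n) <= 3 * t ^- 2.
Proof.
move=> t0; have t2 : 0 < t ^- 2 by rewrite invr_gt0 exprn_gt0.
have e0 : 0 < t ^- 2 / 20 by rewrite divr_gt0.
have H1 := sym_tail0 t0 e0.
have H2 : \forall n \near \oo, t ^- 2 * (9 / 10) <= G t^-1 n.
  by apply: (cvgr_ge _ (rho_gap_cvg (th := t^-1))); rewrite exprVn; lra.
have H3 : \forall n \near \oo, G t^-1 n <= t ^- 2 * (11 / 10).
  by apply: (cvgr_le _ (rho_gap_cvg (th := t^-1))); rewrite exprVn; lra.
near=> n.
have N0 : (0 < n)%N by near: n; exact: nbhs_infty_gt.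
have an := a_gt0 N0.
have h1 : n%:R * sym (fun d => (t * a n < `|d%:~R|)%R%:R) <= t ^- 2 / 20 by near: n.
have h2 : t ^- 2 * (9 / 10) <= G t^-1 n by near: n.
have h3 : G t^-1 n <= t ^- 2 * (11 / 10) by near: n.
rewrite /G (one_sub_rho hE) in h2 h3.
have ta : 0 < t * a n by rewrite mulr_gt0.
have uE (d : int) : t^-1 / a n * d%:~R = d%:~R / (t * a n) by rewrite invfM mulrC.
have nR : 0 <= n%:R :> R by [].
have bK := bd_trunc_moment (t * a n).
have small (d : int) : (t * a n < `|d%:~R : R|) = false -> `|d%:~R / (t * a n)| <= 1.
  move/negbT; rewrite -leNgt => H.
  by rewrite normrM normfV (gtr0_norm ta) ler_pdivrMr// mul1r.
apply/andP; split.
  have : sym (fun d => 1 - cos (t^-1 / a n * d%:~R)) <=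
    sym (fun d => 2^-1 * Num.min 1 ((d%:~R / (t * a n)) ^+ 2) + 2 * (t * a n < `|d%:~R|)%R%:R).
    apply: (ex_le hS); [bdd..|] => d; rewrite uE; set u := d%:~R / (t * a n).
    have m0 : 0 <= Num.min 1 (u ^+ 2) by rewrite le_min ler01 sqr_ge0.
    case H : (_ < _) => /=; first by have := cos_geN1 u; lra.
    have u1 := small d H; rewrite -/u in u1.
    have := one_sub_cos_le u.
    have -> : Num.min 1 (u ^+ 2) = u ^+ 2.
      by apply/min_idPr; rewrite -real_normK ?num_real// expr_le1.
    lra.
  rewrite [leRHS](exD hS); [|bdd..]; rewrite !(exZ hS); [|bdd..] => h4.
  have := ler_wpM2l nR h4; rewrite mulrDr -/(trunc_moment _) !(mulrCA n%:R); lra.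
have : sym (fun d => Num.min 1 ((d%:~R / (t * a n)) ^+ 2)) <=
    sym (fun d => 8 / 3 * (1 - cos (t^-1 / a n * d%:~R)) + (t * a n < `|d%:~R|)%R%:R).
  apply: (ex_le hS); [bdd..|] => d; rewrite uE; set u := d%:~R / (t * a n).
  case H : (t * a n < `|d%:~R|) => /=.
    rewrite ge_min; apply/orP; left; have := cos_le1 u. lra.
  have u1 := small d H; rewrite -/u in u1.
  have := one_sub_cos_ge u1.
  by rewrite addr0 ge_min => h4; apply/orP; right; lra.
rewrite [leRHS](exD hS); [|bdd..]; rewrite !(exZ hS); [|bdd..] => h4.
have := ler_wpM2l nR h4; rewrite mulrDr -/(trunc_moment _) !(mulrCA n%:R); lra.
Unshelve. all: by end_near. Qed.

(** If [a m <= t a n], then monotonicity of [trunc_moment] gives [1 / (t ^ 2 n) <= 3 / m], against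
    the constant 4 in the hypothesis. [scale_lt] is the same argument in the other direction. *)
Lemma scale_gt t : 0 < t -> exists n0, forall n m, (n0 <= n)%N -> (n0 <= m)%N ->
  4 * t ^+ 2 * n%:R <= m%:R -> t * a n < a m.
Proof.
move=> t0; have [n1 _ H1] := trunc_moment_bounds t0; have [n2 _ H2] := trunc_moment_bounds (@ltr01 R).
exists (maxn n1 n2).+1 => n m nn nm nmt; rewrite ltNge; apply/negP => ma.
have n0 : (0 < n)%N by lia. have m0 : (0 < m)%N by lia.
have /= /andP[h1 _] := H1 n ltac:(rewrite /=; lia).
have /= /andP[_ h2] := H2 m ltac:(rewrite /=; lia).
rewrite expr1n invr1 mulr1 mul1r in h2.
have h3 := trunc_moment_mono (a_gt0 m0) ma.
have nR : 0 < n%:R :> R by rewrite ltr0n. have mR : 0 < m%:R :> R by rewrite ltr0n.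
have t2 : 0 < t ^+ 2 by rewrite exprn_gt0.
have h4 : 1 <= t ^+ 2 * n%:R * trunc_moment (a m).
  rewrite -(@ler_pM2l _ (t ^- 2)) ?invr_gt0// mulr1 -mulrA mulKf ?gt_eqF//.
  by rewrite (le_trans h1)// ler_pM2l.
have : 4 * t ^+ 2 * n%:R * trunc_moment (a m) <= m%:R * trunc_moment (a m).
  by apply: ler_wpM2r => //; exact: trunc_moment_ge0.
lra.
Qed.

Lemma scale_lt t : 0 < t -> exists n0, forall n m, (n0 <= n)%N -> (n0 <= m)%N ->
  4 * m%:R <= t ^+ 2 * n%:R -> a m < t * a n.
Proof.
move=> t0; have [n1 _ H1] := trunc_moment_bounds t0; have [n2 _ H2] := trunc_moment_bounds (@ltr01 R).
exists (maxn n1 n2).+1 => n m nn nm nmt; rewrite ltNge; apply/negP => ma.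
have n0 : (0 < n)%N by lia. have m0 : (0 < m)%N by lia.
have /= /andP[_ h1] := H1 n ltac:(rewrite /=; lia).
have /= /andP[h2 _] := H2 m ltac:(rewrite /=; lia).
rewrite expr1n invr1 mul1r in h2.
have ta : 0 < t * a n by rewrite mulr_gt0 ?a_gt0.
have h3 := trunc_moment_mono ta ma.
have nR : 0 < n%:R :> R by rewrite ltr0n. have mR : 0 < m%:R :> R by rewrite ltr0n.
have t2 : 0 < t ^+ 2 by rewrite exprn_gt0.
have h4 : t ^+ 2 * n%:R * trunc_moment (t * a n) <= 3.
  by rewrite -(@ler_pM2l _ (t ^- 2)) ?invr_gt0// -mulrA mulKf ?gt_eqF// mulrC [leRHS]mulrC mulrC.
have h5 : m%:R * trunc_moment (a m) <= m%:R * trunc_moment (t * a n) by rewrite ler_pM2l.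
have : 4 * m%:R * trunc_moment (t * a n) <= t ^+ 2 * n%:R * trunc_moment (t * a n).
  by apply: ler_wpM2r => //; exact: trunc_moment_ge0.
lra.
Qed.

(** While [a n <= B], the moment at [a n] is at least the one at [B], which is positive, so that
    [n * trunc_moment (a n) <= 3] fails for large [n]. *)
Lemma scale_infty B : \forall n \near \oo, B < a n.
Proof.
have [n2 _ H2] := trunc_moment_bounds (@ltr01 R).
(* Positivity passes from one scale to all others: shrinking the scale increases the moment, and
   enlarging it by [1 / c] costs at most the factor [c ^ 2]. *)
have K0 t : 0 < t -> 0 < trunc_moment t.
  move=> t0; have /= /andP[+ _] := H2 n2.+1 ltac:(rewrite /=; lia).
  rewrite expr1n invr1 mul1r => h.
  have KS : 0 < trunc_moment (a n2.+1).
    have : 0 < n2.+1%:R * trunc_moment (a n2.+1) by lra.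
    by rewrite pmulr_rgt0.
  have an := a_gt0 (ltn0Sn n2).
  have [ta|ta] := leP t (a n2.+1); first by rewrite (lt_le_trans KS)// trunc_moment_mono.
  apply: (@lt_le_trans _ _ ((a n2.+1 / t) ^+ 2 * trunc_moment (a n2.+1))).
    by rewrite mulr_gt0// exprn_gt0// divr_gt0.
  have bK := bd_trunc_moment (a n2.+1).
  rewrite -(exZ hS)//; apply: (ex_le hS); [bdd|exact: bd_trunc_moment|] => d.
  set c := a n2.+1 / t.
  have c1 : c ^+ 2 <= 1.
    by rewrite expr_le1// /c ?divr_ge0 ?ltW// ltr_pdivrMr// mul1r.
  rewrite le_min; apply/andP; split.
    by rewrite mulr_ile1 ?sqr_ge0 ?ge_min ?lexx// le_min ler01 sqr_ge0.
  rewrite (_ : (d%:~R / t) ^+ 2 = c ^+ 2 * (d%:~R / a n2.+1) ^+ 2); last first.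
    by rewrite -exprMn; congr (_ ^+ 2); rewrite /c; field; rewrite !gt_eqF.
  by rewrite ler_wpM2l ?sqr_ge0// ge_min lexx orbT.
pose B' := Num.max B 1.
have B'0 : 0 < B' by rewrite lt_max ltr01 orbT.
have := K0 _ B'0 => KB.
near=> n.
have n2n : (n2 <= n)%N by near: n; exact: nbhs_infty_ge.
have N0 : (0 < n)%N by near: n; exact: nbhs_infty_gt.
have nbig : 3 / trunc_moment B' < n%:R by near: n; exact: nbhs_infty_gtr.
rewrite ltNge; apply/negP => aB.
have aB' : a n <= B' by rewrite le_max aB.
have /= /andP[_] := H2 n n2n; rewrite expr1n invr1 mulr1 mul1r.
have := trunc_moment_mono (a_gt0 N0) aB'.
move: nbig; rewrite ltr_pdivrMr// => h1 h2 h3.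
have : n%:R * trunc_moment B' <= n%:R * trunc_moment (a n) by rewrite ler_wpM2l.
lra.
Unshelve. all: by end_near. Qed.

(** Undoes the symmetrization: with probability at least 1/2 the second copy stays in [[-L, L]],
    which is small against [a n], so a large step makes a large difference. *)
Lemma step_tail eta e : 0 < eta -> 0 < e ->
  \forall n \near \oo, n%:R * E (fun z => (eta * a n < `|z%:~R|)%R%:R) <= e.
Proof.
move=> eta0 e0; have e2 : 0 < e / 2 by rewrite divr_gt0.
have h2 : 0 < eta / 2 by rewrite divr_gt0.
have H1 := sym_tail0 h2 e2.
have [L HL] := ex_tight hE (divr_gt0 (@ltr01 R) (ltr0n R 2)).
near=> n.
have h1 : n%:R * sym (fun d => (eta / 2 * a n < `|d%:~R|)%R%:R) <= e / 2 by near: n.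
have aL : L%:R / (eta / 2) < a n by near: n; exact: scale_infty.
have nR : 0 <= n%:R :> R by [].
set q := E _; suff : 2^-1 * q <= sym (fun d => (eta / 2 * a n < `|d%:~R|)%R%:R).
  by move=> H; have := ler_wpM2l nR H; rewrite mulrCA; lra.
have half : 2^-1 <= E (fun z => (`|z| <= L)%N%:R).
  have : E (fun z => (`|z| <= L)%N%:R + (L < `|z|)%N%:R) = 1.
    rewrite -[RHS](ex_cst hE); congr E; apply/funext => z.
    by rewrite ltnNge; case: (_ <= _)%N => /=; lra.
  by rewrite (exD hE); [move: HL; lra|bdd..].
apply: (@le_trans _ _ (E (fun x => E (fun y => (eta * a n < `|x%:~R|)%R%:R * (`|y| <= L)%N%:R)))).
  rewrite -(exZ hE); last by bdd.
  apply: (ex_le hE) => [| |x]; first by bdd.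
    exists 1 => x; apply: (ex_bound hE) => y.
    by case: (_ < _); case: (_ <= _)%N; rewrite /= ?mulr0 ?mul0r ?mulr1 ?normr0 ?normr1.
  rewrite (exZ hE); last by bdd.
  by rewrite mulrC; apply: ler_wpM2l.
apply: (ex_le hE).
- exists 1 => x; apply: (ex_bound hE) => y.
  by case: (_ < _); case: (_ <= _)%N; rewrite /= ?mulr0 ?mul0r ?mulr1 ?normr0 ?normr1.
- by exists 1 => x; apply: (ex_bound hE) => y; case: (_ < _); rewrite ?normr0 ?normr1.
move=> x; apply: (ex_le hE); [bdd..|] => y.
have [h3|_] := ltP (eta * a n) `|x%:~R|; last by rewrite mul0r.
have [h4|_] := leqP `|y|%N L; last by rewrite mulr0.
suff -> : eta / 2 * a n < `|(x - y)%:~R| by rewrite mulr1.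
have yL : `|y%:~R : R| <= L%:R by rewrite -intr_norm -abszE -pmulrn ler_nat.
move: aL; rewrite ltr_pdivrMr// => aL.
have := lerB_dist (x%:~R : R) y%:~R; rewrite intrB; lra.
Unshelve. all: by end_near. Qed.

End scaling.

Lemma bool_le1 (R : realFieldType) (b : bool) : b%:R <= 1 :> R.
Proof. by case: b. Qed.

Lemma bool3_le2 (R : realFieldType) (b1 b2 b3 : bool) :
  `|b1%:R * b2%:R + b3%:R : R| <= 2.
Proof. by case: b1; case: b2; case: b3; rewrite /= ger0_norm; lra. Qed.

(** * Maximum of the walk *)

Section maximum.
Context {R : realType}.
Variable E : (int -> R) -> R.
Hypothesis hE : averaging E.
Local Notation Pr := (Ps E).
Local Notation V := (Vlim E).

(** At the first passage above [x + y], the remaining walk falls by at most [y] with probability at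
    least 1/2, and then ends above [x]. *)
Lemma ottaviani n (x y : R) :
  (forall j, (j <= n)%N -> Pr j (fun s => (sumz s)%:~R < - y) <= 2^-1) ->
  0 <= x + y ->
  Pr n (fun s => x + y < (mx s)%:~R) <= 2 * Pr n (fun s => x < (sumz s)%:~R).
Proof.
elim: n x => [|n IHn] x H xy.
  by rewrite {1}/Ps /= ltNge xy /= mulr_ge0 ?Ps_ge0.
rewrite /Ps -(EsZ hE); last by bdd.
apply: (Es_cons_le2 hE); [bdd..|] => z.
rewrite (EsZ hE); last by bdd.
rewrite [X in _ <= _ * X](_ : _ = Pr n (fun s => x - z%:~R < (sumz s)%:~R)); last first.
  by apply: Es_ext => s _; rewrite sumz_cons intrD; congr (_ %:R); congr nat_of_bool; lra.
have [zx|zx] := leP z%:~R (x + y).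
  apply: le_trans (IHn (x - z%:~R) _ _); last 2 first.
  - by move=> j jn; apply: H; exact: leqW.
  - lra.
  apply: (Ps_le hE) => s _ /=; rewrite [Num.max _ _]maxEle.
  case: ifP => _; last by lra.
  by rewrite intrD; lra.
apply: (@le_trans _ _ 1); first exact: Ps_le1.
have := H n (leqnSn n); have := Ps_neg hE n (fun s => (sumz s)%:~R < - y).
have : Pr n (fun s => ~~ ((sumz s)%:~R < - y)) <= Pr n (fun s => x - z%:~R < (sumz s)%:~R).
  by apply: (Ps_le hE) => s _; rewrite -leNgt; lra.
lra.
Qed.

(** Serves the early times, to which the limit theorem does not apply: the sum can fall below
    [- n L] only through a step of size beyond [L]. *)
Lemma sum_tail0 n (L : nat) (y : R) : n%:R * L%:R <= y ->
  Pr n (fun s => (sumz s)%:~R < - y) <= n%:R * E (fun z => (L < `|z|)%N%:R).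
Proof.
move=> ny; rewrite (_ : (fun z => _) = (fun z => (~~ (`|z| <= L)%N)%:R)); last first.
  by apply/funext => z; rewrite ltnNge.
apply: le_trans (Ps_not_all hE n (fun z => (`|z| <= L)%N)).
apply: (Ps_le hE) => s sn; apply: contraTN => /allP sL.
rewrite -leNgt; apply: (@le_trans _ _ (- (n%:R * L%:R))); first by rewrite lerN2.
rewrite -natrM -sn pmulrn -intrN ler_int.
have : - ((size s * L)%N : int) <= sumz s.
  elim: s sL {sn} => [|z s IHs] sL /=; first by rewrite sumz_nil.
  rewrite sumz_cons mulSn.
  have := IHs (fun w ws => sL w (@mem_behead _ (z :: s) _ ws)).
  by have := sL z (mem_head _ _); lia.
by [].
Qed.

Variable a : nat -> R.
Hypothesis a_gt0 : forall n, (0 < n)%N -> 0 < a n.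
Hypothesis scale_gt : forall t, 0 < t -> exists n0, forall n m, (n0 <= n)%N -> (n0 <= m)%N ->
  4 * t ^+ 2 * n%:R <= m%:R -> t * a n < a m.
Hypothesis scale_lt : forall t, 0 < t -> exists n0, forall n m, (n0 <= n)%N -> (n0 <= m)%N ->
  4 * m%:R <= t ^+ 2 * n%:R -> a m < t * a n.
Hypothesis scale_infty : forall B, \forall n \near \oo, B < a n.
Hypothesis tail : forall e : R, 0 < e -> exists2 L : R, 0 < L &
  \forall n \near \oo, Pr n (fun s => L * a n < `|(sumz s)%:~R|) <= e.
Hypothesis step_tail : forall eta e, 0 < eta -> 0 < e ->
  \forall n \near \oo, n%:R * E (fun z => (eta * a n < `|z%:~R|)%R%:R) <= e.
Variable c0 : R.
Hypothesis c0_gt0 : 0 < c0.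
Hypothesis mass : \forall n \near \oo, c0 <= Pr n (fun s => a n < (sumz s)%:~R).

(** Ottaviani's inequality with [y = 3 L a n]: late times [j <= n] satisfy [a j < 3 a n], and at the
    finitely many early times the walk is small against [a n]. *)
Lemma max_tail e : 0 < e -> exists2 L : R, 0 < L &
  \forall n \near \oo, Pr n (fun s => L * a n < (mx s)%:~R) <= e.
Proof.
move=> e0; pose e' := Num.min (e / 2) 2^-1.
have e'0 : 0 < e' by rewrite lt_min divr_gt0//= invr_gt0.
have e'1 : e' <= e / 2 by rewrite ge_min lexx.
have e'2 : e' <= 2^-1 by rewrite ge_min lexx orbT.
have [L L0 [n1 _ H1]] := tail e'0.
have [n2 H2] := scale_lt (ltr0n R 3).
pose N := (maxn n1 n2).
have pN : 0 < (2 * N.+1%:R)^-1 :> R by rewrite invr_gt0 mulr_gt0.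
have [B HB] := ex_tight hE pN.
exists (4 * L); first by rewrite mulr_gt0.
near=> n.
have Nn : (N <= n)%N by near: n; exact: nbhs_infty_ge.
have n0 : (0 < n)%N by near: n; exact: nbhs_infty_gt.
have an := a_gt0 n0.
have aB : N%:R * B%:R / (3 * L) < a n by near: n; exact: scale_infty.
have H j : (j <= n)%N -> Pr j (fun s => (sumz s)%:~R < - (3 * L * a n)) <= 2^-1.
  move=> jn; have [Nj|jN] := leqP N j.
    have j1 : (n1 <= j)%N by apply: leq_trans Nj; exact: leq_maxl.
    have j2 : (n2 <= j)%N by apply: leq_trans Nj; exact: leq_maxr.
    have /= h1 := H1 j j1; apply: le_trans e'2; apply: le_trans h1.
    have aj : a j < 3 * a n.
      apply: H2 => //; first exact: leq_trans jn.
      have : j%:R <= n%:R :> R by rewrite ler_nat.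
      have : 0 <= n%:R :> R by [].
      lra.
    have Laj : L * a j < L * (3 * a n) by rewrite ltr_pM2l.
    apply: (Ps_le hE) => s _ h; rewrite -normrN.
    by apply: lt_le_trans (ler_norm _); lra.
  have jR : j%:R <= N%:R :> R by rewrite ler_nat ltnW.
  have L30 : 0 < 3 * L by rewrite mulr_gt0.
  have jB : j%:R * B%:R <= 3 * L * a n.
    apply: (@le_trans _ _ (N%:R * B%:R)); first by rewrite ler_wpM2r.
    by move: aB; rewrite ltr_pdivrMr//; lra.
  apply: le_trans (sum_tail0 jB) _.
  apply: (@le_trans _ _ (N.+1%:R * (2 * N.+1%:R)^-1)).
    have E0 : 0 <= E (fun z => (B < `|z|)%N%:R).
      by rewrite -[leLHS](ex_cst hE); apply: (ex_le hE) => [||z]; [bdd..|]; case: (_ < _)%N.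
    apply: ler_pM => //; first by rewrite ler_nat; apply: leqW; exact: ltnW.
  by rewrite invfM mulrCA divff ?mulr1.
have /= h1 := H1 n (leq_trans (leq_maxl _ _) Nn).
have xy : 0 <= L * a n + 3 * L * a n by rewrite addr_ge0// ?mulr_ge0 ?ltW// mulr_gt0.
have := ottaviani H xy.
have -> : L * a n + 3 * L * a n = 4 * L * a n by lra.
move=> h; apply: le_trans h _.
have : Pr n (fun s => L * a n < (sumz s)%:~R) <= Pr n (fun s => L * a n < `|(sumz s)%:~R|).
  by apply: (Ps_le hE) => s _ h; apply: lt_le_trans (ler_norm _).
lra.
Unshelve. all: by end_near. Qed.

Let F (q : R) := exists2 dl : R, 0 < dl &
  \forall n \near \oo, Pr n (fun s => (mx s)%:~R < dl * a n) <= q.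

(* If the maximum is small at time [n], then it is small in the first of [Q]
   blocks, and the walk does not rise by [a n'] in the following block. *)
Let F_step q e : 0 < e -> F q -> F ((1 - c0) * q + e).
Proof.
move=> e0 [dl dl0 [n1 _ H1]].
have [L L0 [n2 _ H2]] := tail e0.
have [n3 _ H3] := mass.
have L1 : 0 < L + 1 by lra.
have [n4 H4] := scale_gt L1.
(* [Q] makes [a (n - n')] larger than [(L + 1) a n']: a rise by this much would lead from a point
   above [- L a n'] past [a n'], beyond the assumed maximum. *)
have [Q HQ] := nat_upper_bound (4 * (L + 1) ^+ 2 + 1).
have Q0 : (0 < Q)%N.
  by rewrite -(ltr_nat R) (lt_le_trans _ HQ)// ltr_wpDl// mulr_ge0// sqr_ge0.
pose T : R := 8 * Q%:R.
have QR : 1 <= Q%:R :> R by rewrite ler1n.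
have T0 : 0 < T by rewrite /T; lra.
have [n5 H5] := scale_lt T0.
pose d1 := Num.min dl 1; have d10 : 0 < d1 by rewrite lt_min dl0 ltr01.
exists (d1 / T); first by rewrite divr_gt0.
pose M := (n1 + n2 + n3 + n4 + n5 + 2)%N.
exists (2 * Q * M)%N => // n /= Mn.
pose n' := (n %/ Q)%N.
have Mn' : (M <= n')%N by rewrite /n' leq_divRL//; apply: leq_trans Mn; rewrite mulnC leq_mul// leq_pmull.
have n'Q : (n' * Q <= n)%N by exact: leq_trunc_div.
have nQ : (n < n' * Q + Q)%N by rewrite -mulSnr; exact: ltn_ceil.
have n'n : (n' <= n)%N by exact: leq_div.
have M0 : (1 < M)%N by rewrite /M addn2.
have Q2 : (1 < Q)%N.
  rewrite -(ltr_nat R) (lt_le_trans _ HQ)//.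
  have : 0 < (L + 1) ^+ 2 - 1 by nra.
  lra.
have nn2 : (n' <= n - n')%N.
  rewrite leq_subRL//; apply: leq_trans n'Q; rewrite addnn -muln2 leq_mul//.
have nE : n = (n' + (n - n'))%N by rewrite subnKC.
have big1 : (L + 1) * a n' < a (n - n').
  apply: H4.
  - by apply: leq_trans Mn'; rewrite /M; clear; lia.
  - by apply: leq_trans nn2; apply: leq_trans Mn'; rewrite /M; clear; lia.
  rewrite natrB//; have : n'%:R * Q%:R <= n%:R :> R by rewrite -natrM ler_nat.
  have : 0 <= n'%:R :> R by [].
  nra.
have an'0 : 0 < a n' by apply: a_gt0; exact: leq_trans (ltnW M0) Mn'.
have big2 : a n < T * a n'.
  apply: H5.
  - by apply: leq_trans Mn'; rewrite /M; clear; lia.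
  - by apply: leq_trans n'n; apply: leq_trans Mn'; rewrite /M; clear; lia.
  have n1R : 1 <= n'%:R :> R by rewrite ler1n; exact: leq_trans (ltnW M0) Mn'.
  have : n%:R <= n'%:R * Q%:R + Q%:R :> R by rewrite -natrM -natrD ler_nat ltnW.
  have q1 : Q%:R <= n'%:R * Q%:R :> R by rewrite ler_peMl//; lra.
  have q2 : n'%:R * Q%:R <= n'%:R * Q%:R * Q%:R :> R.
    by rewrite ler_peMr// mulr_ge0.
  rewrite (_ : T ^+ 2 * n'%:R = 64 * (n'%:R * Q%:R * Q%:R)); last by rewrite /T; ring.
  lra.
have small : d1 / T * a n <= d1 * a n'.
  by rewrite -mulrA ler_pM2l// ler_pdivrMl// ltW.
have sdl : d1 * a n' <= dl * a n' by rewrite ler_pM2r// ge_min lexx.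
have s1 : d1 * a n' <= a n' by rewrite ler_piMl ?(ltW an'0)// ge_min lexx orbT.
rewrite {1}nE /Ps Es_cat.
apply: (@le_trans _ _ (Es E n' (fun u => Es E (n - n') (fun v =>
    ((mx u)%:~R < dl * a n')%R%:R * (~~ (a (n - n') < (sumz v)%:~R))%R%:R +
    (L * a n' < `|(sumz u)%:~R|)%R%:R)))).
  apply: (Es_le hE).
  - apply: (bn_Es hE); exists 1 => s t _ _; case: (_ < _); rewrite ?normr1 ?normr0//.
  - apply: (bn_Es hE); exists 2 => s t _ _; exact: bool3_le2.
  move=> u _; apply: (Es_le hE); [bdd..|] => v _.
  have [h1|h1] := ltP (L * a n') `|(sumz u)%:~R|.
    by rewrite (le_trans (bool_le1 _ _))// lerDr mulr_ge0.
  have [h2|_] := ltP (mx (u ++ v))%:~R (d1 / T * a n); last first.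
    by rewrite addr_ge0// mulr_ge0.
  have m1 : (mx u)%:~R <= (mx (u ++ v))%:~R :> R by rewrite ler_int mx_cat le_max lexx.
  have m2 : (sumz u)%:~R + (sumz v)%:~R <= (mx (u ++ v))%:~R :> R.
    by rewrite -intrD ler_int mx_cat le_max lerD2l mx_ge_sumz orbT.
  have -> : (mx u)%:~R < dl * a n' by lra.
  have -> : a (n - n') < (sumz v)%:~R = false.
    move: h1; rewrite ler_norml => /andP[h1 _].
    by apply/negbTE; rewrite -leNgt; lra.
  by rewrite /= mul1r addr0.
rewrite (@Es_ext _ _ _ _ (fun u => ((mx u)%:~R < dl * a n')%R%:R *
    Pr (n - n') (fun v => ~~ (a (n - n') < (sumz v)%:~R)) + (L * a n' < `|(sumz u)%:~R|)%R%:R)); last first.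
  by move=> u _; rewrite (EsD hE); [rewrite (Es_cst hE) (EsZ hE)//; bdd|bdd..].
rewrite (EsD hE); [|bdd..].
have m2 : Pr (n - n') (fun v => ~~ (a (n - n') < (sumz v)%:~R)) <= 1 - c0.
  rewrite (Ps_neg hE) lerD2l lerN2; apply: H3 => /=.
  by apply: leq_trans nn2; apply: leq_trans Mn'; rewrite /M; clear; lia.
have m3 : Es E n' (fun u => (L * a n' < `|(sumz u)%:~R|)%R%:R) <= e.
  apply: H2 => /=.
  by apply: leq_trans Mn'; rewrite /M; clear; lia.
have m1 : Pr n' (fun u => (mx u)%:~R < dl * a n') <= q.
  apply: H1 => /=.
  by apply: leq_trans Mn'; rewrite /M; clear; lia.
apply: lerD => //.
rewrite (@Es_ext _ _ _ _ (fun u => Pr (n - n') (fun v => ~~ (a (n - n') < (sumz v)%:~R)) *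
    ((mx u)%:~R < dl * a n')%R%:R)); last by move=> u _; rewrite mulrC.
rewrite (EsZ hE); last by bdd.
by apply: ler_pM => //; exact: Ps_ge0.
Qed.

(** Iterating [F_step] from the trivial bound 1 leaves [(1 - c0) ^ k] and [k] small errors. *)
Lemma max_lower e : 0 < e -> exists2 dl : R, 0 < dl &
  \forall n \near \oo, Pr n (fun s => (mx s)%:~R < dl * a n) <= e.
Proof.
move=> e0.
have c1 : c0 <= 1.
  have [n _ H] := mass; have := H n (leqnn n) => /= h.
  by apply: le_trans h _; exact: Ps_le1.
have [k Hk] := nat_upper_bound (2 / (e * c0)).
have ec : 0 < e * c0 by rewrite mulr_gt0.
have pk : (1 - c0) ^+ k <= e / 2.
  have := bernoulli_inv k (ltW c0_gt0) c1.
  have p0 : 0 <= (1 - c0) ^+ k by rewrite exprn_ge0//; lra.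
  move: Hk; rewrite ler_pdivrMr// => Hk h.
  have : (1 - c0) ^+ k * (2 / e) <= 1.
    apply: le_trans h; rewrite ler_wpM2l// ler_pdivrMr//; lra.
  by rewrite mulrA ler_pdivrMr// mul1r; lra.
pose e' := e / (2 * k.+1%:R).
have e'0 : 0 < e' by rewrite divr_gt0// mulr_gt0.
have ke : k%:R * e' <= e / 2.
  rewrite /e' mulrA ler_pdivrMr ?mulr_gt0// mulrA -(mulrA e) mulVf// mulr1 mulrC ler_pM2l//.
  by rewrite ler_nat.
have F1 j : F ((1 - c0) ^+ j + j%:R * e').
  elim: j => [|j [dl dl0 IHj]].
    exists 1 => //; near=> n; rewrite expr0 mul0r addr0; exact: Ps_le1.
  have [|d2 d20 H2] := @F_step ((1 - c0) ^+ j + j%:R * e') e' e'0; first by exists dl.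
  exists d2 => //; move: H2; apply: filterS => n h; apply: le_trans h _.
  rewrite exprS -natr1; have : 0 <= j%:R * e' by rewrite mulr_ge0// ltW.
  have := c0_gt0; nra.
have [dl dl0 H] := F1 k; exists dl => //; move: H; apply: filterS => n h.
by apply: le_trans h _; lra.
Unshelve. all: by end_near. Qed.

(** Take a time [m] with [dl a m] comparable to [x]. By then the level [x] has been passed with
    probability close to 1, while with high probability no step exceeds a small multiple of [a m];
    the overshoot is at most the largest step. *)
Lemma overshoot (e : R) : 0 < e -> exists x0, forall x y r,
  (x0 <= x)%N -> (r <= y)%N -> e * x%:R <= r%:R ->
  V x + (1 - e) * V (y - r)%N <= V (x + y).
Proof.
move=> e0; have e2 : 0 < e / 2 by rewrite divr_gt0.
have [dl dl0 [n1 _ H1]] := max_lower e2.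
have ed : 0 < e * dl / 3 by rewrite divr_gt0// mulr_gt0.
have [n2 _ H2] := step_tail ed e2.
have [n3 H3] := scale_lt (ltr0n R 3).
pose n0 := (n1 + n2 + n3 + 2)%N.
have [x0 Hx0] := nat_upper_bound (dl * a n0 + 1).
exists x0.+1 => x y r x0x ry exr.
have xbig : dl * a n0 < x%:R.
  by have : x0%:R <= x%:R :> R; [rewrite ler_nat ltnW|lra].
(* Minimality will give [dl a (m - 1) < x], and [a m < 3 a (m - 1)] then makes [dl a m] and [x]
   comparable. *)
have exm : exists m, (n0 <= m)%N && (x%:R <= dl * a m).
  have [n4 _ H4] := scale_infty (x%:R / dl).
  exists (maxn n0 n4); rewrite leq_maxl/=.
  have /= := H4 (maxn n0 n4) (leq_maxr _ _).
  by rewrite ltr_pdivrMr// mulrC => /ltW.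
have [m /andP[n0m xm] mmin] := ex_minnP exm.
have mn0 : (n0 < m)%N.
  rewrite ltn_neqAle n0m andbT; apply/eqP => mE.
  by move: xm; rewrite -mE; lra.
have m0 : (0 < m)%N by exact: leq_ltn_trans mn0.
have am1 : dl * a m.-1 < x%:R.
  rewrite ltNge; apply/negP => xa.
  have := mmin m.-1; rewrite xa andbT -ltnS prednK// mn0 => /(_ isT).
  by rewrite leqNgt prednK// leqnn.
have m1 : m%:R = m.-1%:R + 1 :> R by rewrite natr1 prednK.
have mge : (n0 <= m.-1)%N by rewrite -ltnS prednK.
have am : a m < 3 * a m.-1.
  apply: H3.
  - by apply: leq_trans mge; rewrite /n0; clear; lia.
  - by apply: leq_trans n0m; rewrite /n0; clear; lia.
  have : 2 <= m.-1%:R :> R.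
    by rewrite (ler_nat R 2); apply: leq_trans mge; rewrite /n0; clear; lia.
  by rewrite m1; lra.
have erm : e * dl / 3 * a m <= r%:R.
  apply: le_trans exr; apply: (@le_trans _ _ (e * (dl * a m.-1))).
    by rewrite -!mulrA ler_pM2l// ler_pM2l//; lra.
  by rewrite ler_pM2l// ltW.
have x_gt0 : (0 < x)%N by exact: leq_trans x0x.
have := V_sup hE m x ry; have := passes_ge hE m r x_gt0.
have p1 : Pr m (fun s => mx s < x%:Z) <= e / 2.
  have /= h1 : Pr m (fun s => (mx s)%:~R < dl * a m) <= e / 2.
    by apply: H1 => /=; apply: leq_trans n0m; rewrite /n0; clear; lia.
  apply: le_trans h1; apply: (Ps_le hE) => s _.
  by rewrite -(ltr_int R) => h; apply: lt_le_trans xm.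
have p2 : Pr m (fun s => ~~ all (fun z => z <= r%:Z) s) <= e / 2.
  apply: le_trans (Ps_not_all hE m (fun z => z <= r%:Z)) _.
  have /= h1 : m%:R * E (fun z => (e * dl / 3 * a m < `|z%:~R|)%R%:R) <= e / 2.
    by apply: H2 => /=; apply: leq_trans n0m; rewrite /n0; clear; lia.
  apply: le_trans h1; apply: ler_wpM2l => //; apply: (ex_le hE); [bdd..|] => z.
  case: (leP z r%:Z) => //= zr; rewrite [X in _ <= (nat_of_bool X)%:R](_ : _ = true)//.
  apply: le_lt_trans erm _; apply: lt_le_trans (ler_norm _).
  by rewrite pmulrn ltr_int.
move=> h1 h2; apply: le_trans h2; rewrite lerD2l; apply: ler_wpM2r.
  exact: V_ge0.
by apply: le_trans h1; lra.
Qed.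

Lemma V_linear B (e : R) : 0 < e -> exists x0, forall x z, (x0 <= x)%N -> (z <= B * x)%N ->
  `|V z - z%:R / x%:R * V x| <= e * V x.
Proof.
apply: nearly_additive_linear.
- exact: V_mono.
- exact: V_ge0.
- exact: V_sub.
- exact: overshoot.
Qed.

End maximum.

(** * Local estimates *)

Section finite_fourier.
Context {R : realType}.

Lemma cosD2pi_int (x : R) (k : int) : cos (x + 2 * pi * k%:~R) = cos x.
Proof.
have nat_case (y : R) (n : nat) : cos (y + 2 * pi * n%:R) = cos y.
  rewrite (_ : 2 * pi * n%:R = (pi *+ 2) *+ n); last by rewrite -mulr_natr mulr2n; ring.
  by rewrite periodicn//; exact: cosD2pi.
have [|n|n] := intP k; first by rewrite mulr0 addr0.
  by rewrite -pmulrn nat_case.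
rewrite -[LHS](nat_case _ n.+1) /=; congr cos.
by rewrite intrN -pmulrn; ring.
Qed.

Definition freq (L : nat) (j : nat) : R := 2 * pi * j%:R / L%:R.

(** A finite substitute for the normalized integral over a period of frequencies. It detects
    divisibility by [L] instead of vanishing; the difference is harmless when [L] is far beyond the
    range of the walk. *)
Definition avg (L : nat) (f : R -> R) : R := L%:R^-1 * \sum_(j < L) f (freq L j).

Lemma avg_le L f g : (forall t, f t <= g t) -> avg L f <= avg L g.
Proof. by move=> fg; rewrite ler_wpM2l ?invr_ge0// ler_sum. Qed.

Lemma avgD L f g : avg L (fun t => f t + g t) = avg L f + avg L g.
Proof. by rewrite /avg big_split/= mulrDr. Qed.

Lemma avgZ L c f : avg L (fun t => c * f t) = c * avg L f.
Proof. by rewrite /avg -mulr_sumr mulrCA. Qed.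

Lemma avg_norm L f : `|avg L f| <= avg L (fun t => `|f t|).
Proof.
rewrite /avg normrM ger0_norm ?invr_ge0// ler_wpM2l ?invr_ge0//.
exact: ler_norm_sum.
Qed.

Lemma avg_cos L (y : int) : (0 < L)%N ->
  avg L (fun t => cos (t * y%:~R)) = (L%:Z %| y)%Z%:R.
Proof.
move=> L0; have LR : L%:R != 0 :> R by rewrite pnatr_eq0 -lt0n.
have Lz : L%:Z != 0 by lia.
have fE (j : nat) : cos (freq L j * y%:~R) = cos (freq L j * (y %% L%:Z)%Z%:~R).
  rewrite -[RHS](cosD2pi_int _ (j%:Z * (y %/ L%:Z)%Z)) [in LHS](divz_eq y L%:Z) /freq.
  by congr cos; rewrite !(intrD, intrM) -!pmulrn; field.
rewrite /avg (eq_bigr _ (fun j _ => fE (nat_of_ord j))).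
have r0 := modz_ge0 y Lz.
have rL := ltz_mod y Lz.
have [dv|dv] := boolP (L%:Z %| y)%Z.
  move/dvdz_mod0P: dv => ->.
  rewrite (eq_bigr (fun=> 1)); last by move=> j _; rewrite mulr0 cos0.
  by rewrite sumr_const card_ord mulVf.
set r := (y %% L%:Z)%Z in r0 rL *.
have rp : 0 < r by rewrite lt_neqAle r0 andbT eq_sym; apply: contra dv => /eqP rE; apply/dvdz_mod0P.
pose al : R := 2 * pi * r%:~R / L%:R.
have sal : 0 < sin (al / 2).
  apply: sin_gt0_pi; have pi0 := @pi_gt0 R.
  have LRp : 0 < L%:R :> R by rewrite ltr0n.
  have rR : 0 < r%:~R :> R by rewrite ltr0z.
  have rLR : r%:~R < L%:R :> R by rewrite pmulrn ltr_int; move: rL; lia.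
  rewrite /al; apply/andP; split; first by rewrite !mulr_gt0 ?invr_gt0.
  rewrite (_ : _ / 2 = pi * (r%:~R / L%:R)); last by field.
  by rewrite gtr_pMr// ltr_pdivrMr// mul1r.
(* The Dirichlet kernel telescopes; at [n = L] the angle [al L] is a multiple of [2 pi] and the two
   ends cancel. *)
have tel n : 2 * sin (al / 2) * (\sum_(j < n) cos (al * j%:R)) =
    sin (al * n%:R - al / 2) + sin (al / 2).
  elim: n => [|n IHn]; first by rewrite big_ord0 !mulr0 sub0r sinN addNr.
  rewrite big_ord_recr/= mulrDr IHn -(natr1 n).
  rewrite (_ : al * (n%:R + 1) - al / 2 = al * n%:R + al / 2); last by field.
  by rewrite (sinB (al * n%:R)) (sinD (al * n%:R) (al / 2)); ring.
rewrite (eq_bigr (fun j : 'I_L => cos (al * j%:R))); last first.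
  by move=> j _; congr cos; rewrite /freq /al; field.
suff -> : \sum_(j < L) cos (al * j%:R) = 0 by rewrite mulr0.
have : 2 * sin (al / 2) * (\sum_(j < L) cos (al * j%:R)) = 0.
  rewrite tel (_ : al * L%:R - al / 2 = - (al / 2) + 2 * pi * r%:~R); last first.
    by rewrite /al; field.
  have <- : cos (- (al / 2) - pi / 2 + 2 * pi * r%:~R) = sin (- (al / 2) + 2 * pi * r%:~R).
    by rewrite -cosBpihalf; congr cos; ring.
  by rewrite cosD2pi_int cosBpihalf sinN addNr.
by move/eqP; rewrite !mulf_eq0 (gt_eqF sal) pnatr_eq0/= => /eqP.
Qed.

End finite_fourier.

(** * Frequencies near zero and the lattice of the symmetrized step *)

Section local_estimates.
Context {R : realType}.
Variable E : (int -> R) -> R.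
Hypothesis hE : averaging E.
Let hS := averaging_sym hE.
Local Notation sym := (sym E).
Local Notation rho := (rho E).
Local Notation Pr := (Ps E).
Variable a : nat -> R.
Hypothesis a_gt0 : forall n, (0 < n)%N -> 0 < a n.
Hypothesis scale_gt : forall t, 0 < t -> exists n0, forall n m, (n0 <= n)%N -> (n0 <= m)%N ->
  4 * t ^+ 2 * n%:R <= m%:R -> t * a n < a m.
Hypothesis scale_lt : forall t, 0 < t -> exists n0, forall n m, (n0 <= n)%N -> (n0 <= m)%N ->
  4 * m%:R <= t ^+ 2 * n%:R -> a m < t * a n.
Hypothesis scale_infty : forall B, \forall n \near \oo, B < a n.
Hypothesis sym_tail0 : forall eta e, 0 < eta -> 0 < e ->
  \forall n \near \oo, n%:R * sym (fun d => (eta * a n < `|d%:~R|)%R%:R) <= e.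
Hypothesis trunc_moment_bounds : forall t, 0 < t -> \forall n \near \oo,
  t ^- 2 <= n%:R * trunc_moment E (t * a n) <= 3 * t ^- 2.

(** Symmetrized steps within [[-a m, a m]] carry at least [1 / (2 m)] of the truncated moment, and
    on them [1 - cos u >= 3 / 8 u ^ 2]; hence [3 / 16]. *)
Lemma rho_quadratic : \forall m \near \oo, forall th : R, `|th| <= (a m)^-1 ->
  3 / 16 * (th * a m) ^+ 2 <= m%:R * (1 - rho th).
Proof.
have e0 : 0 < 2^-1 :> R by rewrite invr_gt0.
have H1 := sym_tail0 (@ltr01 R) e0.
have H2 := trunc_moment_bounds (@ltr01 R).
near=> m.
have m0 : (0 < m)%N by near: m; exact: nbhs_infty_gt.
have am := a_gt0 m0.
have h1 : m%:R * sym (fun d => (1 * a m < `|d%:~R|)%R%:R) <= 2^-1 by near: m.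
have /andP[h2 _] : 1 ^- 2 <= m%:R * trunc_moment E (1 * a m) <= 3 * 1 ^- 2 by near: m.
rewrite mul1r in h1 h2; rewrite expr1n invr1 in h2.
pose f (d : int) : R := (~~ (a m < `|d%:~R|))%R%:R * (d%:~R / a m) ^+ 2.
have f_le1 d : 0 <= f d <= 1.
  rewrite /f; have [h|h] /= := ltP (a m) `|d%:~R|; first by rewrite mul0r lexx ler01.
  rewrite mul1r sqr_ge0/= -real_normK ?num_real// expr_le1// normrM normfV (gtr0_norm am).
  by rewrite ler_pdivrMr// mul1r.
have bf : bd f.
  by exists 1 => d; have /andP[? ?] := f_le1 d; rewrite ger0_norm.
have hf : 2^-1 <= m%:R * sym f.
  have : trunc_moment E (a m) <= sym (fun d => f d + (a m < `|d%:~R|)%R%:R).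
    apply: (ex_le hS); [|bdd|] => [|d].
      exists 1 => d; rewrite ger0_norm ?ge_min ?lexx//.
      by rewrite le_min ler01 sqr_ge0.
    rewrite /f; case: (a m < _) => /=; rewrite ge_min; apply/orP.
      by left; rewrite mul0r add0r.
    by right; rewrite mul1r addr0.
  rewrite (exD hS); [|bdd..] => h3.
  have := ler_wpM2l (ler0n R m) h3; rewrite mulrDr; lra.
move=> th thm.
have : sym (fun d => 3 / 8 * (th * a m) ^+ 2 * f d) <= 1 - rho th.
  rewrite (one_sub_rho hE); apply: (ex_le hS); [bdd..|] => d.
  rewrite /f; have [h|h] /= := ltP (a m) `|d%:~R|.
    by rewrite mul0r mulr0 subr_ge0 cos_le1.
  rewrite mul1r; apply: le_trans (one_sub_cos_ge _).
    rewrite -mulrA -exprMn (_ : th * a m * (d%:~R / a m) = th * d%:~R)//.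
    by field; rewrite gt_eqF.
  rewrite normrM (le_trans (ler_pM _ _ thm h))// mulVf// gt_eqF//.
rewrite (exZ hS)// => h3; have := ler_wpM2l (ler0n R m) h3.
have : 3 / 8 * (th * a m) ^+ 2 * 2^-1 <= 3 / 8 * (th * a m) ^+ 2 * (m%:R * sym f).
  by rewrite ler_wpM2l// mulr_ge0// ?sqr_ge0//; lra.
lra.
Unshelve. all: by end_near. Qed.

(** [ex_tight] stands in for countable additivity: up to mass [e] only the finitely many atoms in
    [[-L, L]] count. *)
Lemma null_atoms (A : pred int) : (forall d, A d -> sym (fun z => (z == d)%:R) = 0) ->
  sym (fun z => (A z)%:R) = 0.
Proof.
move=> H; apply/eqP; rewrite eq_le; apply/andP; split; last first.
  by rewrite -[leLHS](ex_cst hS); apply: (ex_le hS) => [||z]; [bdd..|]; case: (A z).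
apply/ler_addgt0Pr => e e0; rewrite add0r.
have [L HL] := ex_tight hS e0.
pose g (i : 'I_(L + L).+1) : int := i%:Z - L%:Z.
apply: (@le_trans _ _ (sym (fun z => (L < `|z|)%N%:R +
    \sum_(i < (L + L).+1 | A (g i)) (z == g i)%:R))).
  apply: (ex_le hS) => [| |z]; first by bdd.
    by apply: bdD; [bdd|apply: bd_sum => i; bdd].
  case Az : (A z); last by rewrite addr_ge0// sumr_ge0.
  have [h|h] := ltnP L `|z|; first by rewrite lerDl sumr_ge0.
  have iL : (absz (z + L%:Z)%R < (L + L).+1)%N by lia.
  have gz : g (Ordinal iL) = z by rewrite /g /=; lia.
  rewrite add0r (bigD1 (Ordinal iL)) ?gz//= eqxx lerDl sumr_ge0//.
rewrite (exD hS); [|bdd|by apply: bd_sum => i; bdd].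
suff -> : sym (fun z => \sum_(i < (L + L).+1 | A (g i)) (z == g i)%:R) = 0 by rewrite addr0.
have gen (r : seq 'I_(L + L).+1) : sym (fun z => \sum_(i <- r | A (g i)) (z == g i)%:R) = 0.
  elim: r => [|i r IHr].
    by rewrite -[RHS](ex_cst hS); congr sym; apply/funext => z; rewrite big_nil.
  case Ai : (A (g i)); last first.
    by rewrite -[RHS]IHr; congr sym; apply/funext => z; rewrite big_cons Ai.
  rewrite (_ : (fun z => _) = (fun z => (z == g i)%:R + \sum_(j <- r | A (g j)) (z == g j)%:R)).
    by rewrite (exD hS); [rewrite H// IHr addr0|bdd|apply: bd_sum => j; bdd].
  by apply/funext => z; rewrite big_cons Ai.
exact: gen.
Qed.

(* For such [y] a shift by [y] is visible at no frequency at which the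
   symmetrized walk does not decay. *)
Definition dominated (y : int) : Prop :=
  exists C, forall th : R, 1 - cos (th * y%:~R) <= C * (1 - rho th).

Lemma dominatedD x y : dominated x -> dominated y -> dominated (x + y).
Proof.
move=> [C HC] [D HD]; exists (2 * C + 2 * D) => th.
have := HC th; have := HD th; have := one_sub_cosD (th * x%:~R) (th * y%:~R).
by rewrite -mulrDr -intrD; lra.
Qed.

Lemma dominatedN x : dominated x -> dominated (- x).
Proof. by move=> [C HC]; exists C => th; rewrite intrN mulrN cosN. Qed.

Lemma dominatedM x k : dominated x -> dominated (x * k).
Proof.
move=> Dx; have D0 : dominated 0.
  by exists 0 => th; rewrite mulr0 cos0 subrr mul0r.
have Dn (n : nat) : dominated (x * n%:Z).
  elim: n => [|n IHn]; first by rewrite mulr0.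
  by rewrite -addn1 PoszD mulrDr mulr1; exact: dominatedD.
have [|n|n] := intP k; first by rewrite mulr0.
  exact: Dn.
by rewrite mulrN; apply: dominatedN; exact: Dn.
Qed.

(** The atom [d] of mass [p] alone contributes [p (1 - cos (th d))] to [1 - rho th]. *)
Lemma dominated_atom d : sym (fun z => (z == d)%:R) != 0 -> dominated d.
Proof.
set p := sym _ => p0.
have pp : 0 < p.
  rewrite lt_neqAle eq_sym p0/= -[leLHS](ex_cst hS).
  by apply: (ex_le hS) => [||z]; [bdd..|]; case: (_ == _).
exists p^-1 => th; rewrite ler_pdivlMl// (one_sub_rho hE) mulrC -(exZ hS); last by bdd.
apply: (ex_le hS); [bdd..|] => z.
have := cos_le1 (th * z%:~R).
by have [->|_] := eqVneq z d; rewrite ?mulr1 ?mulr0; lra.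
Qed.

(* The dominated integers form a subgroup that carries the symmetrized step; its
   generator [h] plays the part of the span. *)
Lemma lattice : exists h : nat, [/\ (0 < h)%N, dominated h &
  sym (fun z => (~~ (h %| z)%Z)%:R) = 0].
Proof.
have exh : exists h : nat, `[< (0 < h)%N /\ dominated h >].
  (* Otherwise every nonzero atom is null, the symmetrized step is almost surely 0, and its
     truncated moment vanishes, against [trunc_moment_bounds]. *)
  apply: contrapT => H.
  have nz d : d != 0 -> sym (fun z => (z == d)%:R) = 0.
    move=> d0; apply/eqP; apply: contrapT => /negP /dominated_atom Dd; apply: H.
    exists `|d|%N; apply/asboolP; split; first by rewrite absz_gt0.
    have [d1|d1] := leP 0 d; first by rewrite gez0_abs.
    by rewrite ltz0_abs//; exact: dominatedN.
  have := null_atoms nz => n0.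
  have [n _ /(_ n.+1 (leqnSn n))] := trunc_moment_bounds (@ltr01 R).
  rewrite /= expr1n invr1 mul1r => /andP[+ _].
  suff -> : trunc_moment E (a n.+1) = 0 by rewrite mulr0 ler10.
  apply/eqP; rewrite eq_le trunc_moment_ge0// andbT -n0; apply: (ex_le hS); [|bdd|] => [|d].
    exists 1 => d; rewrite ger0_norm ?ge_min ?lexx//.
    by rewrite le_min ler01 sqr_ge0.
  have [->|d0] := eqVneq d 0; first by rewrite mul0r expr0n/= ge_min lexx orbT.
  by rewrite ge_min lexx.
have [h /asboolP[h0 Dh] hmin] := ex_minnP exh.
exists h; split => //; apply: (@null_atoms (fun z => ~~ (h%:Z %| z)%Z)) => d hd.
apply/eqP; apply: contrapT => /negP /dominated_atom Dd.
have hz : h%:Z != 0 by lia.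
pose r := (d %% h%:Z)%Z.
have r0 : 0 <= r by exact: modz_ge0.
have rh : r < h%:Z by apply: ltz_pmod; lia.
have rn0 : r != 0 by apply: contra hd => /eqP rE; apply/dvdz_mod0P.
have Dr : dominated r.
  have -> : r = d + (- (h%:Z * (d %/ h%:Z)%Z)) by apply/eqP; rewrite eq_sym subr_eq; apply/eqP; rewrite [RHS]addrC mulrC; exact: divz_eq.
  by apply: dominatedD => //; apply: dominatedN; exact: dominatedM.
have : (h <= `|r|)%N.
  by apply: hmin; apply/asboolP; split; [lia|rewrite gez0_abs].
lia.
Qed.

End local_estimates.

(** * Return probability of the symmetrized walk *)

Section local_limit.
Context {R : realType}.
Variable E : (int -> R) -> R.
Hypothesis hE : averaging E.
Let hS := averaging_sym hE.
Local Notation sym := (sym E).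
Local Notation rho := (rho E).
Local Notation Pr := (Ps E).
Variable a : nat -> R.
Hypothesis a_gt0 : forall n, (0 < n)%N -> 0 < a n.
Hypothesis scale_gt : forall t, 0 < t -> exists n0, forall n m, (n0 <= n)%N -> (n0 <= m)%N ->
  4 * t ^+ 2 * n%:R <= m%:R -> t * a n < a m.
Hypothesis scale_lt : forall t, 0 < t -> exists n0, forall n m, (n0 <= n)%N -> (n0 <= m)%N ->
  4 * m%:R <= t ^+ 2 * n%:R -> a m < t * a n.
Hypothesis scale_infty : forall B, \forall n \near \oo, B < a n.
Hypothesis rho_quad : \forall m \near \oo, forall th : R, `|th| <= (a m)^-1 ->
  3 / 16 * (th * a m) ^+ 2 <= m%:R * (1 - rho th).
Variable h : nat.
Hypothesis h0 : (0 < h)%N.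
Hypothesis Dh : dominated E h.
Hypothesis hnull : sym (fun z => (~~ (h %| z)%Z)%:R) = 0.

Let hR : 0 < h%:R :> R. Proof. by rewrite ltr0n. Qed.

Lemma cos_period (th : R) (k y : int) : (h %| y)%Z ->
  cos ((th + 2 * pi * k%:~R / h%:R) * y%:~R) = cos (th * y%:~R).
Proof.
move=> /dvdzP[q ->]; rewrite -[RHS](cosD2pi_int _ (k * q)); congr cos.
by rewrite !intrM -pmulrn; field; rewrite gt_eqF.
Qed.

Lemma rho_period th (k : int) : rho (th + 2 * pi * k%:~R / h%:R) = rho th.
Proof.
have half (x y : R) : (forall z : int, (h %| z)%Z -> cos (x * z%:~R) = cos (y * z%:~R)) ->
    rho x <= rho y.
  move=> xy; rewrite -[leRHS]addr0 -(mulr0 2) -hnull -(exZ hS); last by bdd.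
  rewrite -(exD hS); [|bdd..]; apply: (ex_le hS); [bdd..|] => z.
  case hz : (h %| z)%Z => /=; first by rewrite xy// mulr0 addr0.
  by have := cos_le1 (x * z%:~R); have := cos_geN1 (y * z%:~R); lra.
apply/eqP; rewrite eq_le; apply/andP; split; apply: half => z hz; first exact: cos_period.
by rewrite cos_period.
Qed.

Lemma reduce_freq (th : R) : exists k : int,
  `|th + 2 * pi * k%:~R / h%:R| * h%:R <= pi.
Proof.
have pi0 := @pi_gt0 R.
pose k := Num.floor (th * h%:R / (2 * pi) + 2^-1).
exists (- k) => //=.
rewrite -[X in _ * X](gtr0_norm hR) -normrM.
rewrite (_ : (th + _) * _ = th * h%:R - 2 * pi * k%:~R); last first.
  by rewrite intrN; field; rewrite gt_eqF.
have := floor_le_tmp (th * h%:R / (2 * pi) + 2^-1); rewrite -/k => k1.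
have := floorD1_gt (th * h%:R / (2 * pi) + 2^-1); rewrite -/k intrD => k2.
have p2 : 0 < 2 * pi :> R by rewrite mulr_gt0.
have e1 : th * h%:R / (2 * pi) * (2 * pi) = th * h%:R by rewrite divfK ?gt_eqF.
have h1 : k%:~R * (2 * pi) <= th * h%:R + pi.
  by have := ler_wpM2r (ltW p2) k1; rewrite (mulrDl (_ / _)) e1; lra.
have h2 : th * h%:R + pi < (k%:~R + 1) * (2 * pi).
  have : (th * h%:R / (2 * pi) + 2^-1) * (2 * pi) < (k%:~R + 1) * (2 * pi) by rewrite ltr_pM2r.
  by rewrite (mulrDl (_ / _)) e1; lra.
rewrite ler_norml; apply/andP; split; lra.
Qed.

(** After reduction modulo the period there are three ranges. For [|th| <= 1 / a m] both sides are
    quadratic. In the middle range an earlier time [i] with [1 / |th|] between [a (i - 1)] and [a i]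
    bounds [m (1 - rho th)] from below. Frequencies away from 0 are handled by [dominated h]. *)
Lemma dominated_scaled : exists2 C : R, 1 <= C & exists n0, forall m (y : int), (n0 <= m)%N ->
  (h %| y)%Z -> `|y%:~R| <= a m -> forall th : R,
  1 - cos (th * y%:~R) <= C * (m%:R * (1 - rho th)).
Proof.
have pi0 := @pi_gt0 R.
have [Ch HCh] := Dh.
have [n1 _ H1] := rho_quad.
have [n2 H2] := scale_lt (ltr0n R 3).
pose n0 := (n1 + n2 + 2)%N.
have an0 : 0 < a n0 by apply: a_gt0; rewrite /n0 addn2.
pose x0 : R := Num.min (h%:R / a n0) pi.
have x00 : 0 < x0 by rewrite lt_min pi0 divr_gt0.
pose c1 := 1 - cos x0.
have x0pi : x0 \in `[0, pi] by rewrite in_itv/= (ltW x00) ge_min lexx orbT.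
have c10 : 0 < c1.
  by rewrite /c1 subr_gt0 -(@cos0 R) ltr_cos// in_itv/= lexx ltW.
(* In the middle range [m (1 - rho th) >= 3 / 16 * 1 / 9 = 1 / 48], and the left-hand side is at
   most 2. *)
pose C := Num.max 96 (2 * Ch / c1).
have C96 : 96 <= C by rewrite le_max lexx.
have C2 : 2 * Ch / c1 <= C by rewrite le_max lexx orbT.
exists C; first by lra.
exists n0 => m y n0m hy ym th'.
have [k] := reduce_freq th'; set th := th' + _ => thpi.
rewrite -(cos_period th' k hy) -(rho_period th' k) -/th.
have m0 : (0 < m)%N by apply: leq_trans n0m; rewrite /n0 addn2.
have am := a_gt0 m0.
have mR : 1 <= m%:R :> R by rewrite ler1n.
have r1 := rho_le1 hE th.
have c2 : 1 - cos (th * y%:~R) <= 2 by have := cos_geN1 (th * y%:~R); lra.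
have CM : 96 * (m%:R * (1 - rho th)) <= C * (m%:R * (1 - rho th)).
  by rewrite ler_wpM2r// mulr_ge0// subr_ge0.
have [thm|thm] := leP `|th| (a m)^-1.
  apply: le_trans CM; apply: le_trans (one_sub_cos_le _) _.
  have /= H := H1 m (leq_trans _ n0m) th thm.
  have {}H := H ltac:(by rewrite /n0 -addnA leq_addr).
  have : (th * y%:~R) ^+ 2 <= (th * a m) ^+ 2.
    rewrite !exprMn ler_wpM2l ?sqr_ge0// -real_normK ?num_real//.
    by rewrite lerXn2r ?nnegrE ?(ltW am).
  have : 0 <= (th * a m) ^+ 2 by exact: sqr_ge0.
  lra.
apply: le_trans c2 _.
have th0 : 0 < `|th| by rewrite (lt_trans _ thm)// invr_gt0.
have [th1|th1] := leP `|th| (a n0)^-1.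
  have exi : exists i, (n0 <= i)%N && (`|th|^-1 < a i).
    by exists m; rewrite n0m/= invf_plt ?posrE.
  have [i /andP[n0i ai] imin] := ex_minnP exi.
  have n0i' : (n0 < i)%N.
    rewrite ltn_neqAle n0i andbT; apply/eqP => iE; move: ai; rewrite -iE ltNge.
    by rewrite -(invrK (a n0)) lef_pV2 ?posrE ?invr_gt0// th1.
  have i0 : (0 < i)%N by exact: leq_ltn_trans n0i'.
  have jn0 : (n0 <= i.-1)%N by rewrite -ltnS prednK.
  have aj : a i.-1 <= `|th|^-1.
    rewrite leNgt; apply/negP => ja; have := imin i.-1; rewrite jn0 ja => /(_ isT).
    by rewrite leqNgt prednK// leqnn.
  have im : (i <= m)%N by apply: imin; rewrite n0m/= invf_plt ?posrE.
  have aj0 : 0 < a i.-1 by apply: a_gt0; apply: leq_trans jn0; rewrite /n0 addn2.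
  have iR : i%:R = i.-1%:R + 1 :> R by rewrite natr1 prednK.
  have j2 : 2 <= i.-1%:R :> R.
    by rewrite (ler_nat R 2); apply: leq_trans jn0; rewrite /n0 leq_addl.
  have aij : a i < 3 * a i.-1.
    apply: H2; [apply: leq_trans jn0|apply: leq_trans n0i|lra].
      by rewrite /n0 addnAC leq_addl.
    by rewrite /n0 addnAC leq_addl.
  have thj : `|th| <= (a i.-1)^-1 by rewrite -(invrK `|th|) lef_pV2 ?posrE ?invr_gt0.
  have /= H := H1 i.-1 (leq_trans _ jn0) th thj.
  have {}H := H ltac:(by rewrite /n0 -addnA leq_addr).
  have big : 3^-1 <= `|th| * a i.-1.
    have : 1 <= `|th| * a i by move: ai; rewrite invf_plt ?posrE ?a_gt0// -[X in X < _ -> _]mul1r ltr_pdivrMr ?a_gt0// => /ltW.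
    have : `|th| * a i <= `|th| * (3 * a i.-1) by rewrite ler_pM2l// ltW.
    lra.
  have sq : (3^-1) ^+ 2 <= (th * a i.-1) ^+ 2.
    by rewrite -[leRHS]real_normK ?num_real// normrM (gtr0_norm aj0) lerXn2r ?nnegrE//; lra.
  have jm : i.-1%:R * (1 - rho th) <= m%:R * (1 - rho th).
    by rewrite ler_wpM2r ?subr_ge0// ler_nat (leq_trans (leq_pred _)).
  apply: le_trans CM; lra.
have thx : x0 <= `|th| * h%:R.
  have xe : h%:R / a n0 < `|th| * h%:R by rewrite mulrC ltr_pM2r.
  by rewrite ge_min ltW.
have cx : c1 <= 1 - cos (th * h%:R).
  rewrite lerD2l lerN2 -[in leLHS](cos_norm (th * _)) normrM (gtr0_norm hR).
  have tin : `|th| * h%:R \in `[0, pi] by rewrite in_itv/= thpi mulr_ge0// ltW.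
  by rewrite leNgt ltr_cos// -leNgt.
have /= := HCh th; rewrite -pmulrn => hc.
have c3 : c1 <= Ch * (1 - rho th) by lra.
have s0 : 0 <= 1 - rho th by rewrite subr_ge0.
have : 2 <= C * (1 - rho th).
  apply: le_trans (ler_wpM2r s0 C2); rewrite mulrAC ler_pdivlMr//; lra.
move=> h3; apply: le_trans h3 _; rewrite ler_wpM2l//; first by lra.
by rewrite ler_peMl.
Qed.

(* The probability that the symmetrized walk is divisible by [L] at time [m]; for
   [L] much larger than the range of the walk it is the return probability. *)
Definition sym_return L m : R := avg L (fun t => rho t ^+ m).

Lemma avg_cst L c : (0 < L)%N -> avg L (fun=> c) = c :> R.
Proof.
move=> L0; rewrite /avg sumr_const card_ord -(mulr_natl c) mulKf//.
by rewrite pnatr_eq0 -lt0n.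
Qed.

Lemma prob_mod_sym L m (y : int) : (0 < L)%N ->
  Ps sym m (fun s => (L %| sumz s - y)%Z) = avg L (fun t => rho t ^+ m * cos (t * y%:~R)).
Proof.
move=> L0; rewrite /Ps (@Es_ext _ _ _ _
  (fun s => L%:R^-1 * \sum_(j < L) cos (freq L j * (sumz s - y)%:~R))); last first.
  by move=> s _; rewrite -(avg_cos _ L0).
rewrite (EsZ hS); last by apply: bn_sum => i; bdd.
congr (_ * _); rewrite (Es_sum hS); last by move=> i; bdd.
apply: eq_bigr => j _; set t := freq L j.
have [H1 H2] := Es_sym_cos_sin hE m t.
rewrite (@Es_ext _ _ _ _ (fun s => cos (t * y%:~R) * cos (t * (sumz s)%:~R) +
   sin (t * y%:~R) * sin (t * (sumz s)%:~R))); last first.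
  by move=> s _; rewrite intrB mulrBr cosB; ring.
rewrite (EsD hS); [|bdd..]; rewrite !(EsZ hS); [|bdd..].
by rewrite H1 H2 mulr0 addr0 mulrC.
Qed.

Lemma sym_return_ge0 L m : 0 <= sym_return L m.
Proof. by rewrite mulr_ge0 ?invr_ge0// sumr_ge0// => i _; rewrite exprn_ge0// rho_ge0. Qed.

Lemma sym_return_le1 L m : (0 < L)%N -> sym_return L m <= 1.
Proof.
move=> L0; rewrite -[leRHS](avg_cst 1 L0); apply: avg_le => t.
by rewrite exprn_ile1 ?rho_ge0// rho_le1.
Qed.

(** Giving up [m - k] of the [m] factors pays for [1 - rho t], by [bernoulli_inv] applied to
    [1 - rho t]. *)
Lemma rho_gap m k t : (k <= m)%N ->
  (m - k)%:R * (rho t ^+ m * (1 - rho t)) <= rho t ^+ k.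
Proof.
move=> km; have r0 := rho_ge0 hE t; have r1 := rho_le1 hE t.
have s0 : 0 <= 1 - rho t by lra. have s1 : 1 - rho t <= 1 by lra.
have := bernoulli_inv (m - k) s0 s1.
rewrite (_ : 1 - (1 - rho t) = rho t); last by lra.
have p0 : 0 <= rho t ^+ (m - k) by exact: exprn_ge0.
have pk : 0 <= rho t ^+ k by exact: exprn_ge0.
move=> H; have -> : rho t ^+ m = rho t ^+ k * rho t ^+ (m - k) by rewrite -exprD subnKC.
rewrite -mulrA mulrCA ler_piMr//; lra.
Qed.

Lemma sym_return_flat (C : R) L m m' k (y : int) : (0 < L)%N -> (k <= m)%N -> 0 <= C ->
  (forall th : R, 1 - cos (th * y%:~R) <= C * (m'%:R * (1 - rho th))) ->
  (m - k)%:R * (sym_return L m - Ps sym m (fun s => (L %| sumz s - y)%Z)) <= C * m'%:R * sym_return L k.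
Proof.
move=> L0 km C0 H; rewrite prob_mod_sym//.
have -> : sym_return L m - avg L (fun t => rho t ^+ m * cos (t * y%:~R)) =
    avg L (fun t => rho t ^+ m * (1 - cos (t * y%:~R))).
  rewrite /sym_return -[X in _ - X]mul1r -mulNr -avgZ -avgD; congr avg.
  by apply/funext => t; ring.
rewrite -!avgZ; apply: avg_le => t.
have r0 := rho_ge0 hE t.
apply: (@le_trans _ _ ((m - k)%:R * (rho t ^+ m * (C * (m'%:R * (1 - rho t)))))).
  by rewrite ler_wpM2l// ler_wpM2l// exprn_ge0.
have -> : (m - k)%:R * (rho t ^+ m * (C * (m'%:R * (1 - rho t)))) =
   C * m'%:R * ((m - k)%:R * (rho t ^+ m * (1 - rho t))) by ring.
by rewrite ler_wpM2l ?rho_gap// mulr_ge0.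
Qed.

(** The points [h i] are distinct modulo [L], so the events are disjoint. *)
Lemma sym_return_disjoint L m N : (0 < L)%N -> (N * h <= L)%N ->
  \sum_(i < N) Ps sym m (fun s => (L %| sumz s - (h * i)%N%:Z)%Z) <= 1.
Proof.
move=> L0 NL; rewrite -(Es_sum hS); last by move=> i; bdd.
rewrite -[leRHS](Es_cst hS m); apply: (Es_le hS) => [| |s _]; [by apply: bn_sum => i; bdd|bdd|].
have [[i hi]|none] := pselect (exists i : 'I_N, (L %| sumz s - (h * i)%N%:Z)%Z); last first.
  rewrite big1 ?ler01// => i _; case step_mean : (_ %| _)%Z => //.
  by exfalso; apply: none; exists i.
rewrite (bigD1 i)//= hi big1 ?addr0// => j ji; case hj : (_ %| _)%Z => //.
exfalso; have : (L%:Z %| (h * i)%N%:Z - (h * j)%N%:Z)%Z.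
  rewrite (_ : _ - _ = (sumz s - (h * j)%N%:Z) - (sumz s - (h * i)%N%:Z)); last by lia.
  exact: rpredB.
rewrite dvdzE /= => /dvdn_leq.
have ij : (i != j :> nat) by rewrite eq_sym; apply: contra ji => /eqP/val_inj ->.
have iN := ltn_ord i; have jN := ltn_ord j.
have hiN : (h * i + h <= N * h)%N by rewrite -mulnSr mulnC leq_mul.
have hjN : (h * j + h <= N * h)%N by rewrite -mulnSr mulnC leq_mul.
have : (h * i)%N != (h * j)%N by rewrite eqn_pmul2l.
by lia.
Qed.

(* The return probability differs little from the probabilities of the lattice
   points in a window of size [a m], and these sum up to at most 1. *)
Lemma sym_return_bound : exists2 B : R, 0 < B & forall m L, (0 < m)%N -> (0 < L)%N ->
  (forall i, (0 < i <= m)%N -> a i <= L%:R) -> a m * sym_return L m <= B.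
Proof.
have [C C1 [n0 Hn0]] := dominated_scaled.
(* With [2 C / D <= 1 / 6] and [a m < 3 a k], the term [sym_return L k] of the strong induction
   costs at most [B / 2]. *)
have [D HD] := nat_upper_bound (12 * C).
have D1 : 12 <= D%:R :> R by lra.
have D0 : (0 < D)%N by rewrite -(ltr_nat R); lra.
pose T : R := 8 * D%:R; have T0 : 0 < T by rewrite /T; lra.
have [n1 H1] := scale_lt T0.
have [n2 H2] := scale_lt (ltr0n R 3).
have [n3 _ H3] := scale_infty (2 * h%:R).
pose M := (n0 + n1 + n2 + n3 + 5)%N; pose M1 := (2 * D * M)%N.
pose B1 : R := \sum_(i < M1) `|a i|.
have B10 : 0 <= B1 by exact: sumr_ge0.
(* [B1] settles [m < M1], where the return probability is bounded by 1; the first summand is twice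
   the cost of the window, to go with the [B / 2] above. *)
pose B := 2 * (2 * h%:R * T) + B1 + 1.
have B0 : 0 < B by rewrite ltr_wpDl// addr_ge0// !mulr_ge0// ltW.
exists B => // m L m0 L0; elim/ltn_ind: m m0 => m IH m0 aL.
have am := a_gt0 m0.
have q0 := sym_return_ge0 L m.
have [mM|Mm] := ltnP m M1.
  apply: (@le_trans _ _ `|a m|).
    by rewrite (gtr0_norm am) ler_piMr ?(ltW am)// sym_return_le1.
  have : `|a m| <= B1 by rewrite /B1 (bigD1 (Ordinal mM))//= lerDl sumr_ge0.
  have : 0 <= 2 * (2 * h%:R * T) by rewrite !mulr_ge0// ltW.
  rewrite /B; lra.
pose m' := (m %/ D)%N; pose k := (m %/ 2)%N.
have Mm' : (M <= m')%N.
  by rewrite /m' leq_divRL//; apply: leq_trans Mm; rewrite /M1 mulnC leq_mul// leq_pmull.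
have m'D : (m' * D <= m)%N by exact: leq_trunc_div.
have mD : (m < m' * D + D)%N by rewrite -mulSnr; exact: ltn_ceil.
have M5 : (5 <= M)%N by rewrite /M leq_addl.
have Ds : (2 * M <= M1)%N by rewrite /M1 -mulnA leq_mul// leq_pmull.
have km : (k <= m)%N by exact: leq_div.
have k2 : (2 * k <= m <= 2 * k + 1)%N by rewrite /k; clear; lia.
have Mk : (M <= k)%N by move: Ds Mm k2; clear; lia.
have k0 : (0 < k)%N by move: Mk M5; clear; lia.
have ltkm : (k < m)%N by move: k2 k0; clear; lia.
have m'0 : (0 < m')%N by move: Mm' M5; clear; lia.
have am' := a_gt0 m'0.
have IHk : a k * sym_return L k <= B.
  by apply: IH => // i /andP[i0 ik]; apply: aL; rewrite i0 (leq_trans ik).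
have qk := sym_return_ge0 L k.
have mR : m%:R <= m'%:R * D%:R + D%:R :> R by rewrite -natrM -natrD ler_nat ltnW.
have m'R : 1 <= m'%:R :> R by rewrite ler1n.
have m'Dm : m'%:R * D%:R <= m%:R :> R by rewrite -natrM ler_nat.
have aT : a m < T * a m'.
  apply: H1.
  - by apply: leq_trans Mm'; rewrite /M; clear; lia.
  - by apply: leq_trans Mm; apply: leq_trans Ds; rewrite /M; clear; lia.
  have q1 : D%:R <= m'%:R * D%:R :> R by rewrite ler_peMl.
  have q2 : m'%:R * D%:R <= m'%:R * D%:R * D%:R :> R.
    by rewrite ler_peMr ?mulr_ge0//; lra.
  rewrite (_ : T ^+ 2 * m'%:R = 64 * (m'%:R * D%:R * D%:R)); last by rewrite /T; ring.
  lra.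
have a3 : a m < 3 * a k.
  apply: H2.
  - by apply: leq_trans Mk; rewrite /M; clear; lia.
  - by apply: leq_trans Mm; apply: leq_trans Ds; rewrite /M; clear; lia.
  have : m%:R <= 2 * k%:R + 1 :> R by rewrite -(natrM _ 2) natr1 ler_nat -addn1; case/andP: k2.
  have : 5 <= k%:R :> R by rewrite (ler_nat R 5) (leq_trans M5).
  lra.
have ah : 2 * h%:R < a m'.
  by apply: H3 => /=; apply: leq_trans Mm'; rewrite /M; clear; lia.
pose N := Num.truncn (a m' / h%:R).
have /andP[N1 N2] : N%:R <= a m' / h%:R < N.+1%:R.
  by apply: truncn_itv; rewrite divr_ge0// ltW.
rewrite ler_pdivlMr// in N1; rewrite ltr_pdivrMr// in N2.
have NhL : (N * h <= L)%N.
  rewrite -(ler_nat R) natrM; apply: le_trans N1 _; apply: aL.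
  by rewrite m'0 leq_div.
have Nbig : a m' <= 2 * h%:R * N%:R by move: N2; rewrite -(natr1 N); lra.
have eqk : 0 <= 2 * C / D%:R * sym_return L k by rewrite mulr_ge0// divr_ge0//; lra.
have flat (i : 'I_N) : sym_return L m - 2 * C / D%:R * sym_return L k <=
    Ps sym m (fun s => (L %| sumz s - (h * i)%N%:Z)%Z).
  have hyp : forall th : R, 1 - cos (th * (h * i)%N%:Z%:~R) <= C * (m'%:R * (1 - rho th)).
    apply: Hn0.
    - by apply: leq_trans Mm'; rewrite /M; clear; lia.
    - by rewrite PoszM dvdz_mulr.
    - rewrite -pmulrn ger0_norm//; apply: le_trans N1; rewrite -natrM ler_nat mulnC.
      by rewrite leq_mul// ltnW.
  have C00 : 0 <= C by lra.
  have := sym_return_flat L0 km C00 hyp; set Q := Ps _ _ _ => fl.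
  have mk : m%:R / 2 <= (m - k)%:R :> R.
    by rewrite ler_pdivrMr// -natrM ler_nat; move: k2; clear; lia.
  have [neg|pos] := leP (sym_return L m - Q) 0; first by lra.
  have f1 : m%:R / 2 * (sym_return L m - Q) <= C * m'%:R * sym_return L k.
    by apply: le_trans fl; rewrite ler_pM2r.
  have f2 : C * sym_return L k * (m'%:R * D%:R) <= C * sym_return L k * m%:R.
    by rewrite ler_wpM2l// mulr_ge0.
  have f3 : m%:R * (D%:R * (sym_return L m - Q)) <= m%:R * (2 * C * sym_return L k).
    have := ler_wpM2l (ler0n R D) f1; lra.
  have mp : 0 < m%:R :> R by rewrite ltr0n.
  rewrite ler_pM2l// in f3.
  have : sym_return L m - Q <= 2 * C / D%:R * sym_return L k.
    have e1 : D%:R * (2 * C / D%:R * sym_return L k) = 2 * C * sym_return L k.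
      by field; rewrite pnatr_eq0 -lt0n.
    by rewrite -(@ler_pM2l _ D%:R) ?ltr0n// e1.
  lra.
have tot : N%:R * (sym_return L m - 2 * C / D%:R * sym_return L k) <= 1.
  apply: le_trans (sym_return_disjoint m L0 NhL).
  have -> : N%:R * (sym_return L m - 2 * C / D%:R * sym_return L k) =
     \sum_(i < N) (sym_return L m - 2 * C / D%:R * sym_return L k) by rewrite sumr_const card_ord mulr_natl.
  by apply: ler_sum => i _; exact: flat.
have CD : 2 * C / D%:R <= 6^-1.
  by rewrite ler_pdivrMr ?ltr0n//; lra.
set z := sym_return L m - _ in tot.
have zb : a m * z <= 2 * h%:R * T.
  have [z0|z0] := leP z 0.
    apply: (@le_trans _ _ 0); first by rewrite mulr_ge0_le0// ltW.
    by rewrite !mulr_ge0// ltW.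
  apply: (@le_trans _ _ (T * a m' * z)); first by rewrite ler_pM2r// ltW.
  apply: (@le_trans _ _ (T * (2 * h%:R * N%:R) * z)).
    by rewrite ler_pM2r// ler_pM2l.
  rewrite (_ : T * (2 * h%:R * N%:R) * z = 2 * h%:R * T * (N%:R * z)); last by ring.
  by rewrite ler_piMr// !mulr_ge0// ltW.
have : a m * (2 * C / D%:R * sym_return L k) <= 2^-1 * B.
  apply: (@le_trans _ _ (3 * a k * (6^-1 * sym_return L k))).
    by apply: ler_pM => //; [exact: ltW|exact: ltW|exact: ler_wpM2r].
  lra.
have -> : a m * sym_return L m = a m * z + a m * (2 * C / D%:R * sym_return L k) by rewrite /z; ring.
rewrite /B; lra.
Qed.

End local_limit.

(** * Upper and lower local bounds *)

Section local_bounds.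
Context {R : realType}.
Variable E : (int -> R) -> R.
Hypothesis hE : averaging E.
Let hS := averaging_sym hE.
Local Notation sym := (sym E).
Local Notation rho := (rho E).
Local Notation Pr := (Ps E).
Variable a : nat -> R.
Hypothesis a_gt0 : forall n, (0 < n)%N -> 0 < a n.
Hypothesis scale_gt : forall t, 0 < t -> exists n0, forall n m, (n0 <= n)%N -> (n0 <= m)%N ->
  4 * t ^+ 2 * n%:R <= m%:R -> t * a n < a m.
Hypothesis scale_lt : forall t, 0 < t -> exists n0, forall n m, (n0 <= n)%N -> (n0 <= m)%N ->
  4 * m%:R <= t ^+ 2 * n%:R -> a m < t * a n.
Hypothesis scale_infty : forall B, \forall n \near \oo, B < a n.
Hypothesis rho_quad : \forall m \near \oo, forall th : R, `|th| <= (a m)^-1 ->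
  3 / 16 * (th * a m) ^+ 2 <= m%:R * (1 - rho th).
Variable h : nat.
Hypothesis h0 : (0 < h)%N.
Hypothesis Dh : dominated E h.
Hypothesis hnull : sym (fun z => (~~ (h %| z)%Z)%:R) = 0.

Hypothesis mass : forall K : R, 0 < K -> exists2 g : R, 0 < g & forall al be : R,
  - K <= al -> al < be -> be <= K -> \forall n \near \oo,
  g * (be - al) <= Pr n (fun s => al * a n <= (sumz s)%:~R <= be * a n).

Let hR : 0 < h%:R :> R. Proof. by rewrite ltr0n. Qed.

Lemma cauchy2 (A B c s r : R) : 0 <= r ->
  (A ^+ 2 + B ^+ 2) * (c ^+ 2 + s ^+ 2) <= r ^+ 2 -> `|A * c + B * s| <= r.
Proof.
move=> r0 H; rewrite -(ler_pXn2r (ltn0Sn 1)) ?nnegrE// real_normK ?num_real//.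
apply: le_trans H; have := sqr_ge0 (A * s - B * c); lra.
Qed.

Lemma prob_mod L n (x : int) : (0 < L)%N ->
  Pr n (fun s => (L %| sumz s - x)%Z) =
  avg L (fun t => Es E n (fun s => cos (t * (sumz s)%:~R)) * cos (t * x%:~R) +
                  Es E n (fun s => sin (t * (sumz s)%:~R)) * sin (t * x%:~R)).
Proof.
move=> L0; rewrite /Ps (@Es_ext _ _ _ _
  (fun s => L%:R^-1 * \sum_(j < L) cos (freq L j * (sumz s - x)%:~R))); last first.
  by move=> s _; rewrite -(avg_cos _ L0).
rewrite (EsZ hE); last by apply: bn_sum => i; bdd.
congr (_ * _); rewrite (Es_sum hE); last by move=> i; bdd.
apply: eq_bigr => j _; set t := freq L j.
rewrite (@Es_ext _ _ _ _ (fun s => cos (t * x%:~R) * cos (t * (sumz s)%:~R) +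
   sin (t * x%:~R) * sin (t * (sumz s)%:~R))); last first.
  by move=> s _; rewrite intrB mulrBr cosB; ring.
rewrite (EsD hE); [|bdd..]; rewrite !(EsZ hE); [|bdd..].
by rewrite mulrC [X in _ + X]mulrC.
Qed.

(** The squared modulus of the characteristic function of a step is [rho], so [2 k] steps yield the
    factor [rho ^ k] at each frequency. *)
Lemma prob_mod_le L n k x : (0 < L)%N -> (2 * k <= n)%N ->
  Pr n (fun s => (L %| sumz s - x)%Z) <= sym_return E L k.
Proof.
move=> L0 kn; rewrite prob_mod//; apply: avg_le => t.
apply: le_trans (ler_norm _) _; have r0 := rho_ge0 hE t.
apply: cauchy2; first exact: exprn_ge0.
rewrite cos2Dsin2 mulr1 (rho_exp hE) -exprM.
by apply: ler_wiXn2l => //; [exact: rho_le1|rewrite mulnC].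
Qed.

(** By Cauchy-Schwarz a frequency contributes at most the square root of
    [rho ^ n * 2 (1 - cos (t y))]. The hypothesis on [y] replaces the cosine term by [1 - rho],
    which [rho_gap] absorbs while keeping [rho ^ (2 k)]. *)
Lemma prob_mod_smooth (C e : R) L n k m' (x y : int) : (0 < L)%N -> (4 * k <= n)%N -> (0 < n)%N ->
  0 <= C -> 0 <= e -> 4 * C * m'%:R <= e ^+ 2 * n%:R ->
  (forall th : R, 1 - cos (th * y%:~R) <= C * (m'%:R * (1 - rho th))) ->
  `|Pr n (fun s => (L %| sumz s - x)%Z) - Pr n (fun s => (L %| sumz s - (x + y))%Z)|
    <= e * sym_return E L k.
Proof.
move=> L0 kn n0 C0 e0 Ce H; rewrite !prob_mod// -mulN1r -avgZ -avgD.
apply: le_trans (avg_norm _ _) _; rewrite -avgZ; apply: avg_le => t.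
have r0 := rho_ge0 hE t; have r1 := rho_le1 hE t.
set A := Es E n _; set B := Es E n _.
rewrite [X in `|X|](_ : _ = A * (cos (t * x%:~R) - cos (t * (x + y)%:~R)) +
   B * (sin (t * x%:~R) - sin (t * (x + y)%:~R))); last by ring.
apply: cauchy2; first by rewrite mulr_ge0// exprn_ge0.
rewrite (rho_exp hE).
set cx := cos _; set cy := cos _; set sx := sin _; set sy := sin _.
have -> : (cx - cy) ^+ 2 + (sx - sy) ^+ 2 = 2 * (1 - cos (t * y%:~R)).
  have -> : cos (t * y%:~R) = cy * cx + sy * sx.
    by rewrite -cosB; congr cos; rewrite intrD; ring.
  have := cos2Dsin2 (t * x%:~R); have := cos2Dsin2 (t * (x + y)%:~R).
  by rewrite -/cx -/cy -/sx -/sy; lra.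
have k2n : (k * 2 <= n)%N by lia.
have gap := rho_gap hE t k2n.
have nk : n%:R / 2 <= (n - k * 2)%:R :> R.
  by rewrite ler_pdivrMr// -natrM ler_nat; lia.
have nR : 0 < n%:R :> R by rewrite ltr0n.
rewrite exprMn -exprM.
have p0 : 0 <= rho t ^+ n by exact: exprn_ge0.
have p1 : 0 <= rho t ^+ n * (1 - rho t) by rewrite mulr_ge0// subr_ge0.
have pk : 0 <= rho t ^+ (k * 2) by exact: exprn_ge0.
have g1 : n%:R / 2 * (rho t ^+ n * (1 - rho t)) <= rho t ^+ (k * 2).
  by apply: le_trans gap; exact: ler_wpM2r.
rewrite -(ler_pM2l nR).
apply: (@le_trans _ _ (n%:R * (rho t ^+ n * (2 * (C * (m'%:R * (1 - rho t))))))).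
  by rewrite ler_pM2l// ler_wpM2l// ler_pM2l.
apply: (@le_trans _ _ (4 * C * m'%:R * rho t ^+ (k * 2))).
  rewrite (_ : _ * _ = 4 * C * m'%:R * (n%:R / 2 * (rho t ^+ n * (1 - rho t)))); last by field.
  by rewrite ler_wpM2l// !mulr_ge0.
by rewrite mulrA (mulrC n%:R) ler_wpM2r.
Qed.

Lemma sumz_tight n (e : R) : 0 < e -> exists L1 : nat, forall L, (L1 <= L)%N ->
  Pr n (fun s => (L < `|sumz s|)%N) <= e.
Proof.
move=> e0; have n0 : 0 < n.+1%:R :> R by [].
have [L HL] := ex_tight hE (divr_gt0 e0 n0).
exists (n * L)%N => L' LL'.
have hq : (fun z : int => (L < `|z|)%N%:R) = (fun z => (~~ (`|z| <= L)%N)%:R) :> (int -> R).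
  by apply/funext => z; rewrite ltnNge.
apply: (@le_trans _ _ (n%:R * E (fun z => (L < `|z|)%N%:R))); last first.
  have E0 : 0 <= E (fun z => (L < `|z|)%N%:R).
    by rewrite -[leLHS](ex_cst hE); apply: (ex_le hE) => [||z]; [bdd..|]; case: (_ < _)%N.
  apply: (@le_trans _ _ (n.+1%:R * E (fun z => (L < `|z|)%N%:R))).
    by rewrite ler_wpM2r// ler_nat.
  by move: HL; rewrite ler_pdivlMr// mulrC.
rewrite hq; apply: le_trans (Ps_not_all hE n (fun z => (`|z| <= L)%N)).
apply: (Ps_le hE) => s sn; apply: contraTN => /allP sL; rewrite -leqNgt.
apply: leq_trans LL'; rewrite -sn.
elim: s sL {sn} => [|z s IHs] sL; first by rewrite sumz_nil.
rewrite sumz_cons [size _]/= mulSn.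
have := IHs (fun w ws => sL w (@mem_behead _ (z :: s) _ ws)).
by have := sL z (mem_head _ _); lia.
Qed.

Let big_modulus m : exists L : nat, forall i, (i <= m)%N -> a i <= L%:R.
Proof.
have [L HL] := nat_upper_bound (\sum_(i < m.+1) `|a i|).
exists L => i im; apply: le_trans HL; apply: le_trans (ler_norm _) _.
by rewrite (bigD1 (Ordinal (im : (i < m.+1)%N)))//= lerDl sumr_ge0.
Qed.

Lemma local_upper : exists2 C0 : R, 0 < C0 & \forall n \near \oo, forall x : int,
  Pr n (fun s => sumz s == x) <= C0 / a n.
Proof.
have [B B0 HB] := sym_return_bound hE a_gt0 scale_lt scale_infty rho_quad h0 Dh hnull.
have [n1 H1] := scale_lt (ltr0n R 3).
exists (3 * B); first by rewrite mulr_gt0.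
exists (2 * n1 + 10)%N => // n /= nb x.
pose k := (n %/ 2)%N; have kb : (n1 + 5 <= k)%N by rewrite /k; lia.
have k0 : (0 < k)%N by lia. have n0 : (0 < n)%N by lia.
have k2 : (2 * k <= n <= 2 * k + 1)%N by rewrite /k; clear; lia.
have ak := a_gt0 k0; have an := a_gt0 n0.
have a3 : a n < 3 * a k.
  apply: H1; [lia|lia|].
  have : n%:R <= 2 * k%:R + 1 :> R by rewrite -(natrM _ 2) natr1 ler_nat -addn1; case/andP: k2.
  have : 5 <= k%:R :> R by rewrite (ler_nat R 5); lia.
  lra.
have [L HL] := big_modulus k.
have L0 : (0 < L.+1)%N by [].
have qb : a k * sym_return E L.+1 k <= B.
  apply: HB => // i /andP[_ ik]; apply: le_trans (HL i ik) _; by rewrite ler_nat.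
apply: (@le_trans _ _ (Pr n (fun s => (L.+1 %| sumz s - x)%Z))).
  by apply: (Ps_le hE) => s _ /eqP ->; rewrite subrr dvdz0.
have kn : (2 * k <= n)%N by case/andP: k2.
apply: le_trans (prob_mod_le x L0 kn) _.
rewrite ler_pdivlMr//; have := sym_return_ge0 hE L.+1 k => q0.
have : sym_return E L.+1 k * a n <= sym_return E L.+1 k * (3 * a k) by rewrite ler_wpM2l// ltW.
lra.
Qed.

(** The difference of two independent copies of the walk lies in [h Z] almost surely, and one copy
    is at [x] with positive probability, independently of the other. *)
Lemma support n (x : int) : 0 < Pr n (fun s => sumz s == x) ->
  Pr n (fun s => ~~ (h %| sumz s - x)%Z) = 0.
Proof.
move=> px.
have s0 : Ps sym n (fun s => ~~ (h %| sumz s)%Z) = 0.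
  apply/eqP; rewrite eq_le Ps_ge0// andbT.
  have := Ps_not_all hS n (fun z => (h %| z)%Z); rewrite hnull mulr0; apply: le_trans.
  apply: (Ps_le hS) => s _; apply: contra => /allP H.
  by rewrite /sumz big_seq; apply: rpred_sum => z zs; exact: H.
have p1 := Ps_ge0 hE n (fun s => ~~ (h %| sumz s - x)%Z).
have : Pr n (fun s => ~~ (h %| sumz s - x)%Z) * Pr n (fun s => sumz s == x) <= 0.
  rewrite -s0 /Ps (Es_sym hE n (f := fun y => (~~ (h %| y)%Z)%:R)); last by bdd.
  rewrite -(Es_indep hE); [|bdd..]; apply: (Es_le hE).
  - apply: (bn_Es hE); exists 1 => s t _ _.
    by case: (_ %| _)%Z; case: (_ == _); rewrite /= ?mulr0 ?mul0r ?mulr1 ?normr0 ?normr1.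
  - by apply: (bn_Es hE); exists 1 => s t _ _; case: (_ %| _)%Z; rewrite /= ?normr0 ?normr1.
  move=> s _; apply: (Es_le hE); [bdd..|] => t _.
  by have [->|_] := eqVneq (sumz t) x; rewrite ?mulr1 ?mulr0.
by move=> H; apply/eqP; rewrite eq_le p1 andbT -(ler_pM2r px) mul0r.
Qed.

(** [A] is fixed before [dl], so that the change over a window of width [dl a n] can be made a small
    part of [1 / a n]. *)
Lemma local_smooth : exists2 A : R, 0 < A & forall dl : R, 0 < dl -> dl <= 1 ->
  \forall n \near \oo, forall x y : int, (h %| y)%Z -> `|y%:~R| <= dl * a n ->
  Pr n (fun s => sumz s == x + y) <= Pr n (fun s => sumz s == x) + A * dl / a n.
Proof.
have [B B0 HB] := sym_return_bound hE a_gt0 scale_lt scale_infty rho_quad h0 Dh hnull.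
have [C C1 [n0 Hn0]] := dominated_scaled hE a_gt0 scale_lt rho_quad h0 Dh hnull.
have [n1 H1] := scale_lt (ltr0n R 5).
exists (6 * C * 5 * B); first by rewrite !mulr_gt0//; lra.
move=> dl dl0 dl1.
have [n2 H2] := scale_gt dl0.
have [n3 H3] := nat_upper_bound ((n0 + n2 + 1)%:R / (4 * dl ^+ 2)).
have d2 : 0 < dl ^+ 2 by rewrite exprn_gt0.
exists (4 * n1 + n2 + n3 + 100)%N => // n /= nb x y hy yn.
have nn : (0 < n)%N by move: nb; clear; lia.
have an := a_gt0 nn.
have nR3 : (n0 + n2 + 1)%:R <= 4 * dl ^+ 2 * n%:R.
  move: H3; rewrite ler_pdivrMr ?mulr_gt0// => H3; apply: le_trans H3 _.
  by rewrite mulrC ler_pM2l ?mulr_gt0// ler_nat; move: nb; clear; lia.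
(* After about [4 dl ^ 2 n] steps the scale [a m'] exceeds [dl a n], so the shift is admissible in
   [dominated_scaled] at time [m']. *)
pose m' := (Num.truncn (4 * dl ^+ 2 * n%:R)).+1.
have /andP[t1 t2] : (Num.truncn (4 * dl ^+ 2 * n%:R))%:R <= 4 * dl ^+ 2 * n%:R < m'%:R.
  by apply: truncn_itv; rewrite !mulr_ge0// ltW.
have m'b : (n0 + n2 + 1 <= m')%N.
  by rewrite -(ler_nat R); lra.
have m'R : m'%:R <= 8 * dl ^+ 2 * n%:R.
  have : m'%:R = (Num.truncn (4 * dl ^+ 2 * n%:R))%:R + 1 :> R by rewrite natr1.
  have : 1 <= (n0 + n2 + 1)%:R :> R by rewrite ler1n addn1.
  lra.
clearbody m'; clear t1.
have am' : dl * a n < a m'.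
  apply: H2; [by move: nb; clear; lia|by move: m'b; clear; lia|exact: ltW].
have m'n0 : (n0 <= m')%N by move: m'b; clear; lia.
(* As [m' <= 8 dl ^ 2 n], the requirement [4 C m' <= e ^ 2 n] follows from [32 C <= 36 C ^ 2]. *)
pose e := 6 * C * dl.
have e0 : 0 < e by rewrite !mulr_gt0//; lra.
pose k := (n %/ 4)%N.
have k4 : (4 * k <= n <= 4 * k + 3)%N by rewrite /k; clear; lia.
have kb : (n1 + 24 <= k)%N by move: nb k4; clear; lia.
have k0 : (0 < k)%N by move: kb; clear; lia.
have ak := a_gt0 k0.
have a5 : a n < 5 * a k.
  apply: H1; [by move: kb; clear; lia|by move: nb; clear; lia|].
  have : n%:R <= 4 * k%:R + 3 :> R by rewrite -(natrM _ 4) -natrD ler_nat; case/andP: k4.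
  have : 24 <= k%:R :> R by rewrite (ler_nat R 24); move: kb; clear; lia.
  lra.
rewrite -lerBlDl; apply/ler_addgt0Pr => eta eta0.
have [L1 HL1] := sumz_tight n eta0.
have [L2 HL2] := big_modulus k.
(* A path that ends in [[-L1, L1]] and is congruent to [x] modulo [L] ends at [x]; [L2] dominates
   the scales that [sym_return_bound] asks for. *)
pose L := (L1 + L2 + `|x| + 1)%N.
have L0 : (0 < L)%N by rewrite /L addn1.
have C0 : 0 <= C by lra.
have hyp : forall th : R, 1 - cos (th * y%:~R) <= C * (m'%:R * (1 - rho th)).
  by apply: Hn0 => //; apply: le_trans yn _; exact: ltW.
have Ce : 4 * C * m'%:R <= e ^+ 2 * n%:R.
  have Cm : C * m'%:R <= C * (8 * dl ^+ 2 * n%:R) by rewrite ler_wpM2l.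
  have CC : C * (dl ^+ 2 * n%:R) <= C * C * (dl ^+ 2 * n%:R).
    by apply: ler_wpM2r; [rewrite mulr_ge0// ltW|rewrite ler_peMl].
  rewrite (_ : e ^+ 2 * n%:R = 36 * (C * C * (dl ^+ 2 * n%:R))); last by rewrite /e; ring.
  have : 0 <= C * (dl ^+ 2 * n%:R) by rewrite !mulr_ge0// ltW.
  lra.
have kn : (4 * k <= n)%N by case/andP: k4.
have := prob_mod_smooth x L0 kn nn C0 (ltW e0) Ce hyp.
rewrite ler_norml => /andP[sm _].
have qb : a k * sym_return E L k <= B.
  apply: HB => // i /andP[_ ik]; apply: le_trans (HL2 i ik) _.
  by rewrite ler_nat /L; clear; lia.
have l1 : Pr n (fun s => sumz s == x + y) <= Pr n (fun s => (L %| sumz s - (x + y))%Z).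
  by apply: (Ps_le hE) => s _ /eqP ->; rewrite subrr dvdz0.
have l2 : Pr n (fun s => (L %| sumz s - x)%Z) <=
    Pr n (fun s => sumz s == x) + Pr n (fun s => (L1 < `|sumz s|)%N).
  apply: le_trans (Ps_or hE _ _ _); apply: (Ps_le hE) => s _ Ls.
  have [//|sx] /= := eqVneq (sumz s) x.
  rewrite ltnNge; apply/negP => sL; move: Ls; rewrite dvdzE /= => /dvdn_leq.
  have : sumz s - x != 0 by rewrite subr_eq0.
  by move: sL; rewrite /L; clear; lia.
have l3 := HL1 L1 (leqnn _).
have q0 := sym_return_ge0 hE L k.
have : e * sym_return E L k <= 6 * C * 5 * B * dl / a n.
  rewrite ler_pdivlMr// (_ : 6 * C * 5 * B * dl = e * (5 * B)); last by rewrite /e; ring.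
  rewrite -mulrA ler_pM2l//.
  have : sym_return E L k * a n <= sym_return E L k * (5 * a k) by rewrite ler_wpM2l// ltW.
  lra.
lra.
Qed.

(* A point of mass far below [1 / a n] would, by [local_smooth], force a whole
   window around it to have less mass than the normal law gives it. *)
Lemma local_lower eps : 0 < eps -> exists2 c : R, 0 < c & \forall n \near \oo, forall x : int,
  eps <= x%:~R / a n <= eps^-1 -> 0 < Pr n (fun s => sumz s == x) ->
  c / a n <= Pr n (fun s => sumz s == x).
Proof.
move=> eps0.
pose K := eps^-1 + 1; have K0 : 0 < K by rewrite addr_gt0// invr_gt0.
have [g g0 Hg] := mass K0.
have [A A0 HA] := local_smooth.
(* The window around [x] will give [g h / 6 <= a n P(S_n = x) + A dl], and [A dl] takes at most half
   of the left-hand side. *)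
pose dl := Num.min 1 (g * h%:R / (12 * A)).
have dl0 : 0 < dl by rewrite lt_min ltr01 divr_gt0// ?mulr_gt0.
have dl1 : dl <= 1 by rewrite ge_min lexx.
have dlA : A * dl <= g * h%:R / 12.
  have : dl <= g * h%:R / (12 * A) by rewrite ge_min lexx orbT.
  by rewrite ler_pdivlMr ?mulr_gt0//; lra.
clearbody dl.
pose w := dl / 3; have w0 : 0 < w by rewrite divr_gt0.
exists (g * h%:R / 12); first by rewrite !mulr_gt0.
(* [mass] treats one fixed interval at a time. A finite grid of mesh [dl / 3] makes it uniform: the
   cell after the one of [x / a n] lies within distance [dl] to its right. *)
have grid I : \forall n \near \oo, forall i, (i < I)%N -> i.+1%:R * w <= K ->
    g * w <= Pr n (fun s => i%:R * w * a n <= (sumz s)%:~R <= i.+1%:R * w * a n).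
  elim: I => [|I IHI]; first by near=> n.
  have [IK|IK] := leP (I.+1%:R * w) K; last first.
    move: IHI; apply: filterS => n H i; rewrite ltnS leq_eqVlt => /orP[/eqP ->|iI]; last exact: H.
    by rewrite leNgt IK.
  have IK1 : - K <= I%:R * w by rewrite (le_trans (_ : _ <= 0))// ?oppr_le0 ?mulr_ge0// ltW.
  have Iw : I%:R * w < I.+1%:R * w by rewrite ltr_pM2r// ltr_nat.
  have := Hg _ _ IK1 Iw IK.
  move: IHI; apply: filterS2 => n H H' i; rewrite ltnS leq_eqVlt => /orP[/eqP -> _|iI]; last exact: H.
  by apply: le_trans H'; rewrite -mulrBl -natrB// subSnn mul1r.
have [I HI] := nat_upper_bound (K / w + 2).
have HAn := HA dl dl0 dl1.
have Gn := grid I.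
near=> n.
have n0 : (0 < n)%N by near: n; exact: nbhs_infty_gt.
have an := a_gt0 n0.
have ah : h%:R / dl < a n by near: n; exact: scale_infty.
have sm : forall x y : int, (h %| y)%Z -> `|y%:~R| <= dl * a n ->
  Pr n (fun s => sumz s == x + y) <= Pr n (fun s => sumz s == x) + A * dl / a n by near: n.
have gr : forall i, (i < I)%N -> i.+1%:R * w <= K ->
    g * w <= Pr n (fun s => i%:R * w * a n <= (sumz s)%:~R <= i.+1%:R * w * a n) by near: n.
move=> x /andP[x1 x2] px.
have x0 : 0 <= x%:~R / a n :> R by apply: le_trans x1; exact: ltW.
have wa : 0 < w * a n by rewrite mulr_gt0.
pose i := Num.truncn (x%:~R / a n / w).
have /andP[i1 i2] : i%:R <= x%:~R / a n / w < i.+1%:R.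
  by apply: truncn_itv; rewrite divr_ge0// ltW.
clearbody i.
rewrite ler_pdivlMr// in i1; rewrite ltr_pdivrMr// in i2.
have w3 : w * 3 = dl by rewrite /w divfK.
have iK : i.+2%:R * w <= K.
  by rewrite -(natr1 i.+1) -(natr1 i) /K; lra.
have iI : (i.+1 < I)%N.
  rewrite -(ltr_nat R); apply: lt_le_trans HI; rewrite -(natr1 i).
  rewrite -(@ltr_pM2r _ w)// (_ : (K / w + 2) * w = K + 2 * w); last by field; rewrite gt_eqF.
  by rewrite /K; lra.
have := gr i.+1 iI iK.
pose J := Num.truncn (dl * a n / h%:R).
have /andP[J1 J2] : J%:R <= dl * a n / h%:R < J.+1%:R.
  by apply: truncn_itv; rewrite !mulr_ge0// ?invr_ge0// ltW.
clearbody J.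
rewrite ler_pdivlMr// in J1; rewrite ltr_pdivrMr// in J2.
set P1 := Pr n _ => H1.
have ub : P1 <= J.+1%:R * (Pr n (fun s => sumz s == x) + A * dl / a n).
  apply: (@le_trans _ _ (Pr n (fun s => [exists j : 'I_J.+1, sumz s == x + (h * j)%N%:Z] ||
      ~~ (h %| sumz s - x)%Z))).
    apply: (Ps_le hE) => s _ /andP[s1 s2].
    case hs: (h %| sumz s - x)%Z; last by rewrite orbT.
    rewrite orbF.
    have sx : x%:~R <= (sumz s)%:~R :> R.
      by apply: le_trans s1; rewrite -ler_pdivrMr// ltW.
    have sx2 : (sumz s)%:~R <= x%:~R + dl * a n :> R.
      apply: le_trans s2 _; rewrite -(natr1 i.+1) -(natr1 i).
      have : i%:R * w * a n <= x%:~R by rewrite -ler_pdivlMr.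
      have : 0 < w * a n by [].
      rewrite -w3; lra.
    rewrite ler_int in sx.
    move: hs => /dvdzP[q qE].
    have q0 : 0 <= q.
      have : 0 <= q * h by rewrite -qE subr_ge0.
      by rewrite pmulr_lge0// ltz_nat.
    have qJ : (absz q < J.+1)%N.
      rewrite -(ltr_nat R) -(@ltr_pM2r _ h%:R)//; apply: le_lt_trans J2.
      have : (absz q)%:R * h%:R = (sumz s - x)%:~R :> R.
        by rewrite qE intrM -(gez0_abs q0) -!pmulrn.
      by move=> ->; rewrite intrB; lra.
    apply/existsP; exists (Ordinal qJ); apply/eqP => /=.
    by rewrite PoszM gez0_abs// mulrC -qE addrC subrK.
  apply: le_trans (Ps_or hE _ _ _) _; rewrite (support px) addr0.
  apply: le_trans (Ps_has hE _ _ (fun j s => sumz s == x + (h * j)%N%:Z)) _.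
  apply: (@le_trans _ _ (\sum_(j < J.+1) (Pr n (fun s => sumz s == x) + A * dl / a n))).
    apply: ler_sum => j _; apply: sm; first by rewrite PoszM dvdz_mulr.
    rewrite -pmulrn ger0_norm//; apply: le_trans J1; rewrite -natrM ler_nat mulnC.
    by rewrite leq_mul// -ltnS.
  by rewrite sumr_const card_ord mulr_natl.
have hd : h%:R < dl * a n by move: ah; rewrite ltr_pdivrMr// mulrC.
have J3 : J.+1%:R * h%:R <= 2 * (dl * a n) by rewrite -(natr1 J); lra.
set p := Pr n (fun s => sumz s == x) in px ub *.
have q0 : 0 <= p + A * dl / a n by rewrite addr_ge0 ?ltW// divr_gt0// mulr_gt0.
have H2 : g * w * h%:R <= 2 * (dl * a n) * (p + A * dl / a n).
  apply: (@le_trans _ _ (J.+1%:R * h%:R * (p + A * dl / a n))); last by rewrite ler_wpM2r.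
  rewrite [leRHS]mulrAC ler_pM2r//; apply: le_trans H1 ub.
have e1 : 2 * (dl * a n) * (p + A * dl / a n) = 2 * dl * (p * a n + A * dl).
  by field; rewrite gt_eqF.
rewrite e1 (_ : g * w * h%:R = 2 * dl * (g * h%:R / 6)) in H2; last by rewrite /w; field.
rewrite ler_pM2l ?mulr_gt0// in H2.
rewrite ler_pdivrMr//; lra.
Unshelve. all: by end_near. Qed.

End local_bounds.

(** * Asymptotics for the abstract walk *)

Section block_estimates.
Context {R : realType}.
Variable E : (int -> R) -> R.
Hypothesis hE : averaging E.
Local Notation Pr := (Ps E).
Local Notation V := (Vlim E).
Variable a : nat -> R.
Hypothesis a_gt0 : forall n, (0 < n)%N -> 0 < a n.
Hypothesis scale_lt : forall t, 0 < t -> exists n0, forall n m, (n0 <= n)%N -> (n0 <= m)%N ->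
  4 * m%:R <= t ^+ 2 * n%:R -> a m < t * a n.
Hypothesis scale_infty : forall B, \forall n \near \oo, B < a n.
Hypothesis max_tail : forall e : R, 0 < e -> exists2 L : R, 0 < L &
  \forall n \near \oo, Pr n (fun s => L * a n < (mx s)%:~R) <= e.
Hypothesis V_linear : forall B (e : R), 0 < e -> exists x0, forall x z, (x0 <= x)%N ->
  (z <= B * x)%N -> `|V z - z%:R / x%:R * V x| <= e * V x.
Variable eps : R.
Hypothesis eps0 : 0 < eps.

Let block n m (x : nat) := [/\ (n <= 4 * m)%N, (m <= n)%N & eps * a n <= x%:R].

Let max_block e : 0 < e -> exists (b n0 : nat), forall n m x, (n0 <= n)%N -> block n m x ->
  Pr m (fun s => (b * x)%N%:Z <= mx s) <= e.
Proof.
move=> e0; have [L L0 [n1 _ H1]] := max_tail e0.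
have [n2 H2] := scale_lt (ltr0n R 3).
have [b Hb] := nat_upper_bound (3 * L / eps + 1).
exists b, (4 * (n1 + n2 + 1))%N => n m x nn [n4m mn xn].
have nm : (n1 + n2 + 1 <= m)%N by move: nn n4m; clear; lia.
have am : 0 < a m by apply: a_gt0; move: nm; clear; lia.
have am3 : a m < 3 * a n.
  apply: H2; [by move: nm mn; clear; lia|by move: nm; clear; lia|].
  have : m%:R <= n%:R :> R by rewrite ler_nat.
  have : 0 <= n%:R :> R by []. lra.
have /= h1 := H1 m ltac:(rewrite /=; move: nm; clear; lia).
apply: le_trans h1; apply: (Ps_le hE) => s _.
rewrite -(ler_int R) => bx; apply: lt_le_trans bx; rewrite -pmulrn natrM.
have b1 : 3 * L / eps < b%:R by lra.
rewrite ltr_pdivrMr// in b1.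
have bR : 0 <= b%:R :> R by [].
have h2 : b%:R * (eps * a n) <= b%:R * x%:R by rewrite ler_wpM2l.
have h3 : L * a m < L * (3 * a n) by rewrite ltr_pM2l.
have an : 0 < a n by lra.
have : 3 * L * a n < b%:R * eps * a n by rewrite ltr_pM2r.
lra.
Qed.

(** With probability at least 1/2 the maximum of the block stays below [b x], so [Lam_le] bounds
    [Lam] by the renewal function at [b x + 1], and subadditivity brings this back to [V x]. *)
Lemma Lam_block : exists (c : R) (n0 : nat), 0 < c /\ forall n m x, (n0 <= n)%N ->
  block n m x -> Lam E m <= c * V x.
Proof.
have [b [n0 H]] := max_block (@divr_gt0 R 1 2 ltr01 (ltr0n R 2)).
exists (2 * b.+1%:R), (maxn n0 1); split; first by rewrite mulr_gt0.
move=> n m x nn blk.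
have := H n m x ltac:(by move: nn; clear; lia) blk.
rewrite mul1r => h.
have h1 : Pr m (fun s => (b * x).+1%:Z - 1 < mx s) <= 2^-1.
  have [n4m mn xn] := blk.
  have x0 : (0 < x)%N.
    rewrite -(ltr_nat R); apply: lt_le_trans xn; rewrite mulr_gt0// a_gt0//.
    by move: nn; clear; lia.
  apply: le_trans h; apply: (Ps_le hE) => s _.
  have -> : (b * x).+1%:Z - 1 = (b * x)%N by clear; lia.
  exact: ltW.
apply: le_trans (Lam_le hE h1) _; rewrite -mulrA ler_pM2l//.
apply: le_trans (Vn_le_V hE _ _) _.
have xV : ((b * x).+1 <= b.+1 * x)%N.
  have [n4m mn xn] := blk.
  have x0 : (0 < x)%N.
    rewrite -(ltr_nat R); apply: lt_le_trans xn; rewrite mulr_gt0// a_gt0//.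
    by move: nn; clear; lia.
  by clear - x0; nia.
apply: le_trans (V_mono hE xV) _.
have := subadditiveM (V_sub hE) b.+1 x.
have -> : V 0 = 0 by apply/eqP; rewrite eq_le V_ge0// andbT; apply: V_le => // n'; rewrite Vn0.
by rewrite addr0.
Qed.

(** [bad_bound] with a mesh [w] of about [tau x / 2] and with [N w] above the typical maximum [b x];
    the levels stay in [[0, B2 x]], where [V_linear] applies. *)
Lemma bad_block (tau q : R) : 0 < tau -> 0 < q -> exists n0 : nat, forall n m x,
  (n0 <= n)%N -> block n m x -> Pr m (fun b => ~~ good (V x / x%:R) (tau * V x) b) <= q.
Proof.
move=> tau0 q0.
have q2 : 0 < q / 2 by rewrite divr_gt0.
have [b [n1 H1]] := max_block q2.
have [N HN] := nat_upper_bound (4 * b%:R / tau).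
have [B2 HB2] := nat_upper_bound (N.+1%:R * tau / 2).
have t2 : 0 < tau ^+ 2 by rewrite exprn_gt0.
have [c cE c0] : exists2 c : R, c = N.+2%:R * 4 / tau ^+ 2 & 0 < c.
  by eexists; first reflexivity; rewrite divr_gt0// mulr_gt0.
pose d : R := Num.min 1 (q / (4 * c * (8 * B2%:R + 2))).
have B2R : 0 <= B2%:R :> R by [].
have d0 : 0 < d by rewrite lt_min ltr01/= divr_gt0// !mulr_gt0//; lra.
have d1 : d <= 1 by rewrite ge_min lexx.
have dq : c * (8 * B2%:R + 2) * d <= q / 4.
  have : d <= q / (4 * c * (8 * B2%:R + 2)) by rewrite ge_min lexx orbT.
  by rewrite ler_pdivlMr ?mulr_gt0//; lra.
clearbody d.
have [x0 Hx0] := V_linear B2 d0.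
have [x1 Hx1] := nat_upper_bound (4 / tau + 4 * c * B2%:R / q).
have [n2 _ H2] := scale_infty ((x0 + x1)%:R / eps).
exists (n1 + n2 + 1)%N => n m x nn blk.
have [n4m mn xn] := blk.
have xb : (x0 + x1)%:R < x%:R :> R.
  have /= h := H2 n ltac:(rewrite /=; move: nn; clear; lia).
  by apply: lt_le_trans xn; rewrite mulrC -ltr_pdivrMr.
rewrite ltr_nat in xb.
have x_gt0 : (0 < x)%N by move: xb; clear; lia.
have xR : 0 < x%:R :> R by rewrite ltr0n.
have x1R : 4 / tau + 4 * c * B2%:R / q <= x%:R.
  by apply: le_trans Hx1 _; rewrite ler_nat; move: xb; clear; lia.
have p1 : 0 <= 4 * c * B2%:R / q by rewrite divr_ge0 ?mulr_ge0// ltW.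
have p2 : 0 <= 4 / tau by rewrite divr_ge0// ltW.
have x4 : 4 <= tau * x%:R by rewrite mulrC -ler_pdivrMr//; lra.
have xq : c * (B2%:R / x%:R) <= q / 4.
  have : 4 * c * B2%:R <= q * x%:R by rewrite [leRHS]mulrC -ler_pdivrMr//; lra.
  by rewrite mulrA ler_pdivrMr//; lra.
have v0 : 0 < V x by rewrite (lt_le_trans ltr01)// V_ge1.
pose w := Num.truncn (tau * x%:R / 2).
have /andP[w1 w2] : w%:R <= tau * x%:R / 2 < w.+1%:R.
  by apply: truncn_itv; rewrite divr_ge0// mulr_ge0// ltW.
clearbody w; rewrite -(natr1 w) in w2.
have w3 : tau * x%:R / 4 <= w%:R by lra.
have w0 : (0 < w)%N by rewrite -(ltr_nat R); lra.
have NB : (b * x <= N * w)%N.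
  rewrite -(ler_nat R) !natrM; move: HN; rewrite ler_pdivrMr// => HN.
  have : N%:R * (tau * x%:R / 4) <= N%:R * w%:R by rewrite ler_wpM2l.
  have : 4 * b%:R * x%:R <= N%:R * tau * x%:R by rewrite ler_pM2r.
  lra.
have NB2 : N.+1%:R * w%:R <= B2%:R * x%:R :> R.
  have h1 : N.+1%:R * w%:R <= N.+1%:R * (tau * x%:R / 2) by rewrite ler_pM2l.
  have h2 : N.+1%:R * tau / 2 * x%:R <= B2%:R * x%:R by rewrite ler_pM2r.
  lra.
have k0 : 0 <= V x / x%:R by rewrite divr_ge0// ltW.
have dv : 0 < d * V x by rewrite mulr_gt0.
have tv : 0 < tau * V x by rewrite mulr_gt0.
have kw : V x / x%:R * w%:R <= tau * V x / 2.
  by rewrite mulrAC ler_pdivrMr//; have := ler_wpM2l (ltW v0) w1; lra.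
have HV y : (y <= N.+1 * w)%N -> `|V y - V x / x%:R * y%:R| <= d * V x.
  move=> yN; rewrite (_ : V x / x%:R * y%:R = y%:R / x%:R * V x); last by ring.
  apply: Hx0; first by move: xb; clear; lia.
  by apply: leq_trans yN _; rewrite -(ler_nat R) !natrM.
have := bad_bound hE m k0 dv tv w0 kw HV; move=> h; apply: le_trans h _.
have h1 : Pr m (fun b0 => (N * w)%N%:Z <= mx b0) <= q / 2.
  apply: le_trans (H1 n m x _ blk); last by move: nn; clear; lia.
  by apply: (Ps_le hE) => s _; move: NB; clear; lia.
(* The Chebyshev bound is homogeneous in [V x], which cancels; what remains is small because [1 / x]
   and [d] are. *)
have -> : N.+2%:R * ((tau * V x / 2) ^- 2 * ((V x / x%:R) ^+ 2 * (N.+1 * w)%:R +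
    8 * (V x / x%:R) * (d * V x) * (N.+1 * w)%:R + 2 * (d * V x) ^+ 2)) =
    c * ((N.+1 * w)%:R / x%:R / x%:R + 8 * d * ((N.+1 * w)%:R / x%:R) + 2 * d ^+ 2).
  by rewrite cE; field; rewrite !gt_eqF.
have Yx : (N.+1 * w)%:R / x%:R <= B2%:R :> R by rewrite ler_pdivrMr// natrM.
have h2 : c * ((N.+1 * w)%:R / x%:R / x%:R) <= q / 4.
  by apply: le_trans xq; rewrite (ler_pM2l c0) ler_pM2r ?invr_gt0.
have h3 : 8 * d * ((N.+1 * w)%:R / x%:R) <= 8 * d * B2%:R.
  by apply: ler_wpM2l => //; rewrite mulr_ge0// ltW.
have h4 : d ^+ 2 <= d by rewrite expr2 ler_piMr// ltW.
have h5 : c * (8 * d * ((N.+1 * w)%:R / x%:R) + 2 * d ^+ 2) <= q / 4.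
  by apply: le_trans dq; rewrite -[leRHS]mulrA ler_pM2l//; lra.
lra.
Qed.

End block_estimates.

(** * Assembly of the estimates *)

Section assembly.
Context {R : realType}.
Variable E : (int -> R) -> R.
Hypothesis hE : averaging E.
Local Notation Pr := (Ps E).
Local Notation V := (Vlim E).
Variable a : nat -> R.
Hypothesis a_gt0 : forall n, (0 < n)%N -> 0 < a n.

(* [l b <= K v b + l ^ 2 / (K v)] and [Lam_second]. *)
Lemma lam_bad m (v K cl q : R) (b : seq int -> bool) : 0 < v -> 0 < K -> Lam E m <= cl * v ->
  Pr m b <= q ->
  Es E m (fun s => (lam s (-1))%:R * (b s)%:R) <= v * (K * q + 2 * cl ^+ 2 / K).
Proof.
move=> v0 K0 hL hq; have Kv : 0 < K * v by rewrite mulr_gt0.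
have -> : v * (K * q + 2 * cl ^+ 2 / K) = K * v * q + (K * v)^-1 * (2 * (cl * v) ^+ 2).
  by field; rewrite !gt_eqF.
have h : Es E m (fun s => K * v * (b s)%:R + (K * v)^-1 * ((lam s (-1))%:R ^+ 2)) <=
    K * v * q + (K * v)^-1 * (2 * (cl * v) ^+ 2).
  rewrite (EsD hE) ?(EsZ hE); do ?by bddl.
  apply: lerD; first by rewrite ler_pM2l.
  rewrite ler_pM2l ?invr_gt0//; apply: le_trans (Lam_second hE m) _.
  rewrite ler_pM2l// ler_sqr ?nnegrE//; first by apply: (Es_ge0 hE) => //; bddl.
  by apply: le_trans hL; apply: (Es_ge0 hE) => //; bddl.
apply: le_trans h; apply: (Es_le hE); do ?by bddl.
move=> s _; case: (b s); rewrite ?mulr1 ?mulr0 ?add0r; last first.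
  by rewrite mulr_ge0 ?invr_ge0 ?sqr_ge0// ltW.
have : 0 <= (lam s (-1))%:R :> R by [].
move: (lam s (-1))%:R => l l0; move: Kv; set c := K * v; clearbody c => c_gt0.
have := sqr_ge0 (l - c); rewrite -[l <= _]subr_ge0.
have -> : c + c^-1 * l ^+ 2 - l = ((l - c) ^+ 2 + c * l) / c by field; rewrite gt_eqF.
move=> h2; have c_ge0 := ltW c_gt0.
by apply: divr_ge0 => //; apply: addr_ge0 => //; apply: mulr_ge0.
Qed.

Hypothesis cos_cvg : forall th,
  Es E n (fun s => cos (th / a n * (sumz s)%:~R)) @[n --> \oo] --> expR (- (th ^+ 2 / 2)).
Hypothesis sin_cvg : forall th,
  Es E n (fun s => sin (th / a n * (sumz s)%:~R)) @[n --> \oo] --> (0 : R).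
Hypothesis tail : forall e, 0 < e -> exists2 L, 0 < L &
  \forall n \near \oo, Pr n (fun s => L * a n < `|(sumz s)%:~R|) <= e.
Hypothesis mass : forall K : R, 0 < K -> exists2 g, 0 < g & forall al be : R,
  - K <= al -> al < be -> be <= K ->
  \forall n \near \oo, g * (be - al) <=
    Pr n (fun s => (al * a n <= (sumz s)%:~R) && ((sumz s)%:~R <= be * a n)).

Let sl := scale_lt hE a_gt0 cos_cvg sin_cvg tail.
Let sg := scale_gt hE a_gt0 cos_cvg sin_cvg tail.
Let si := scale_infty hE a_gt0 cos_cvg sin_cvg tail.

Let mass1 : exists2 c0 : R, 0 < c0 & \forall n \near \oo, c0 <= Pr n (fun s => a n < (sumz s)%:~R).
Proof.
have [g g0 Hg] := mass (ltr0n R 3).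
have [|||n1 _ H1] := Hg 2 3; do ?lra.
exists g => //; exists n1.+1 => // n /= nn.
have h := H1 n (ltnW nn); rewrite (_ : 3 - 2 = 1) ?mulr1 in h; last by lra.
apply: le_trans h _; apply: (Ps_le hE) => s _ /andP[h _]; apply: lt_le_trans h.
by rewrite ltr_pMl ?a_gt0 ?(leq_ltn_trans _ nn)// ltr1n.
Qed.

Theorem ladder_mass_asymp (eps dl : R) : 0 < eps -> 0 < dl ->
  \forall n \near \oo, forall x : nat, eps <= x%:R / a n <= eps^-1 ->
  `|n%:R * Pr n (fun s => lad s && (sumz s == x)) - Pr n (fun s => sumz s == x) * V x| <=
  dl * (Pr n (fun s => sumz s == x) * V x).
Proof.
move=> eps0 dl0.
have [c0 c00 Hc0] := mass1.
have mt := max_tail hE a_gt0 sl si tail.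
have st := step_tail hE a_gt0 cos_cvg sin_cvg tail.
have kb := trunc_moment_bounds hE a_gt0 cos_cvg sin_cvg tail.
have rq := rho_quadratic hE a_gt0 (sym_tail0 hE a_gt0 cos_cvg sin_cvg tail) kb.
have Vl := V_linear hE a_gt0 sg sl si tail st c00 Hc0.
have [h [h0 hd hz]] := lattice hE kb.
have [Cu Cu0 [n1 _ H1]] := local_upper hE a_gt0 sl si rq h0 hd hz.
have [cd cd0 [n2 _ H2]] := local_lower hE a_gt0 sg sl si rq h0 hd hz mass eps0.
have [cl [n3 [cl0 H3]]] := Lam_block hE a_gt0 sl mt eps0.
(* [D] bounds the ratio of the local bound [5 Cu / a n] for a free block to [P(S_n = x)]. *)
pose D := 5 * Cu / cd; have D0 : 0 < D by rewrite divr_gt0// mulr_gt0.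
(* [dl] is split into [6 tau = dl / 2], [dl / 4] for the term with [cl ^ 2 / K], and [dl / 4] for
   the terms with [q]; [K] comes before [q] because it multiplies [q]. *)
pose K := 24 * D * cl ^+ 2 / dl; have K0 : 0 < K by do !apply: divr_gt0 => //; do !apply: mulr_gt0 => //; apply: exprn_gt0.
pose q := dl / (4 * D * (3 * K + 6 * cl + 3)).
have den0 : 0 < 3 * K + 6 * cl + 3 by lra.
have q0 : 0 < q by do !apply: divr_gt0 => //; do !apply: mulr_gt0 => //; apply: exprn_gt0.
pose tau := dl / 12; have tau0 : 0 < tau by rewrite divr_gt0.
have [n4 H4] := bad_block hE a_gt0 sl si mt Vl eps0 tau0 q0.
have [n5 H5] := sl (ltr0n R 5).
have budget : 6 * tau + D * (3 * (K * q + 2 * cl ^+ 2 / K) + 6 * (cl * q) + 3 * q) = dl.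
  have e1 : D * (6 * cl ^+ 2 / K) = dl / 4.
    by rewrite /K; field; rewrite !gt_eqF.
  have e2 : D * ((3 * K + 6 * cl + 3) * q) = dl / 4.
    by rewrite /q; field; rewrite !gt_eqF.
  rewrite /tau; lra.
have DE : D * cd = 5 * Cu by rewrite /D divfK// gt_eqF.
clearbody tau q K D.
exists (4 * (n1 + n2 + n3 + n4 + n5 + 3))%N => // n /= nn x xn.
have [m1 [m2 [m3 [nE hm]]]] : exists m1 m2 m3, n = (m1 + (m2 + m3))%N /\
    forall m, m \in [:: m1; m2; m3] -> [/\ (n <= 4 * m)%N, (n <= 4 * m)%N & (m <= n)%N].
  exists (n %/ 3)%N, (n %/ 3)%N, (n - 2 * (n %/ 3))%N; split; first by clear; lia.
  by move=> m; rewrite !inE => /or3P[] /eqP ->; move: nn; clear; split; lia.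
have an : 0 < a n by apply: a_gt0; move: nn; clear; lia.
(* [local_lower] needs a positive probability; otherwise both sides are 0. *)
have [p0|p0] := eqVneq (Pr n (fun s => sumz s == x)) 0.
  rewrite p0 mul0r mulr0 subr0; suff -> : Pr n (fun s => lad s && (sumz s == x)) = 0.
    by rewrite mulr0 normr0.
  apply/eqP; rewrite eq_le Ps_ge0// andbT -p0; apply: (Ps_le hE) => s _.
  by case/andP.
have pp : 0 < Pr n (fun s => sumz s == x) by rewrite lt_neqAle eq_sym p0 Ps_ge0.
have hp := H2 n ltac:(rewrite /=; move: nn; clear; lia) x xn pp.
case/andP: xn => xn _; rewrite ler_pdivlMr// in xn.
have xR : 0 < x%:R :> R by apply: lt_le_trans xn; rewrite mulr_gt0.
have x0 : (0 < x)%N by rewrite -(ltr_nat R).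
have v0 : 0 < V x by rewrite (lt_le_trans ltr01)// V_ge1.
have hC m y : m \in [:: m1; m2; m3] -> Pr m (fun s => sumz s == y) <= 5 * Cu / a n.
  move=> /hm[n4m _ mn].
  apply: le_trans (H1 m ltac:(rewrite /=; move: nn n4m; clear; lia) y) _.
  have am : 0 < a m by apply: a_gt0; move: nn n4m; clear; lia.
  have h5 : a n < 5 * a m.
    apply: H5; [by move: nn n4m; clear; lia|by move: nn n4m; clear; lia|].
    have : n%:R <= 4 * m%:R :> R by rewrite -natrM ler_nat.
    have : 0 <= m%:R :> R by []. lra.
  by rewrite ler_pdivrMr// mulrAC ler_pdivlMr//; have := ltW h5; rewrite -(ler_pM2l Cu0); lra.
have C0 : 0 <= 5 * Cu / a n by rewrite divr_ge0// ?mulr_ge0// ltW.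
have blk m : m \in [:: m1; m2; m3] -> [/\ (n <= 4 * m)%N, (m <= n)%N & eps * a n <= x%:R].
  by move=> /hm[].
have hL m : m \in [:: m1; m2; m3] -> Es E m (fun s => (lam s (-1))%:R) <= cl * V x.
  by move=> /blk; apply: H3; move: nn; clear; lia.
have hq m : m \in [:: m1; m2; m3] ->
    Es E m (fun s => (~~ good (V x / x%:R) (tau * V x) s)%:R) <= q.
  by move=> /blk; apply: H4; move: nn; clear; lia.
have hr m : m \in [:: m1; m2; m3] ->
    Es E m (fun s => (lam s (-1))%:R * (~~ good (V x / x%:R) (tau * V x) s)%:R) <=
    V x * (K * q + 2 * cl ^+ 2 / K).
  by move=> mi; apply: lam_bad => //; [exact: hL|exact: hq].
have xz : (0 : int) < x by rewrite ltz_nat.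
have k0 : 0 <= V x / x%:R by rewrite divr_ge0// ltW.
have t0 : 0 <= tau * V x by rewrite mulr_ge0// ltW.
have := three_blocks hE C0 hC k0 t0 xz hL hq hr.
rewrite -nE cycle_identity// -pmulrn.
have -> : V x / x%:R * x%:R = V x by rewrite divfK// gt_eqF.
rewrite [V x * Pr n _]mulrC => H; apply: le_trans H _.
set p := Pr n _ in pp hp *.
have hCp : 5 * Cu / a n <= D * p.
  by rewrite -DE -mulrA ler_pM2l.
have Z0 : 0 <= 3 * (V x * (K * q + 2 * cl ^+ 2 / K)) + 6 * (cl * V x * q) + 3 * (V x * q).
  have h1 : 0 <= K * q + 2 * cl ^+ 2 / K by rewrite addr_ge0 ?mulr_ge0 ?invr_ge0// ltW.
  by rewrite !addr_ge0// ?mulr_ge0// ltW.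
have := ler_wpM2r Z0 hCp; rewrite -[in X in _ -> X]budget; lra.
Qed.

End assembly.

(** * The standard normal law *)

Section gaussian.
Context {R : realType}.
Local Notation mu := (@lebesgue_measure R).
Local Notation g := (normal_pdf (0 : R) 1).
Local Notation pk := (normal_peak (1 : R)).

Lemma std_normal_pdfE x : g x = pk * expR (- (x ^+ 2 / 2)).
Proof.
rewrite normal_pdfE ?oner_eq0// /normal_fun subr0 expr1n; congr (_ * expR _).
by rewrite mulNr.
Qed.

Lemma std_normal_pdf_gt0 x : 0 < g x.
Proof. by rewrite std_normal_pdfE mulr_gt0 ?expR_gt0// normal_peak_gt0 ?oner_eq0. Qed.

Lemma measurable_std_normal_pdf : measurable_fun setT g.
Proof. exact: measurable_normal_pdf. Qed.

Lemma continuous_std_normal_pdf : continuous g.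
Proof. by apply: continuous_normal_pdf; rewrite oner_eq0. Qed.

(** Since [|x| <= exp (3 / 8 x ^ 2)], the integrand is dominated by a multiple of the normal density
    with standard deviation 2. *)
Lemma integrable_norm_std_normal : mu.-integrable setT (fun x => (`|x| * g x)%:E).
Proof.
pose c := pk / normal_peak (2 : R).
have c0 : 0 < c by rewrite divr_gt0 ?normal_peak_gt0 ?oner_eq0.
have := integrableZl (mu := mu) (D := setT) measurableT c (integrable_normal_pdf 0 2).
apply: le_integrable => //.
  apply/measurable_EFinP; apply: measurable_funM; last exact: measurable_std_normal_pdf.
  by apply: measurableT_comp; first exact: normr_measurable.
move=> x _; rewrite -EFinM lee_fin ger0_norm; last by rewrite mulr_ge0// ltW ?std_normal_pdf_gt0.
rewrite ger0_norm; last by rewrite mulr_ge0 ?normal_pdf_ge0// ltW.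
rewrite std_normal_pdfE normal_pdfE// /normal_fun subr0 /c.
have p2 : normal_peak 2 != 0 :> R by rewrite gt_eqF// normal_peak_gt0.
rewrite [leRHS]mulrA divfK// [leLHS]mulrCA ler_pM2l ?normal_peak_gt0 ?oner_eq0//.
have -> : - x ^+ 2 / (2 ^+ 2 *+ 2) = 3 / 8 * x ^+ 2 + - (x ^+ 2 / 2).
  by rewrite -mulr_natr; field.
rewrite expRD ler_pM2r ?expR_gt0//; apply: le_trans (expR_ge1Dx _).
have -> : x ^+ 2 = `|x| ^+ 2 by rewrite real_normK ?num_real.
have := sqr_ge0 (3 * `|x| - 4); lra.
Qed.

Lemma integrable_bounded_std_normal (f : R -> R) : measurable_fun setT f -> (forall x, `|f x| <= 1) ->
  mu.-integrable setT (fun x => (f x * g x)%:E).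
Proof.
move=> mf f1; apply: le_integrable (integrable_normal_pdf 0 1) => //.
  by apply/measurable_EFinP; apply: measurable_funM; last exact: measurable_std_normal_pdf.
move=> x _; rewrite lee_fin normrM ler_piMl//.
Qed.

Lemma integrable_linear_std_normal (f : R -> R) : measurable_fun setT f -> (forall x, `|f x| <= 1) ->
  mu.-integrable setT (fun x => (f x * x * g x)%:E).
Proof.
move=> mf f1; apply: le_integrable integrable_norm_std_normal => //.
  apply/measurable_EFinP; apply: measurable_funM; last exact: measurable_std_normal_pdf.
  exact: measurable_funM.
move=> x _; rewrite lee_fin !normrM normr_id ler_wpM2r//.
by rewrite ler_piMl.
Qed.

Lemma is_derive_std_normal_pdf (x : R) : is_derive x 1%R g (- x * g x).
Proof.
have -> : g = (fun x => pk * expR (- (x ^+ 2 / 2))) by apply/funext => y; exact: std_normal_pdfE.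
apply: is_derive_eq.
by rewrite /GRing.scale /=; field.
Qed.

Lemma is_derive_sin_affine (th c x : R) :
  is_derive x 1%R (fun y => sin (th * y + c)) (th * cos (th * x + c)).
Proof.
apply: is_derive_eq.
by rewrite /GRing.scale /=; ring.
Qed.

Lemma is_derive_cos_affine (th c x : R) :
  is_derive th 1%R (fun t => cos (t * x + c)) (- (sin (th * x + c) * x)).
Proof.
apply: is_derive_eq.
by rewrite /GRing.scale /=; ring.
Qed.

(** A crude decay that makes the boundary terms at [n] and [- n] vanish in the integration by
    parts. *)
Lemma std_normal_pdf_le_harmonic n : g n%:R <= 2 * pk * harmonic n.
Proof.
rewrite std_normal_pdfE /harmonic [leRHS]mulrAC [leRHS]mulrC ler_pM2l ?normal_peak_gt0 ?oner_eq0//.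
have n1 : 0 < n.+1%:R :> R by [].
have -> : 2 * n.+1%:R^-1 = (n.+1%:R / 2)^-1 :> R by rewrite invf_div.
rewrite expRN lef_pV2 ?posrE ?expR_gt0 ?divr_gt0//.
apply: le_trans (expR_ge1Dx _); rewrite -(natr1 n).
have := sqr_ge0 (n%:R - 1 : R); have : 0 <= n%:R :> R by []; lra.
Qed.

Lemma std_normal_pdfN x : g (- x) = g x.
Proof. by rewrite !std_normal_pdfE sqrrN. Qed.

Lemma Rintegral_cvg_symmetric (f : R -> R) : mu.-integrable setT (EFin \o f) ->
  \int[mu]_(x in `[- n%:R, n%:R]) f x @[n --> \oo] --> \int[mu]_x f x.
Proof.
move=> fi; have mf := measurable_int _ fi.
apply: fine_cvg; rewrite fineK; last exact: integrable_fin_num.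
pose F n := (EFin \o f) \_ (`[- n%:R, n%:R]%classic : set R).
have mF n : measurable_fun setT (F n).
  by apply/(measurable_restrictT _ _).1 => //; apply: measurable_funS mf.
have [|||_ _ +] := @dominated_convergence _ _ _ mu setT measurableT F (EFin \o f) (abse \o (EFin \o f))
  mF mf.
- apply: aeW => x _; apply: cvg_near_cst.
  have [n hn] := nat_upper_bound (`|x|).
  exists n => // k /= nk; rewrite /F patchE mem_set//=.
  by rewrite in_itv/= -ler_norml (le_trans hn)// ler_nat.
- exact: integrable_abse.
- apply: aeW => x n _; rewrite /F patchE; case: ifP => //=.
  by rewrite normr0 lee_fin.
apply: cvg_trans; apply: near_eq_cvg; apply: nearW => n /=.
by rewrite /F -integral_mkcond.
Qed.

Lemma is_derive_continuous (f : R -> R) (x df : R) : is_derive x 1%R f df -> {for x, continuous f}.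
Proof.
by move=> h; apply/differentiable_continuous/derivable1_diffP; exact: ex_derive.
Qed.

Lemma continuous_sin_affine (th c : R) : continuous (fun x => sin (th * x + c)).
Proof. by move=> x; exact: is_derive_continuous (is_derive_sin_affine th c x). Qed.

Lemma continuous_cos_affine (th c : R) : continuous (fun x => cos (th * x + c)).
Proof.
have -> : (fun x => cos (th * x + c)) = (fun t => cos (t * th + c)).
  by apply/funext => t; rewrite mulrC.
by move=> x; exact: is_derive_continuous (is_derive_cos_affine x c th).
Qed.

Lemma integrable_cos_std_normal (th c : R) : mu.-integrable setT (fun x => (cos (th * x + c) * g x)%:E).
Proof.
apply: (integrable_bounded_std_normal (f := fun x => cos (th * x + c))) => [|x]; last exact: cos_max.
by apply: continuous_measurable_fun; exact: continuous_cos_affine.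
Qed.

Lemma integrable_sin_linear_std_normal (th c : R) :
  mu.-integrable setT (fun x => (sin (th * x + c) * x * g x)%:E).
Proof.
apply: (integrable_linear_std_normal (f := fun x => sin (th * x + c))) => [|x]; last exact: sin_max.
by apply: continuous_measurable_fun; exact: continuous_sin_affine.
Qed.

(** Integration by parts with [g' = - x g] on [[-n, n]], then [n] to infinity. *)
Lemma Rintegral_std_normal_parts (th c : R) :
  \int[mu]_x (sin (th * x + c) * x * g x) = th * \int[mu]_x (cos (th * x + c) * g x).
Proof.
pose f x := th * (cos (th * x + c) * g x) - sin (th * x + c) * x * g x.
pose F x := sin (th * x + c) * g x.
have dF (x : R) : is_derive x 1%R F (f x).
  have := is_deriveM (is_derive_sin_affine th c x) (is_derive_std_normal_pdf x).
  by move=> h; apply: is_derive_eq h _; rewrite /f /GRing.scale /=; ring.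
have fi : mu.-integrable setT (EFin \o f).
  rewrite (_ : EFin \o f = (fun x => th%:E * (cos (th * x + c) * g x)%:E) \-
    (fun x => (sin (th * x + c) * x * g x)%:E))%E//.
  apply: integrableB => //; last exact: integrable_sin_linear_std_normal.
  by apply: integrableZl => //; exact: integrable_cos_std_normal.
have normal_charfun : continuous f.
  move=> x; apply: cvgB; first apply: cvgZr; apply: cvgM; try exact: continuous_std_normal_pdf.
    exact: continuous_cos_affine.
  by apply: cvgM; [exact: continuous_sin_affine|exact: cvg_id].
have I0 : \int[mu]_x f x = 0.
  apply: (cvg_unique _ (Rintegral_cvg_symmetric fi)) => //.
  apply: (@squeeze_cvgr _ _ _ _ (fun n => - (4 * pk * harmonic n)) (fun n => 4 * pk * harmonic n)).
  - exists 1%N => // n /= n0; rewrite -ler_norml /Rintegral.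
    rewrite (@continuous_FTC2 _ f F)//=.
    + have h x : `|F x| <= g x.
        by rewrite normrM (ger0_norm (ltW (std_normal_pdf_gt0 x))) ler_piMl ?sin_max// ltW// std_normal_pdf_gt0.
      rewrite (le_trans (ler_normB _ _))//; have := h n%:R; have := h (- n%:R).
      rewrite std_normal_pdfN => h1 h2; have h3 := std_normal_pdf_le_harmonic n.
      apply: le_trans (lerD (le_trans h2 h3) (le_trans h1 h3)) _.
      by rewrite -mulrDl -mulrDl -natrD.
    + by rewrite gtrN// ltr0n.
    + by apply: continuous_subspaceT.
    + split => [x _||]; first exact: ex_derive.
      * by apply: cvg_at_right_filter; exact: is_derive_continuous (dF _).
      * by apply: cvg_at_left_filter; exact: is_derive_continuous (dF _).
    + by move=> x _; rewrite derive1E; exact: derive_val.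
  - rewrite -oppr0; apply: cvgN; rewrite -(mulr0 (4 * pk)); apply: cvgMr.
    exact: cvg_harmonic.
  - by rewrite -(mulr0 (4 * pk)); apply: cvgMr; exact: cvg_harmonic.
move: I0; rewrite /f RintegralB//; last exact: integrable_sin_linear_std_normal.
  by rewrite RintegralZl//; [lra|exact: integrable_cos_std_normal].
exact: (integrableZl measurableT th (integrable_cos_std_normal th c)).
Qed.

Definition normal_charfun (c th : R) := \int[mu]_x (cos (th * x + c) * g x).

(* With [c = 0] this is the real part of the characteristic function, and with
   [c = pi / 2] minus its imaginary part. *)
Lemma is_derive_normal_charfun (c th : R) : is_derive th 1%R (normal_charfun c) (- (th * normal_charfun c th)).
Proof.
have It : `]th - 1, th + 1[%classic th by rewrite /= in_itv/=; lra.
have d1 (t x : R) : is_derive t 1%R (fun t => cos (t * x + c) * g x) (- (sin (t * x + c) * x * g x)).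
  have := is_deriveM (is_derive_cos_affine t c x) (is_derive_cst (g x) t 1%R).
  by move=> h; apply: is_derive_eq h _; rewrite /GRing.scale /=; ring.
have d1E (t x : R) : partial1of2 (fun t x => cos (t * x + c) * g x) t x = - (sin (t * x + c) * x * g x).
  by rewrite partial1of2E; exact: (@derive_val _ _ _ _ _ _ _ (d1 t x)).
have d2 (t x : R) : derivable (fun t : R => cos (t * x + c) * g x) t 1.
  exact: (@ex_derive _ _ _ _ _ _ _ (d1 t x)).
have b1 (t x : R) : `|partial1of2 (fun t x => cos (t * x + c) * g x) t x| <= `|x| * g x.
  rewrite d1E normrN -mulrA normrM.
  by rewrite normrM (ger0_norm (ltW (std_normal_pdf_gt0 x))) ler_piMl ?sin_max// mulr_ge0// ltW// std_normal_pdf_gt0.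
have xg0 x : 0 <= `|x| * g x by rewrite mulr_ge0// ltW// std_normal_pdf_gt0.
have i1 t : `]th - 1, th + 1[%classic t -> mu.-integrable setT (EFin \o (fun x => cos (t * x + c) * g x)).
  by move=> _; exact: integrable_cos_std_normal.
have D := @derivable_under_integral _ _ _ mu _ setT measurableT _ _ _ It i1 (fun t x _ _ => d2 t x)
  _ xg0 integrable_norm_std_normal (fun t x _ _ => b1 t x).
have E := @differentiation_under_integral _ _ _ mu _ setT measurableT _ _ _ It i1 (fun t x _ _ => d2 t x)
  _ xg0 integrable_norm_std_normal (fun t x _ _ => b1 t x).
apply: DeriveDef => //; rewrite -derive1E E.
under eq_Rintegral do rewrite d1E.
rewrite (_ : \int[mu]_x (- (sin (th * x + c) * x * g x)) = \int[mu]_x (- 1 * (sin (th * x + c) * x * g x))).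
  by rewrite RintegralZl// ?mulN1r ?Rintegral_std_normal_parts//; exact: integrable_sin_linear_std_normal.
by apply: eq_Rintegral => x _; rewrite mulN1r.
Qed.

(** Multiplied by [exp (th ^ 2 / 2)] the function has derivative 0, and at [th = 0] it equals
    [cos c]. *)
Lemma normal_charfunE (c th : R) : normal_charfun c th = cos c * expR (- (th ^+ 2 / 2)).
Proof.
have d (x : R) : is_derive x 1%R (fun th => normal_charfun c th * expR (th ^+ 2 / 2)) 0.
  have h : is_derive x 1%R (fun th => expR (th ^+ 2 / 2)) (x * expR (x ^+ 2 / 2)).
    by apply: is_derive_eq; rewrite /GRing.scale /=; field.
  have := is_deriveM (is_derive_normal_charfun c x) h.
  by move=> h2; apply: is_derive_eq h2 _; rewrite /GRing.scale /=; ring.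
have := is_derive_0_is_cst th 0 d => /=.
rewrite expr0n/= mul0r expR0 mulr1 /normal_charfun.
have -> : \int[mu]_x (cos (0 * x + c) * g x) = cos c.
  under eq_Rintegral do rewrite mul0r add0r.
  rewrite RintegralZl//; last exact: integrable_normal_pdf.
  by rewrite /Rintegral integral_normal_pdf mulr1.
by move=> <-; rewrite -mulrA -expRD addrN expR0 mulr1.
Qed.

(* The density is a version of the Radon-Nikodym derivative. *)
Lemma integral_normal_prob (f : R -> R) : measurable_fun setT f -> (exists M, forall x, `|f x| <= M) ->
  (\int[normal_prob 0 1]_x (f x)%:E = \int[mu]_x (f x * g x)%:E)%E.
Proof.
move=> mf [M fM].
have fi : (normal_prob 0 1).-integrable setT (EFin \o f).
  apply: (@le_integrable _ _ _ _ setT measurableT _ (cst M%:E)) => //; first exact/measurable_EFinP.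
    by move=> x _; rewrite lee_fin (le_trans (fM x))// ler_norm.
  exact: finite_measure_integrable_cst.
have dom := normal_prob_dominates (0 : R) 1.
rewrite -(Radon_Nikodym_change_of_variables dom measurableT fi).
apply: ae_eq_integral => //.
- apply: emeasurable_funM; first exact/measurable_EFinP.
  by apply: (measurable_int mu); exact: Radon_Nikodym_integrable.
- by apply/measurable_EFinP; apply: measurable_funM => //; exact: measurable_std_normal_pdf.
- under [X in ae_eq _ _ _ X]eq_fun do rewrite EFinM.
  apply: ae_eqe_mul2l => /=.
  rewrite Radon_NikodymE//=.
  case: cid => /= h [h1 h2 h3].
  apply: integral_ae_eq => //=.
  + by apply/measurable_EFinP; exact: measurable_std_normal_pdf.
  + by move=> E E01 mE; rewrite -h3.
Qed.

Lemma normal_cos (c th : R) :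
  (\int[normal_prob 0 1]_x (cos (th * x + c))%:E = (cos c * expR (- (th ^+ 2 / 2)))%:E)%E.
Proof.
rewrite integral_normal_prob.
- by rewrite -normal_charfunE /normal_charfun /Rintegral fineK//; exact: integrable_fin_num (integrable_cos_std_normal th c).
- by apply: continuous_measurable_fun; exact: continuous_cos_affine.
- by exists 1 => x; exact: cos_max.
Qed.

Lemma continuous_tail (L : R) : continuous (fun x : R => Num.min 1 (`|x| / L)).
Proof.
move=> x; apply: (@continuous_min _ _ (cst 1) (fun x : R => `|x| / L)); first exact: cvg_cst.
by apply: cvgM; [exact: norm_continuous|exact: cvg_cst].
Qed.

Lemma tail_bound (L x : R) : 0 < L -> 0 <= Num.min 1 (`|x| / L) <= 1.
Proof. by move=> L0; rewrite le_min ler01 divr_ge0 ?ge_min ?lexx// ltW. Qed.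

(** The integrand is a continuous majorant of the indicator of [|x| > L], as weak convergence
    requires; its mean is at most the first absolute moment over [L]. *)
Lemma normal_tail (e : R) : 0 < e -> exists2 L, 0 < L &
  (\int[normal_prob 0 1]_x (Num.min 1 (`|x| / L))%:E <= e%:E)%E.
Proof.
move=> e0; pose C := \int[mu]_x (`|x| * g x).
have C0 : 0 <= C by apply: Rintegral_ge0 => x _; rewrite mulr_ge0// ltW// std_normal_pdf_gt0.
have L0 : 0 < (C + 1) / e by rewrite divr_gt0// ltr_pwDr.
exists ((C + 1) / e) => //; rewrite integral_normal_prob; last 2 first.
- by apply: continuous_measurable_fun; exact: continuous_tail.
- by exists 1 => x; have /andP[h1 h2] := tail_bound x L0; rewrite ger0_norm.
apply: (@le_trans _ _ (\int[mu]_x (((C + 1) / e)^-1%:E * (`|x| * g x)%:E))%E).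
  apply: ge0_le_integral => //.
  - move=> x _; have /andP[h1 h2] := tail_bound x L0.
    by rewrite lee_fin mulr_ge0// ltW// std_normal_pdf_gt0.
  - apply/measurable_EFinP; apply: measurable_funM; last exact: measurable_std_normal_pdf.
    by apply: continuous_measurable_fun; exact: continuous_tail.
  - by apply: measurable_int (integrableZl _ _ integrable_norm_std_normal).
  - move=> x _; rewrite -EFinM lee_fin mulrA ler_pM2r ?std_normal_pdf_gt0//.
    by rewrite ge_min (mulrC `|x|) lexx orbT.
rewrite integralZl//; last exact: integrable_norm_std_normal.
rewrite -[X in (_ * X)%E]fineK; last exact: integrable_fin_num integrable_norm_std_normal.
rewrite -EFinM lee_fin -/(Rintegral _ _ _) -/C invf_div -mulrA ler_piMr ?(ltW e0)//.
by rewrite mulrC ler_pdivrMr ?mul1r ?lerDl// ltr_pwDr.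
Qed.

(** A continuous minorant of the indicator of [[al, be]], to be used with weak convergence. *)
Definition tent (al be x : R) : R :=
  Num.max 0 (1 - `|x - (al + be) / 2| / ((be - al) / 2)).

Lemma continuous_tent al be : continuous (tent al be).
Proof.
move=> x; apply: (@continuous_max _ _ (cst 0) (fun x : R => 1 - `|x - (al + be) / 2| / ((be - al) / 2)));
  first exact: cvg_cst.
apply: cvgB; first exact: cvg_cst.
apply: cvgM; last exact: cvg_cst.
apply: (@continuous_comp _ _ _ (fun y : R => y - (al + be) / 2)); last exact: norm_continuous.
by apply: cvgB; [exact: cvg_id|exact: cvg_cst].
Qed.

Lemma tent_bound al be x : al < be -> 0 <= tent al be x <= ((al <= x) && (x <= be))%:R.
Proof.
move=> ab; rewrite /tent le_max lexx/= ge_max.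
have w0 : 0 < (be - al) / 2 by lra.
case: (boolP ((al <= x) && (x <= be))) => h /=.
  by rewrite ler01 lerBlDl lerDr divr_ge0// ltW.
rewrite lexx/= subr_le0 ler_pdivlMr// mul1r.
move: h; rewrite negb_and -!ltNge => /orP[] h.
  by rewrite ltr0_norm; lra.
by rewrite gtr0_norm; lra.
Qed.

(** On the middle half of [[al, be]] the tent is at least 1/2 and the density at least [g K]. *)
Lemma normal_tent (K al be : R) : - K <= al -> al < be -> be <= K ->
  ((g K / 4 * (be - al))%:E <= \int[normal_prob 0 1]_x (tent al be x)%:E)%E.
Proof.
move=> Kal ab beK.
have mt : measurable_fun setT (tent al be).
  by apply: continuous_measurable_fun; exact: continuous_tent.
rewrite integral_normal_prob//; last first.
  exists 1 => x; have /andP[h1 h2] := tent_bound x ab; rewrite ger0_norm//.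
  by apply: le_trans h2 _; case: (_ && _).
pose m1 := (3 * al + be) / 4; pose m2 := (al + 3 * be) / 4.
have m12 : m1 < m2 by rewrite /m1 /m2; lra.
have mtg : measurable_fun setT (fun x => (tent al be x * g x)%:E).
  by apply/measurable_EFinP; apply: measurable_funM => //; exact: measurable_std_normal_pdf.
apply: (@le_trans _ _ (\int[mu]_(x in `[m1, m2]) (tent al be x * g x)%:E)%E); last first.
  apply: ge0_subset_integral => // x _.
  by have /andP[h1 h2] := tent_bound x ab; rewrite lee_fin mulr_ge0// ltW// std_normal_pdf_gt0.
apply: (@le_trans _ _ (\int[mu]_(x in `[m1, m2]) (g K / 2)%:E)%E).
  rewrite integral_cst//= lebesgue_measure_itv/= lte_fin m12 -EFinB -EFinM lee_fin.
  by rewrite /m1 /m2; lra.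
apply: ge0_le_integral => //.
- by move=> x _; rewrite lee_fin divr_ge0// ltW// std_normal_pdf_gt0.
- exact: measurable_funS mtg.
- move=> x /=; rewrite in_itv/= /m1 /m2 => /andP[x1 x2]; rewrite lee_fin mulrC.
  have h1 : 2^-1 <= tent al be x.
    rewrite /tent le_max; apply/orP; right.
    rewrite lerBrDl -lerBrDr ler_pdivrMr; last lra.
    by rewrite ler_norml; lra.
  have h2 : g K <= g x.
    rewrite !std_normal_pdfE ler_pM2l ?normal_peak_gt0 ?oner_eq0// ler_expR lerN2 ler_pM2r ?invr_gt0//.
    have -> : x ^+ 2 = `|x| ^+ 2 by rewrite real_normK ?num_real.
    have -> : K ^+ 2 = K * K by [].
    have xK : `|x| <= K by rewrite ler_norml; lra.
    by rewrite expr2; apply: ler_pM.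
  by apply: ler_pM; rewrite ?normal_pdf_ge0 ?invr_ge0.
Qed.

End gaussian.

(** * The law of the path *)

Section countable_measurability.
Context (d : measure_display) (T : measurableType d) (R : realType) (P : probability T R).

(** Measurability for countable targets such as integer lists, without choosing a sigma-algebra on
    them. *)
Definition measurable_levels {A : countType} (Y : T -> A) := forall a, measurable [set w | Y w = a].

Lemma measurable_levels_preimage (A : countType) (Y : T -> A) (Q : set A) : measurable_levels Y -> measurable [set w | Q (Y w)].
Proof.
move=> mY.
have -> : [set w | Q (Y w)] =
    \bigcup_k [set w | oapp (fun a => Q a /\ Y w = a) False (pickle_inv k)].
  apply/seteqP; split => w /=.
    by move=> Qw; exists (choice.pickle (Y w)) => //=; rewrite pickleK_inv.
  by move=> [k _] /=; case: (pickle_inv k) => //= a [Qa ->].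
apply: bigcupT_measurable => k; case: (pickle_inv k) => [a|] /=; last first.
  by rewrite (_ : [set _ | _] = set0)//; apply/seteqP; split.
have [Qa|nQa] := pselect (Q a).
  rewrite (_ : [set _ | _] = [set w | Y w = a])//.
  by apply/seteqP; split => w /= => [[]|].
by rewrite (_ : [set _ | _] = set0)//; apply/seteqP; split => w /= => [[]|].
Qed.

Lemma measurable_levels_comp (A B : countType) (Y : T -> A) (h : A -> B) : measurable_levels Y -> measurable_levels (fun w => h (Y w)).
Proof. by move=> mY b; exact: (measurable_levels_preimage (fun a => h a = b)). Qed.

Lemma measurable_levels_map (A : countType) (I : Type) (Y : I -> T -> A) (l : seq I) :
  (forall i, measurable_levels (Y i)) -> measurable_levels (fun w => [seq Y i w | i <- l]).
Proof.
move=> mY; elim: l => [|i l IHl] s /=.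
  have [->|ns] := eqVneq s [::].
    by rewrite (_ : [set _ | _] = setT)//; apply/seteqP; split.
  by rewrite (_ : [set _ | _] = set0)//; apply/seteqP; split => // w /= h; rewrite -h in ns.
case: s => [|a s].
  by rewrite (_ : [set _ | _] = set0)//; apply/seteqP; split.
rewrite (_ : [set _ | _] = [set w | Y i w = a] `&` [set w | [seq Y i w | i <- l] = s]).
  by apply: measurableI; [exact: mY|exact: IHl].
by apply/seteqP; split => w /=; [case=> -> ->|case=> -> ->].
Qed.

Lemma measurable_fun_levels (A : countType) (Y : T -> A) (h : A -> R) :
  measurable_levels Y -> measurable_fun setT (fun w => h (Y w)).
Proof.
by move=> mY _ B mB; rewrite setTI; exact: (measurable_levels_preimage (fun a => B (h a))).
Qed.

Lemma integrable_levels (A : countType) (Y : T -> A) (h : A -> R) : measurable_levels Y ->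
  (exists M, forall w, `|h (Y w)| <= M) -> P.-integrable setT (EFin \o (fun w => h (Y w))).
Proof.
move=> mY [M hM].
apply: (@le_integrable _ _ _ _ setT measurableT _ (cst M%:E)) => //.
- by apply/measurable_EFinP; exact: measurable_fun_levels.
- by move=> w _; rewrite lee_fin (le_trans (hM w))// ler_norm.
- exact: finite_measure_integrable_cst.
Qed.

(* The sum over a countable type is taken along [pickle_inv], which hits every
   element once and is [None] elsewhere. *)
Lemma integral_countable (A : countType) (Y : T -> A) (F : A -> T -> R) : measurable_levels Y ->
  (forall a, measurable_fun setT (F a)) -> (forall a w, 0 <= F a w) ->
  (\int[P]_w (F (Y w) w)%:E =
   \sum_(k <oo) oapp (fun a => \int[P]_w ((Y w == a)%:R * F a w)%:E) 0 (pickle_inv k))%E.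
Proof.
move=> mY mF F0.
pose f k w : \bar R := (oapp (fun a => ((Y w == a)%:R * F a w)%:E) 0 (pickle_inv k))%E.
have mYa a : measurable_fun setT (fun w => (Y w == a)%:R : R).
  exact: (measurable_fun_levels (fun b => (b == a)%:R)).
transitivity (\int[P]_w \sum_(k <oo) f k w)%E.
  apply: eq_integral => w _.
  rewrite (@nneseriesD1 _ _ (choice.pickle (Y w))) => [||//]; last first.
    move=> k _; rewrite /f; case: (pickle_inv k) => //= a.
    by rewrite lee_fin mulr_ge0.
  rewrite eseries0 ?adde0; first by rewrite /f pickleK_inv/= eqxx mul1r.
  move=> k _ /= nk; rewrite /f; case E : (pickle_inv k) => [a|]//=.
  have [Ya|] := eqVneq (Y w) a; last by rewrite mul0r.
  have := @pickle_invK A k; rewrite E /= => ak.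
  by rewrite Ya ak eqxx in nk.
rewrite integral_nneseries//.
- apply: eq_eseriesr => k _; rewrite /f; case: (pickle_inv k) => //=.
  by rewrite integral0.
- move=> k; rewrite /f; case: (pickle_inv k) => //= a.
  by apply/measurable_EFinP; exact: measurable_funM.
- by move=> k w _; rewrite /f; case: (pickle_inv k) => //= a; rewrite lee_fin mulr_ge0.
Qed.

End countable_measurability.

(** * The law of the integer path *)

Section law.
Context (d : measure_display) (T : measurableType d) (R : realType) (P : probability T R).
Variable X : nat -> {RV P >-> R}.
Hypothesis X_iid : iid X.

(** The floor gives an integer at every sample point, so that paths take values in a countable
    type. *)
Definition int_step i (w : T) : int := Num.floor (X i w).

Lemma int_step_preimage i z : [set w | int_step i w = z] = X i @^-1` `[z%:~R, (z + 1)%:~R[%classic.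
Proof.
apply/seteqP; split => w /=; rewrite in_itv/=.
  by rewrite /int_step => <-; rewrite floor_le_tmp lt_succ_floor.
by move=> /floor_def.
Qed.

Lemma measurable_levels_int_step i : measurable_levels (int_step i).
Proof.
move=> z; rewrite int_step_preimage -[X in measurable X]setTI.
exact: (measurable_funP (X i)) measurableT _ (measurable_itv _).
Qed.

Lemma int_step_law i z : P [set w | int_step i w = z] = P [set w | int_step 0 w = z].
Proof.
rewrite !int_step_preimage; have [_ /(_ i 0%N `[z%:~R, (z + 1)%:~R[%classic)] := X_iid.
by apply; exact: measurable_itv.
Qed.

Lemma int_step_indep (J : seq nat) (z : nat -> int) : uniq J ->
  P [set w | all (fun i => int_step i w == z i) J] = (\prod_(i <- J) P [set w | int_step i w = z i])%E.
Proof.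
move=> uJ; pose J' := [fset i in J]%fset.
have [/(_ J' (fun i => `[(z i)%:~R, (z i + 1)%:~R[%classic)) h _] := X_iid.
transitivity (\prod_(i <- J') P [set w | int_step i w = z i])%E; last first.
  by apply: perm_big; apply: uniq_perm => // i; rewrite !inE.
under eq_bigr do rewrite int_step_preimage.
rewrite -h; last by move=> i; exact: measurable_itv.
congr (P _); apply/seteqP; split => w.
  move=> /allP h2 i; rewrite /= !inE => /h2 /eqP.
  by have := int_step_preimage i (z i) => /seteqP[/(_ w)] + _; exact.
move=> h2; apply/allP => i iJ; apply/eqP.
have /h2 : [set` J'] i by rewrite /= !inE.
by have := int_step_preimage i (z i) => /seteqP[_ /(_ w)] + ; exact.
Qed.

Definition int_path k m w := [seq int_step i w | i <- iota k m].

Lemma measurable_levels_int_path k m : measurable_levels (int_path k m).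
Proof. by apply: measurable_levels_map => i; exact: measurable_levels_int_step. Qed.

Lemma int_path_prob k s : size s = k ->
  P [set w | int_path 0 k w = s] = (\prod_(i <- iota 0 k) P [set w | int_step i w = (nth 0 s i)%R])%E.
Proof.
move=> sk; rewrite -int_step_indep ?iota_uniq//; congr (P _); apply/seteqP; split => w /=.
  move=> <-; apply/allP => i; rewrite mem_iota/= => ik.
  by rewrite (nth_map 0%N) ?size_iota// nth_iota// eqxx.
move=> /allP h; apply: (@eq_from_nth _ 0); rewrite size_map size_iota// => i ik.
rewrite (nth_map 0%N) ?size_iota// nth_iota//.
by apply/eqP/h; rewrite mem_iota.
Qed.

Lemma int_path_rcons k s z : size s = k ->
  P [set w | int_path 0 k.+1 w = rcons s z] = (P [set w | int_path 0 k w = s] * P [set w | int_step 0 w = z])%E.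
Proof.
move=> sk; rewrite int_path_prob ?size_rcons ?sk// int_path_prob// -addn1 iotaD big_cat big_seq1/=.
rewrite add0n nth_rcons sk ltnn eqxx int_step_law; congr (_ * _)%E.
rewrite big_seq [RHS]big_seq; apply: eq_bigr => i; rewrite mem_iota/= => ik.
by rewrite nth_rcons sk ik.
Qed.

Definition step_mean (f : int -> R) := \int[P]_w f (int_step 0 w).

Let integrable_step (f : int -> R) : bd f -> P.-integrable setT (EFin \o (fun w => f (int_step 0 w))).
Proof. by move=> [M fM]; apply: integrable_levels; [exact: measurable_levels_int_step|exists M]. Qed.

Lemma step_mean_fin (f : int -> R) : bd f -> (\int[P]_w (f (int_step 0 w))%:E = (step_mean f)%:E)%E.
Proof. by move=> bf; rewrite fineK//; exact: integrable_fin_num (integrable_step bf). Qed.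

Lemma step_mean_Fubini (F : int -> int -> R) : (forall x y, 0 <= F x y) -> (exists M, forall x y, `|F x y| <= M) ->
  step_mean (fun x => step_mean (F x)) = step_mean (fun y => step_mean (F ^~ y)).
Proof.
move=> F0 [M FM].
have mF : measurable_fun setT (fun ww : T * T => (F (int_step 0 ww.1) (int_step 0 ww.2))%:E).
  apply/measurable_EFinP.
  apply: (@measurable_fun_levels _ _ R _ (fun ww : T * T => (int_step 0 ww.1, int_step 0 ww.2)) (fun zz => F zz.1 zz.2)).
  move=> [x y]; rewrite (_ : [set _ | _] = [set w | int_step 0 w = x] `*` [set w | int_step 0 w = y]).
    by apply: measurableX; exact: measurable_levels_int_step.
  by apply/seteqP; split => -[w w'] /= => [[-> ->]|[-> ->]].
have := @fubini_tonelli _ _ T T R P P _ mF (fun ww => F0 _ _) => /= h.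
have bF x : bd (F x) by exists M.
have bF' y : bd (F ^~ y) by exists M.
rewrite [LHS]/step_mean [RHS]/step_mean /Rintegral; congr fine.
transitivity (\int[P]_w \int[P]_w' (F (int_step 0 w) (int_step 0 w'))%:E)%E.
  by apply: eq_integral => w _; rewrite (step_mean_fin (bF _)).
rewrite h; apply: eq_integral => w _.
by rewrite (step_mean_fin (bF' (int_step 0 w))).
Qed.

Lemma step_mean_cst c : step_mean (fun=> c) = c.
Proof. by rewrite /step_mean /Rintegral integral_cst//= probability_setT mule1. Qed.

Lemma averaging_step_mean : averaging step_mean.
Proof.
have exD (f g : int -> R) : bd f -> bd g -> step_mean (fun z => f z + g z) = step_mean f + step_mean g.
  by move=> bf bg; rewrite /step_mean RintegralD//; exact: integrable_step.
have exle (f g : int -> R) : bd f -> bd g -> (forall z, f z <= g z) -> step_mean f <= step_mean g.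
  by move=> bf bg fg; apply: le_Rintegral => //; exact: integrable_step.
split; [exact: exD| |exact: exle|exact: step_mean_cst| |].
- by move=> c f bf; rewrite /step_mean RintegralZl//; exact: integrable_step.
- move=> F [M FM].
  (* Tonelli needs a non-negative integrand, so the bound [M] is added and cancelled at the end. *)
  have FMz x y : 0 <= F x y + M by rewrite -lerBlDr sub0r; have := FM x y; rewrite ler_norml => /andP[].
  have b1 (f : int -> R) : (forall z, `|f z| <= M) -> `|step_mean f| <= M.
    move=> fM; have bf : bd f by exists M.
    rewrite ler_norml -{1}(step_mean_cst (- M)) -{2}(step_mean_cst M).
    by apply/andP; split; apply: exle => //; try exact: bd_cst;
      move=> z; have := fM z; rewrite ler_norml => /andP[].
  have h (f : int -> R) : bd f -> step_mean (fun x => f x + M) = step_mean f + M.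
    by move=> bf; rewrite exD ?step_mean_cst//; exact: bd_cst.
  have bFM : exists M', forall x y, `|F x y + M| <= M'.
    exists (M + M) => x y; apply: le_trans (ler_normD _ _) _.
    by rewrite lerD// (ger0_norm (le_trans _ (FM 0 0))).
  have bF x : bd (F x) by exists M.
  have bF' y : bd (F ^~ y) by exists M.
  have := step_mean_Fubini FMz bFM.
  have -> : (fun x => step_mean (fun y => F x y + M)) = (fun x => step_mean (F x) + M).
    by apply/funext => x; rewrite h.
  have -> : (fun y => step_mean (fun x => F x y + M)) = (fun y => step_mean (F ^~ y) + M).
    by apply/funext => y; rewrite h.
  rewrite !h; last 2 first.
  + by exists M => x; exact: b1.
  + by exists M => y; exact: b1.
  by move=> /addIr.
- move=> e e0.
  (* Tightness is continuity from above along events that decrease to the empty set. *)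
  pose A n := [set w | (n < `|int_step 0 w|)%N].
  have mA n : measurable (A n) := measurable_levels_preimage (fun z : int => (n < `|z|)%N) (@measurable_levels_int_step 0).
  have A0 : \bigcap_n A n = set0.
    apply/seteqP; split => // w /(_ `|int_step 0 w|%N I) /=.
    by rewrite /A/= ltnn.
  have h : P (A n) @[n --> \oo] --> 0%E.
    rewrite -(measure0 P) -A0; apply: nonincreasing_cvg_mu => //; first by rewrite -ge0_fin_numE// fin_num_measure.
    - by rewrite A0.
  - by move=> n m nm; apply/subsetPset => w /=; exact: leq_ltn_trans.
  have h2 : fine (P (A n)) @[n --> \oo] --> (0 : R) by apply: fine_cvg.
  have [n _ hn] := cvgr_le _ h2 _ e0.
  exists n; have /= := hn n (leqnn n); apply: le_trans.
  rewrite /step_mean /Rintegral; under eq_integral.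
    move=> w _; rewrite (_ : (_%:R)%:E = (\1_(A n) w)%:E).
      over.
    by rewrite indicE /A; congr (((nat_of_bool _)%:R)%:E); apply/idP/idP; rewrite inE.
  by rewrite integral_indic// setIT.
Qed.

Lemma integral_event (A : countType) (Y : T -> A) a (c : R) : measurable_levels Y -> 0 <= c ->
  (\int[P]_w ((Y w == a)%:R * c)%:E = P [set w | Y w = a] * c%:E)%E.
Proof.
move=> mY c0; rewrite muleC.
transitivity (\int[P]_w (c%:E * (\1_[set w | Y w = a] w)%:E))%E.
  apply: eq_integral => w _; rewrite indicE -EFinM mulrC; congr ((_ * (nat_of_bool _)%:R)%:E).
  by apply/eqP/idP; rewrite inE.
rewrite ge0_integralZl_EFin//; last first.
  by apply/measurable_EFinP; apply: measurable_indic; exact: mY.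
by rewrite integral_indic ?setIT//; exact: mY.
Qed.

(* The prefix is carried along so that the induction step can use the
   independence of the first [k + 1] steps. *)
Lemma integral_prefix m k s (f : seq int -> R) : size s = k -> (forall t, 0 <= f t) -> bn m f ->
  (\int[P]_w ((int_path 0 k w == s)%:R * f (int_path k m w))%:E =
   P [set w | int_path 0 k w = s] * (Es step_mean m f)%:E)%E.
Proof.
elim: m k s f => [|m IHm] k s f sk f0 bf.
  exact: (integral_event s (@measurable_levels_int_path 0 k) (f0 [::])).
have hE := averaging_step_mean.
pose F z w := (int_path 0 k w == s)%:R * f (z :: int_path k.+1 m w).
have mF z : measurable_fun setT (F z).
  apply: measurable_funM.
    exact: (measurable_fun_levels (fun t => (t == s)%:R : R)) (@measurable_levels_int_path 0 k).
  exact: (measurable_fun_levels (fun t => f (z :: t))) (@measurable_levels_int_path k.+1 m).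
have F0 z w : 0 <= F z w by rewrite mulr_ge0.
transitivity (\int[P]_w (F (int_step k w) w)%:E)%E; first by [].
rewrite (integral_countable _ (@measurable_levels_int_step k) mF F0).
(* Both sides are summed over the value [z] of the next step; on each value the prefix grows by [z]
   and the induction hypothesis applies. *)
pose h z := Es step_mean m (fun t => f (z :: t)).
have h0 z : 0 <= h z by apply: (Es_ge0 hE) => //; bdd.
have hb : bd h by exact: bd_Es_cons.
rewrite -[RHS]/(_ * (step_mean h)%:E)%E -(step_mean_fin hb).
rewrite (integral_countable (F := fun z _ => h z) _ (@measurable_levels_int_step 0))//.
rewrite -[P _]fineK ?fin_num_measure//; last exact: (@measurable_levels_int_path 0 k).
rewrite -nneseriesZl; last first.
  by move=> j _; case: (pickle_inv j) => //= z; apply: integral_ge0 => w _; rewrite lee_fin mulr_ge0.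
apply: eq_eseriesr => j _; case: (pickle_inv j) => [z|]/=; last by rewrite mule0.
rewrite (integral_event _ (@measurable_levels_int_step 0))// muleA fineK ?fin_num_measure//; last exact: (@measurable_levels_int_path 0 k).
rewrite -int_path_rcons// -IHm ?size_rcons ?sk//; last by bdd.
apply: eq_integral => w _; rewrite /F mulrA; congr (_ * _)%:E.
rewrite -natrM mulnb andbC; congr ((nat_of_bool _)%:R).
by rewrite /int_path -[in RHS]addn1 iotaD map_cat cats1 eqseq_rcons add0n.
Qed.

Lemma integrable_int_path n (f : seq int -> R) : bn n f ->
  P.-integrable setT (EFin \o (fun w => f (int_path 0 n w))).
Proof.
move=> [M fM]; apply: integrable_levels; first exact: measurable_levels_int_path.
by exists M => w; rewrite fM// size_map size_iota.
Qed.

Lemma Rintegral_int_path n (f : seq int -> R) : bn n f -> \int[P]_w f (int_path 0 n w) = Es step_mean n f.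
Proof.
move=> bf; have [M fM] := bf; have hE := averaging_step_mean.
have M0 : 0 <= M by apply: le_trans (fM (nseq n 0) _); rewrite ?size_nseq.
(* [integral_prefix] asks for non-negativity on all lists, while the bound on [f] holds at length
   [n] only. *)
pose f' s := if size s == n then f s + M else 0.
have f'0 s : 0 <= f' s.
  rewrite /f'; case: eqP => // /fM; rewrite ler_norml => /andP[+ _].
  by rewrite -lerBlDr sub0r.
have bf' : bn n f'.
  exists (M + M) => s sn; rewrite /f' sn eqxx (le_trans (ler_normD _ _))// lerD ?fM//.
  by rewrite ger0_norm.
have := @integral_prefix n 0 [::] f' erefl f'0 bf'.
rewrite (_ : [set w | _] = setT) ?probability_setT ?mul1e; last exact/seteqP.
have -> : Es step_mean n f' = Es step_mean n f + M.
  rewrite -[X in _ + X](Es_cst hE n) -(EsD hE); [|by bdd..].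
  by apply: Es_ext => s sn; rewrite /f' sn eqxx.
move=> h; have {h} : \int[P]_w f' (int_path 0 n w) = Es step_mean n f + M.
  rewrite /Rintegral; apply: EFin_inj; rewrite fineK.
    by rewrite -h; apply: eq_integral => w _; rewrite mul1r.
  exact: integrable_fin_num (integrable_int_path bf').
have -> : (fun w => f' (int_path 0 n w)) = (fun w => f (int_path 0 n w) + M).
  by apply/funext => w; rewrite /f' size_map size_iota eqxx.
rewrite RintegralD//; [|exact: integrable_int_path|exact: finite_measure_integrable_cst].
have -> : \int[P]_(x in setT) M = M by exact: (step_mean_cst M).
by move=> /addIr.
Qed.

Lemma Ps_int_path n (b : seq int -> bool) : P [set w | b (int_path 0 n w)] = (Ps step_mean n b)%:E.
Proof.
rewrite /Ps -Rintegral_int_path; last by bdd.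
rewrite /Rintegral fineK; last first.
  by apply: integrable_fin_num => //; apply: (@integrable_int_path n (fun s => (b s)%:R)); bdd.
have mb : measurable [set w | b (int_path 0 n w)] := measurable_levels_preimage (fun t => b t) (@measurable_levels_int_path 0 n).
transitivity (\int[P]_w (\1_[set w | b (int_path 0 n w)] w)%:E)%E.
  by rewrite integral_indic// setIT.
apply: eq_integral => w _; rewrite indicE; congr (((nat_of_bool _)%:R)%:E).
by apply/idP/idP; rewrite inE.
Qed.

End law.

(** * Ladder epochs *)

Section ladder_epochs.
Context {R : realType}.
Implicit Type s : nat -> R.

Definition record_at s k := all (fun i => s i < s k) (iota 0 k).

Lemma record_atP s k : reflect (forall i, (i < k)%N -> s i < s k) (record_at s k).
Proof.
by apply: (iffP allP) => h i; have := h i; rewrite mem_iota.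
Qed.

Lemma first_timeP (p : pred nat) n :
  first_time p = Some n <-> p n /\ forall m, (m < n)%N -> ~~ p m.
Proof.
rewrite /first_time; case: pselect => [h|h]; last first.
  by split => // -[pn _]; case: h; exists n.
case: ex_minnP => m pm minm; split => [[<-]|[pn hn]].
  by split => // k km; apply: contraL km => /minm; rewrite -leqNgt.
congr Some; apply/eqP; rewrite eqn_leq minm//= leqNgt.
by apply: contraL pm => /hn.
Qed.

Lemma record_count_next s t n : (t < n)%N -> record_at s t ->
  (forall m, (t < m < n)%N -> ~~ record_at s m) ->
  count (record_at s) (iota 0 n) = (count (record_at s) (iota 0 t)).+1.
Proof.
move=> tn rt hm; have -> : n = (t + 1 + (n - t.+1))%N by move: tn; clear; lia.
rewrite !iotaD !count_cat !add0n.
have -> : count (record_at s) (iota t 1) = 1%N by rewrite /= rt.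
rewrite (_ : count _ (iota _ (n - t.+1)) = 0%N) ?addn0 ?addn1//.
apply/eqP; rewrite -leqn0 leqNgt -has_count; apply/hasPn => m.
by rewrite mem_iota => h; apply: hm; move: h tn; clear; lia.
Qed.

(** After a record at [t], the first value above [s t] exceeds everything before it, so it is the
    next record, and conversely. *)
Lemma record_next s t n : record_at s t -> (t < n)%N ->
  (s t < s n /\ forall m, (t < m < n)%N -> s m <= s t) <->
  (record_at s n /\ forall m, (t < m < n)%N -> ~~ record_at s m).
Proof.
move=> /record_atP rt tn; split => [[stn hm]|[/record_atP rn hm]].
  split.
    apply/record_atP => i ilt; have [it|ti|->//] := ltngtP i t.
      exact: lt_trans (rt _ it) stn.
    by apply: le_lt_trans stn; apply: hm; rewrite ti.
  move=> m /andP[tm mn]; apply/negP => /record_atP /(_ t tm).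
  by rewrite ltNge hm// tm.
split; first exact: rn.
(* Strong induction: if all values between [t] and [m] are at most [s t] and [s m] is larger, then
   [m] is a record. *)
move=> m; have [k] := ubnP m; elim: k m => // k IHk m mk /andP[tm mn].
rewrite leNgt; apply/negP => stm.
suff : record_at s m by apply/negP/hm; rewrite tm.
apply/record_atP => i im; have [it|ti|->//] := ltngtP i t.
  exact: lt_trans (rt _ it) stm.
apply: le_lt_trans stm; apply: IHk; last by rewrite ti (ltn_trans im).
exact: leq_trans im _.
Qed.

(** Epoch 0 is time 0, vacuously a record, and every further epoch is the next record; so the index
    of an epoch is the number of records before it. This removes the recursion from all ladder
    events. *)
Lemma ladder_epochE s r n :
  ladder_epoch s r = Some n <-> record_at s n /\ count (record_at s) (iota 0 n) = r.
Proof.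
elim: r n => [|r IHr] n /=.
  by split => [[<-]//|[_]]; case: n => // n; rewrite /= add1n.
split.
  case E : (ladder_epoch s r) => [t|]//.
  have [rt ct] := (IHr t).1 E.
  move=> /first_timeP[/andP[tn stn] hm].
  have [|rn hm'] := (record_next rt tn).1.
    split => // m /andP[tm mn]; rewrite leNgt; apply: contra (hm _ mn) => ->.
    by rewrite tm.
  by split => //; rewrite (record_count_next tn rt hm') ct.
move=> [rn cn].
have [t [tn rt hm]] : exists t, [/\ (t < n)%N, record_at s t & forall m, (t < m < n)%N -> ~~ record_at s m].
  have ex : exists t, (t < n)%N && record_at s t.
    have : (0 < count (record_at s) (iota 0 n))%N by rewrite cn.
    rewrite -has_count => /hasP[t]; rewrite mem_iota/= => tn rt.
    by exists t; rewrite tn.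
  have bt t : (t < n)%N && record_at s t -> (t <= n)%N by case/andP => /ltnW.
  case: (ex_maxnP ex bt) => t /andP[tn rt] tm; exists t; split => // m /andP[ltm mn].
  by apply/negP => rm; have := tm m; rewrite mn rm leqNgt ltm => /(_ isT).
have ct : count (record_at s) (iota 0 t) = r.
  by have := record_count_next tn rt hm; rewrite cn => -[].
rewrite (IHr t).2//; apply/first_timeP.
have [stn hle] := (record_next rt tn).2 (conj rn hm).
split; first by rewrite tn.
move=> m mn; apply/negP => /andP[tm stm].
by have := hle m; rewrite tm mn leNgt stm => /(_ isT).
Qed.

End ladder_epochs.

Lemma lad_iota (y : nat -> int) k m :
  lad [seq y i | i <- iota k m] =
  all (fun i => sumz [seq y j | j <- iota 0 i] < sumz [seq y j | j <- iota 0 (k + m)]) (iota k m).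
Proof.
elim: m k => //= m IHm k; rewrite IHm addSnnS; congr (_ && _).
by rewrite iotaD map_cat sumz_cat add0n ltrDl /= sumz_cons.
Qed.

Lemma sumz_lad_ge0 s : lad s -> 0 <= sumz s.
Proof. by case: s => [|z s] /=; rewrite ?sumz_nil// sumz_cons => /andP[/ltW]. Qed.

Lemma cnt_take (R : realType) (s : seq int) (y : nat) :
  (cnt s y)%:R = \sum_(k < (size s).+1) (lad (take k s) && (sumz (take k s) <= y%:Z - 1))%:R :> R.
Proof.
rewrite natr_cnt// !lam_take !natr_sum -sumrB; apply: eq_bigr => k _.
case E : (lad (take k s)); rewrite /= ?subr0//.
have := sumz_lad_ge0 E; rewrite [(_ - 1 < _)%R]ltNge; move: (sumz (take k s)) => S S0.
rewrite (_ : -1 < S) ?(lt_le_trans _ S0)//.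
by case: (S <= _); rewrite /= ?subr0 ?subrr.
Qed.

(** Exhibits [Vn] as a partial sum of the renewal series, which identifies [Vlim y] with U(y - 1) in
    the limit. *)
Lemma Vn_sum (R : realType) (E : (int -> R) -> R) (hE : averaging E) N (y : nat) :
  Vn E N y = \sum_(k < N.+1) Ps E k (fun s => lad s && (sumz s <= y%:Z - 1)).
Proof.
rewrite /Vn; transitivity (Es E N (fun s => \sum_(k < N.+1)
    (lad (take k s) && (sumz (take k s) <= y%:Z - 1))%:R)).
  by apply: Es_ext => s sN; rewrite cnt_take sN.
rewrite (Es_sum hE); last by move=> k; bdd.
apply: eq_bigr => k _.
have kN : (k <= N)%N by rewrite -ltnS.
exact: (Es_take hE (fun t => (lad t && (sumz t <= y%:Z - 1))%:R) kN).
Qed.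

(** * Ladder events as record events *)

Section ladder_measure.
Context (d : measure_display) (T : measurableType d) (R : realType) (P : probability T R).
Variable X : nat -> {RV P >-> R}.
Hypothesis X_iid : iid X.
Local Notation W w := (walk X ^~ w).

Lemma measurable_walk n : measurable_fun setT (walk X n).
Proof. by apply: measurable_sum => i; exact: measurable_funP. Qed.

Lemma measurable_levels_record n : measurable_levels (fun w => record_at (W w) n).
Proof.
pose c w := [seq walk X i w < walk X n w | i <- iota 0 n].
have -> : (fun w => record_at (W w) n) = (fun w => all id (c w)).
  by apply/funext => w; rewrite all_map.
apply: measurable_levels_comp; apply: measurable_levels_map => i b.
rewrite -[X in measurable X]setTI.
exact: (measurable_fun_ltr (measurable_walk i) (measurable_walk n)) measurableT [set b] I.
Qed.

Definition epoch_event r n := [set w | ladder_epoch (W w) r = Some n].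

Lemma measurable_epoch r n : measurable (epoch_event r n).
Proof.
pose c w := [seq record_at (W w) i | i <- iota 0 n].
have mc : measurable_levels c by apply: measurable_levels_map => i; exact: measurable_levels_record.
rewrite (_ : epoch_event r n = [set w | record_at (W w) n] `&` [set w | count id (c w) = r]).
  apply: measurableI; first exact: (@measurable_levels_record n true).
  exact: (measurable_levels_preimage (fun s => count id s = r)) mc.
by apply/seteqP; split => w; rewrite /epoch_event/= /c count_map; move=> /ladder_epochE.
Qed.

(** The index [r] is determined by the number of earlier records, so the epoch events are disjoint
    in [r] and make up the record event. *)
Lemma sum_epoch n B : measurable B ->
  (\sum_(0 <= r <oo) P (epoch_event r n `&` B) = P ([set w | record_at (W w) n] `&` B))%E.
Proof.
move=> mB; rewrite -measure_semi_bigcup.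
- congr (P _); rewrite -setI_bigcupl; congr (_ `&` _); apply/seteqP; split => w /=.
    by move=> [r _ /ladder_epochE[]].
  by move=> rw; exists (count (record_at (W w)) (iota 0 n)) => //; apply/ladder_epochE.
- by move=> r; apply: measurableI => //; exact: measurable_epoch.
- move=> r r' _ _ [w [[/ladder_epochE[_ <-] _] [/ladder_epochE[_ <-] _]]] //.
- apply: bigcup_measurable => r _; apply: measurableI => //; exact: measurable_epoch.
Qed.

Lemma measurable_walk_set n (A : set R) : measurable A -> measurable [set w | A (walk X n w)].
Proof. by move=> mA; rewrite -[X in measurable X]setTI; exact: (@measurable_walk n) measurableT A mA. Qed.

Lemma ladder_mass_record n (x : int) :
  ladder_mass X n x = P ([set w | record_at (W w) n] `&` [set w | walk X n w = x%:~R]).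
Proof.
rewrite -sum_epoch; last exact: (@measurable_walk_set n [set x%:~R]).
apply: eq_eseriesr => r _; congr (P _); rewrite /ladder_height.
by apply/seteqP; split => w [/= e]; rewrite /epoch_event/= e; [case=> ->|move=> ->].
Qed.

Lemma ladder_height_renewal_record (y : R) :
  ladder_height_renewal X y =
  (\sum_(0 <= n <oo) P ([set w | record_at (W w) n] `&` [set w | (walk X n w <= y)%R]))%E.
Proof.
have mB n : measurable [set w | walk X n w <= y].
  have := @measurable_walk_set n `]-oo, y]%classic (measurable_itv _).
  by congr (measurable _); apply/seteqP; split => w /=; rewrite in_itv.
transitivity (\sum_(0 <= r <oo) \sum_(0 <= n <oo) P (epoch_event r n `&` [set w | (walk X n w <= y)%R]))%E.
  apply: eq_eseriesr => r _; rewrite -measure_semi_bigcup.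
  - congr (P _); apply/seteqP; split => w /=.
      rewrite /ladder_height; case E : ladder_epoch => [n|]; last by rewrite leye_eq.
      by rewrite lee_fin => h; exists n.
    by move=> [n _ [e h]]; rewrite /ladder_height e lee_fin.
  - by move=> n; apply: measurableI => //; exact: measurable_epoch.
  - by move=> n n' _ _ [w [[/= + _] [/= + _]]]; rewrite /epoch_event/= => -> [].
  - by apply: bigcup_measurable => n _; apply: measurableI => //; exact: measurable_epoch.
rewrite nneseries_interchange//.
by apply: eq_eseriesr => n _; rewrite sum_epoch.
Qed.

End ladder_measure.

(** * From the real walk to integer paths *)

Section lattice_walk.
Context (d : measure_display) (T : measurableType d) (R : realType) (P : probability T R).
Variable X : nat -> {RV P >-> R}.
Hypothesis X_iid : iid X.
Hypothesis X_int : P (X 0%N @^-1` int_multiples 1) = 1%E.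
Local Notation W w := (walk X ^~ w).
Local Notation E := (step_mean X).
Local Notation Pr := (Ps E).
Let hE := averaging_step_mean X.

Lemma measurable_ints : measurable (int_multiples 1 : set R).
Proof.
rewrite (_ : int_multiples 1 = \bigcup_(k : nat) ([set k%:R] `|` [set - k%:R])).
  by apply: bigcupT_measurable => k; apply: measurableU; exact: measurable_set1.
apply/seteqP; split => x.
  move=> [[k|k] _ <-]; first by exists k => //; left; rewrite /= mul1r.
  by exists k.+1 => //; right; rewrite /= mul1r NegzE mulrNz.
move=> [k _ [->|->]].
  by exists k%:Z => //; rewrite mul1r.
by exists (- k%:Z) => //; rewrite mul1r mulrNz.
Qed.

(* Almost surely all steps are integers, but the walk is only measurable as a
   real function; off [nonint] it agrees with the sums of [int_path]. *)
Definition nonint := \bigcup_i (X i @^-1` (~` int_multiples 1)).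

Let mint i : measurable (X i @^-1` int_multiples 1).
Proof.
by rewrite -[X in measurable X]setTI; exact: (measurable_funP (X i)) measurableT _ measurable_ints.
Qed.

Lemma measurable_nonint : measurable nonint.
Proof.
by apply: bigcupT_measurable => i; rewrite preimage_setC; apply: measurableC; exact: mint.
Qed.

Lemma prob_nonint0 : P nonint = 0%E.
Proof.
apply/eqP; rewrite -measure_le0.
apply: le_trans (measure_sigma_subadditive P _ measurable_nonint (@subset_refl _ _)) _.
  by move=> i; rewrite preimage_setC; apply: measurableC; exact: mint.
rewrite eseries0// => i _ _; rewrite preimage_setC.
transitivity (1 - P (X i @^-1` int_multiples 1))%E; first by apply: probability_setC; exact: mint.
suff -> : P (X i @^-1` int_multiples 1) = 1%E by rewrite subee.
have [_ /(_ i 0%N _ measurable_ints)] := X_iid.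
by rewrite -X_int.
Qed.

Lemma int_stepE w i : ~ nonint w -> X i w = (int_step X i w)%:~R.
Proof.
move=> nw; have /= [k _ xk] : int_multiples 1 (X i w).
  by apply: contrapT => h; apply: nw; exists i.
by rewrite /int_step -xk mul1r intrKfloor.
Qed.

Lemma walk_int w n : ~ nonint w -> walk X n w = (sumz (int_path X 0 n w))%:~R.
Proof.
move=> nw; rewrite /walk /sumz /int_path big_map rmorph_sum/= -(big_mkord xpredT (X ^~ w)) /index_iota subn0.
by apply: eq_bigr => i _; exact: int_stepE.
Qed.

Lemma record_int w n : ~ nonint w -> record_at (W w) n = lad (int_path X 0 n w).
Proof.
move=> nw; rewrite /int_path lad_iota add0n; apply: eq_in_all => i _.
by rewrite !walk_int// ltr_int.
Qed.

Lemma prob_eq_off_nonint (A B : set T) : measurable A -> measurable B ->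
  (forall w, ~ nonint w -> A w <-> B w) -> P A = P B.
Proof.
suff h (A' B' : set T) : measurable A' -> measurable B' -> (forall w, ~ nonint w -> A' w -> B' w) ->
    (P A' <= P B')%E.
  move=> mA mB AB; apply/eqP; rewrite eq_le !h// => w nw; by rewrite AB.
move=> mA mB AB; apply: (@le_trans _ _ (P (B' `|` nonint))).
  apply: le_measure; rewrite ?inE//; first by apply: measurableU => //; exact: measurable_nonint.
  by move=> w Aw; have [?|nw] := pselect (nonint w); [right|left; exact: AB].
apply: le_trans (measureU2 _ mB measurable_nonint) _.
by rewrite [X in (_ + X)%E]prob_nonint0 adde0.
Qed.

Lemma measurable_path_event n (b : seq int -> bool) : measurable [set w | b (int_path X 0 n w)].
Proof. exact: (measurable_levels_preimage (fun t => b t)) (@measurable_levels_int_path _ _ _ _ X 0 n). Qed.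

Lemma walk_prob n (x : int) : P [set w | walk X n w = x%:~R] = (Pr n (fun s => sumz s == x))%:E.
Proof.
rewrite -Ps_int_path//; apply: prob_eq_off_nonint.
- exact: (@measurable_walk_set _ _ _ _ X n [set x%:~R]).
- exact: (@measurable_path_event n (fun s => sumz s == x)).
- by move=> w nw /=; rewrite walk_int//; split => [/intr_inj ->|/eqP ->].
Qed.

Lemma record_prob n (b : int -> bool) (B : set R) : measurable B ->
  (forall z, B z%:~R <-> b z) ->
  P ([set w | record_at (W w) n] `&` [set w | B (walk X n w)]) =
  (Pr n (fun s => lad s && b (sumz s)))%:E.
Proof.
move=> mB Bb; rewrite -Ps_int_path//; apply: prob_eq_off_nonint.
- apply: measurableI; first exact: (@measurable_levels_record _ _ _ _ X n true).
  exact: measurable_walk_set.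
- exact: (@measurable_path_event n (fun s => lad s && b (sumz s))).
- move=> w nw /=; rewrite walk_int// Bb -record_int//.
  by split => [[-> ->]//|/andP[]].
Qed.

Lemma ladder_massE n (x : int) :
  ladder_mass X n x = (Pr n (fun s => lad s && (sumz s == x)))%:E.
Proof.
rewrite ladder_mass_record (@record_prob n (fun z => z == x) [set x%:~R])//.
by move=> z /=; split => [/intr_inj ->|/eqP ->].
Qed.

Lemma renewalE (y : nat) : ladder_height_renewal X (y%:Z - 1)%:~R = (Vlim E y)%:E.
Proof.
rewrite ladder_height_renewal_record.
under eq_eseriesr.
  move=> n _; rewrite (@record_prob n (fun z => z <= y%:Z - 1) [set u | u <= (y%:Z - 1)%:~R]).
  - over.
  - have := measurable_itv (`]-oo, (y%:Z - 1)%:~R] : interval R).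
    by congr (measurable _); apply/seteqP; split => w /=; rewrite in_itv.
  - by move=> z /=; rewrite ler_int.
(* The sum over times [0 .. N] is [Vn E N y], hence the shift by one. *)
apply/cvg_lim => //; rewrite -cvg_shiftS.
rewrite (_ : (fun n => _) = EFin \o (fun n => Vn E n y)).
  by apply: cvg_EFin; [exact: nearW|exact: V_cvg].
by apply/funext => n /=; rewrite Vn_sum// big_mkord -sumEFin.
Qed.

Lemma expectation_walk n (c : R) (h : R -> R) : measurable_fun setT h -> (exists M, forall x, `|h x| <= M) ->
  ('E_P[h \o (fun w => (walk X n w / c)%R)] = (Es E n (fun s => h ((sumz s)%:~R / c)%R))%:E)%E.
Proof.
move=> mh [M hM]; rewrite unlock.
have bf : bn n (fun s => h ((sumz s)%:~R / c)) by exists M.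
rewrite -Rintegral_int_path// /Rintegral fineK; last first.
  by apply: integrable_fin_num => //; exact: (integrable_int_path X bf).
apply: ae_eq_integral => //.
- apply/measurable_EFinP; apply: measurableT_comp => //.
  by apply: measurable_funM => //; exact: measurable_walk.
- exact: measurable_int (integrable_int_path X bf).
- exists nonint; split; [exact: measurable_nonint|exact: prob_nonint0|].
  move=> w /= h1; apply: contrapT => nw; apply: h1 => _ /=.
  by rewrite walk_int.
Qed.

End lattice_walk.

(** * Consequences of weak convergence *)

Section central_limit.
Context (d : measure_display) (T : measurableType d) (R : realType) (P : probability T R).
Variables (X : nat -> {RV P >-> R}) (a : nat -> R).
Hypothesis X_iid : iid X.
Hypothesis X_int : P (X 0%N @^-1` int_multiples 1) = 1%E.
Hypothesis a_gt0 : forall n, (0 < n)%N -> 0 < a n.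
Hypothesis clt : weakly_converges P (fun n w => walk X n w / a n) (normal_prob 0 1).
Local Notation E := (step_mean X).
Local Notation Pr := (Ps E).
Let hE := averaging_step_mean X.

Lemma fin_num_normal (h : R -> R) : continuous h -> (exists M, forall x, `|h x| <= M) ->
  (\int[normal_prob 0 1]_x (h x)%:E)%E \is a fin_num.
Proof.
move=> ch [M hM]; apply: integrable_fin_num => //.
apply: (@le_integrable _ _ _ _ setT measurableT _ (cst M%:E)) => //.
- by apply/measurable_EFinP; exact: continuous_measurable_fun.
- by move=> w _; rewrite lee_fin (le_trans (hM w))// ler_norm.
- exact: finite_measure_integrable_cst.
Qed.

Lemma clt_Es (h : R -> R) : continuous h -> (exists M, forall x, `|h x| <= M) ->
  Es E n (fun s => h ((sumz s)%:~R / a n)) @[n --> \oo] -->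
  fine (\int[normal_prob 0 1]_x (h x)%:E)%E.
Proof.
move=> ch bh; have := clt ch bh.
rewrite -[X in _ --> X]fineK ?fin_num_normal// => /fine_cvg.
apply: cvg_trans; apply: near_eq_cvg; apply: nearW => n /=.
by rewrite expectation_walk//; exact: continuous_measurable_fun.
Qed.

Lemma clt_cos_affine (c th : R) :
  Es E n (fun s => cos (th * ((sumz s)%:~R / a n) + c)) @[n --> \oo] -->
  cos c * expR (- (th ^+ 2 / 2)).
Proof.
have := clt_Es (@continuous_cos_affine _ th c); rewrite normal_cos; apply.
by exists 1 => x; exact: cos_max.
Qed.

Lemma clt_cos th :
  Es E n (fun s => cos (th / a n * (sumz s)%:~R)) @[n --> \oo] --> expR (- (th ^+ 2 / 2)).
Proof.
have := @clt_cos_affine 0 th; rewrite cos0 mul1r; apply: cvg_trans.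
apply: near_eq_cvg; apply: nearW => n; apply: Es_ext => s _.
by rewrite addr0 mulrA mulrAC.
Qed.

Lemma clt_sin th :
  Es E n (fun s => sin (th / a n * (sumz s)%:~R)) @[n --> \oo] --> (0 : R).
Proof.
have := @clt_cos_affine (pi / 2) th; rewrite cos_pihalf mul0r => h.
rewrite (_ : (fun n => _) = (fun n =>
    - Es E n (fun s => cos (th * ((sumz s)%:~R / a n) + pi / 2)))).
  by rewrite -oppr0; exact: cvgN.
apply/funext => n; rewrite -(EsN hE); last by bdd.
by apply: Es_ext => s _; rewrite cosDpihalf opprK mulrA mulrAC.
Qed.

Lemma clt_tail e : 0 < e -> exists2 L, 0 < L &
  \forall n \near \oo, Pr n (fun s => L * a n < `|(sumz s)%:~R|) <= e.
Proof.
move=> e0; have [L L0 HL] := normal_tail (divr_gt0 e0 (ltr0n R 2)).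
have bL : exists M, forall x : R, `|Num.min 1 (`|x| / L)| <= M.
  by exists 1 => x; have /andP[h1 h2] := tail_bound x L0; rewrite ger0_norm.
have cL := @continuous_tail _ L.
have [|n1 _ H1] := cvgr_lt _ (clt_Es cL bL) e.
  rewrite -lte_fin fineK ?fin_num_normal//; apply: le_lt_trans HL _.
  by rewrite lte_fin; lra.
exists L => //; exists n1.+1 => // n /= nn.
have an : 0 < a n by rewrite a_gt0// (leq_ltn_trans _ nn).
apply: le_trans (ltW (H1 n (ltnW nn))); apply: (Es_le hE); first by bdd.
  by have [M hM] := bL; exists M => s _.
move=> s _; have /andP[h1 h2] := tail_bound ((sumz s)%:~R / a n) L0.
case: ltP => //= h; rewrite le_min lexx/= ler_pdivlMr// mul1r normrM normfV (gtr0_norm an).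
by rewrite ler_pdivlMr// ltW.
Qed.

Lemma clt_mass K : 0 < K -> exists2 g, 0 < g & forall al be : R,
  - K <= al -> al < be -> be <= K ->
  \forall n \near \oo, g * (be - al) <=
    Pr n (fun s => (al * a n <= (sumz s)%:~R) && ((sumz s)%:~R <= be * a n)).
Proof.
(* Half of the constant of [normal_tent], so that the limit lies strictly above the required
   bound. *)
move=> K0; exists (normal_pdf 0 1 K / 8) => [|al be Kal ab beK].
  by rewrite divr_gt0// std_normal_pdf_gt0.
have bt : exists M, forall x, `|tent al be x| <= M.
  exists 1 => x; have /andP[h1 h2] := tent_bound x ab; rewrite ger0_norm//.
  by apply: le_trans h2 _; case: (_ && _).
have [|n1 _ H1] := cvgr_gt _ (clt_Es (@continuous_tent _ al be) bt) (normal_pdf 0 1 K / 8 * (be - al)).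
  rewrite -lte_fin fineK; last by apply: fin_num_normal => //; exact: continuous_tent.
  apply: lt_le_trans (normal_tent Kal ab beK); rewrite lte_fin ltr_pM2r ?subr_gt0//.
  by have := std_normal_pdf_gt0 K; lra.
exists n1.+1 => // n /= nn.
have an : 0 < a n by rewrite a_gt0// (leq_ltn_trans _ nn).
apply: le_trans (ltW (H1 n (ltnW nn))) _; apply: (Es_le hE); last 1 first.
- move=> s _; have /andP[_ h2] := tent_bound ((sumz s)%:~R / a n) ab.
  by apply: le_trans h2 _; rewrite ler_pdivlMr// ler_pdivrMr.
- by have [M hM] := bt; exists M => s _.
- by bdd.
Qed.

End central_limit.

Theorem theorem4 (d : measure_display) (T : measurableType d) (R : realType)
    (P : probability T R) (X : nat -> {RV P >-> R}) (a : nat -> R)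
    (X_iid : iid X)
    (a_gt0 : forall n : nat, (0 < n)%N -> 0 < a n)
    (clt : weakly_converges P (fun n w => walk X n w / a n)
             (normal_prob 0 1))
    (X_arith : arithmetic_span1 P (X 0%N)) :
  forall eps delta : R, 0 < eps -> 0 < delta ->
  exists n0 : nat, forall (n : nat) (x : int), (n0 <= n)%N ->
    eps <= x%:~R / a n <= eps^-1 ->
    let main := ((n%:R^-1)%:E * P [set w | walk X n w = x%:~R]
                 * ladder_height_renewal X (x - 1)%:~R)%E in
    (`| ladder_mass X n x - main | <= delta%:E * main)%E.
Proof.
move=> eps delta eps0 delta0; have [X_int _] := X_arith.
have [n0 _ H] := ladder_mass_asymp (averaging_step_mean X) a_gt0 (clt_cos X_iid X_int clt)
  (clt_sin X_iid X_int clt) (clt_tail X_iid X_int a_gt0 clt)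
  (clt_mass X_iid X_int a_gt0 clt) eps0 delta0.
exists n0.+1 => n x nn xn /=.
have n_gt0 : (0 < n)%N by apply: leq_ltn_trans nn.
have nR : 0 < n%:R :> R by rewrite ltr0n.
have an := a_gt0 n n_gt0.
have x0 : 0 < x.
  have /andP[h _] := xn; have : 0 < x%:~R / a n by apply: lt_le_trans h.
  by rewrite pmulr_lgt0 ?invr_gt0// ltr0z.
(* [x / a n >= eps] makes [x] positive, hence a natural number. *)
case: x x0 xn => // y y0 xn.
rewrite (walk_prob X_iid X_int) (ladder_massE X_iid X_int) (renewalE X_iid X_int).
rewrite -!EFinM -EFinB abse_EFin lee_fin.
have := H n (ltnW nn) y xn.
set u := Ps _ _ _; set p := Ps _ _ _; set v := Vlim _ _ => h.
rewrite -(ler_pM2l nR) -{1}(gtr0_norm nR) -normrM.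
have -> : n%:R * (u - n%:R^-1 * p * v) = n%:R * u - p * v by field; rewrite gt_eqF.
by have -> : n%:R * (delta * (n%:R^-1 * p * v)) = delta * (p * v) by field; rewrite gt_eqF.
Qed.
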